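(* For any integer $d \geq 1$ and any $\epsilon > 0$, there is an algorithm that, given a finite set $\mathcal C \subseteq \mathbb R^d$ and an integer $k>0$, computes a $(1+\epsilon)$-approximate solution to $k$-center on $\mathcal C$, with running time $$O\!\left(|\mathcal C| \cdot k \cdot (1/\epsilon)^{O(d)} + 2^{O\left((1/\epsilon)^{O(d)} \cdot k^{1-1/d} \cdot \log k + d \log d\right)}\right).$$
   Context: Euclidean $k$-center: given a finite set $\mathcal C\subseteq\mathbb R^d$ and an integer $k>0$, find a set $F \subseteq \mathbb R^d$ of $k$ points minimizing $\max_{p \in \mathcal C} \min_{c\in F}\|p-c\|$ (Euclidean norm). A $(1+\epsilon)$-approximate solution is a feasible $F$ whose cost is at most $(1+\epsilon)$ times the optimum. Here every $O(\cdot)$ suppresses only absolute constants, independent of $d$ and $\epsilon$.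
   Formalization: For ε > 1/2 the terms (1/ε)^{O(d)} are replaced by their value at ε = 1/2; with absolute constants the literal bound fails, e.g. at ε = 1, k = 2, where it would not cover reading all |C|·d coordinates for large d. *)

(* Defs.v *)
(* MathComp / MathComp-Analysis; the reals are an arbitrary R : realType. *)
From HB Require Import structures.
From mathcomp Require Import all_boot all_order all_algebra.
From mathcomp Require Import all_classical all_reals all_analysis.

Set Implicit Arguments.
Unset Strict Implicit.
Unset Printing Implicit Defensive.

Import Order.TTheory GRing.Theory Num.Theory.
Local Open Scope classical_set_scope.
Local Open Scope ring_scope.

(* The library norm `|x| on row vectors is the sup norm, hence this one. *)
Definition enorm (R : realType) (d : nat) (x : 'rV[R]_d) : R :=
  Num.sqrt (\sum_(j < d) x ord0 j ^+ 2).

(* Finite sets of points are given by duplicate-free sequences.  F is only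
   used when nonempty, so the default value of the minimum is attained in F;
   the maximum over an empty C is 0. *)
Definition dist_to (R : realType) (d : nat) (F : seq 'rV[R]_d) (p : 'rV[R]_d) : R :=
  \big[Num.min/enorm (p - head 0 F)]_(c <- F) enorm (p - c).

Definition kcenter_cost (R : realType) (d : nat) (C F : seq 'rV[R]_d) : R :=
  \big[Num.max/0]_(p <- C) dist_to F p.

Definition kcenter_feasible (R : realType) (d k : nat) : set (seq 'rV[R]_d) :=
  [set F | uniq F /\ size F = k].
Arguments kcenter_feasible : clear implicits.

Definition kcenter_opt (R : realType) (d : nat) (C : seq 'rV[R]_d) (k : nat) : R :=
  inf [set kcenter_cost C F | F in kcenter_feasible R d k].

Definition kcenter_approx (R : realType) (d : nat) (eps : R)
    (C : seq 'rV[R]_d) (k : nat) (F : seq 'rV[R]_d) : Prop :=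
  kcenter_feasible R d k F /\
  kcenter_cost C F <= (1 + eps) * kcenter_opt C k.

(* Real RAM (deterministic, uniform cost).  There are integer registers and
   real registers, addressed by constants of the program, and an integer
   memory and a real memory, addressed indirectly through integer registers.
   Programs are finite and contain no real constants.  There is no conversion
   from reals to integers (no floor), and the only integer arithmetic is
   addition and truncated subtraction, so that neither of the usual ways of
   cheating with unit-cost arithmetic is available. *)
Inductive rop := RAdd | RSub | RMul | RDiv.

(* In the constructors below n is the integer register file, x the real
   register file, N the integer memory and X the real memory. *)
Inductive instr :=
| NConst (i c : nat)               (* n_i := c *)
| NAdd (i j l : nat)               (* n_i := n_j + n_l *)
| NSub (i j l : nat)               (* n_i := max(n_j - n_l, 0) *)
| NLoad (i j : nat)                (* n_i := N[n_j] *)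
| NStore (i j : nat)               (* N[n_i] := n_j *)
| ROfNat (i j : nat)               (* x_i := n_j *)
| ROp (o : rop) (i j l : nat)      (* x_i := x_j o x_l *)
| RSqrt (i j : nat)                (* x_i := sqrt x_j *)
| RLoad (i j : nat)                (* x_i := X[n_j] *)
| RStore (i j : nat).              (* X[n_i] := x_j *)

Inductive test :=
| NLe (i j : nat)                  (* n_i <= n_j *)
| RLe (i j : nat).                 (* x_i <= x_j *)

Inductive prog :=
| PSkip
| PInstr (a : instr)
| PSeq (P Q : prog)
| PIf (b : test) (P Q : prog)
| PWhile (b : test) (P : prog).

Record state (R : realType) := State {
  nreg : nat -> nat;
  rreg : nat -> R;
  nmem : nat -> nat;
  rmem : nat -> R }.

Definition upd (T : Type) (f : nat -> T) (a : nat) (v : T) : nat -> T :=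
  fun b => if b == a then v else f b.

Definition eval_rop (R : realType) (o : rop) (x y : R) : R :=
  match o with
  | RAdd => x + y
  | RSub => x - y
  | RMul => x * y
  | RDiv => x / y
  end.

Definition eval_test (R : realType) (b : test) (s : state R) : bool :=
  match b with
  | NLe i j => (nreg s i <= nreg s j)%N
  | RLe i j => rreg s i <= rreg s j
  end.

Definition set_nreg (R : realType) (s : state R) (i v : nat) : state R :=
  State (upd (nreg s) i v) (rreg s) (nmem s) (rmem s).
Definition set_rreg (R : realType) (s : state R) (i : nat) (v : R) : state R :=
  State (nreg s) (upd (rreg s) i v) (nmem s) (rmem s).
Definition set_nmem (R : realType) (s : state R) (a v : nat) : state R :=
  State (nreg s) (rreg s) (upd (nmem s) a v) (rmem s).
Definition set_rmem (R : realType) (s : state R) (a : nat) (v : R) : state R :=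
  State (nreg s) (rreg s) (nmem s) (upd (rmem s) a v).

Definition step (R : realType) (a : instr) (s : state R) : state R :=
  match a with
  | NConst i c => set_nreg s i c
  | NAdd i j l => set_nreg s i (nreg s j + nreg s l)%N
  | NSub i j l => set_nreg s i (nreg s j - nreg s l)%N
  | NLoad i j => set_nreg s i (nmem s (nreg s j))
  | NStore i j => set_nmem s (nreg s i) (nreg s j)
  | ROfNat i j => set_rreg s i (nreg s j)%:R
  | ROp o i j l => set_rreg s i (eval_rop o (rreg s j) (rreg s l))
  | RSqrt i j => set_rreg s i (Num.sqrt (rreg s j))
  | RLoad i j => set_rreg s i (rmem s (nreg s j))
  | RStore i j => set_rmem s (nreg s i) (rreg s j)
  end.

(* exec P s t s': started in s, the program P terminates in s' after exactly
   t steps; every instruction and every evaluation of a test is one step. *)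
Inductive exec (R : realType) : prog -> state R -> nat -> state R -> Prop :=
| exec_skip s : exec PSkip s 1%N s
| exec_instr a s : exec (PInstr a) s 1%N (step a s)
| exec_seq P Q s s1 s2 t1 t2 :
    exec P s t1 s1 -> exec Q s1 t2 s2 -> exec (PSeq P Q) s (t1 + t2)%N s2
| exec_if b P Q s s1 t :
    exec (if eval_test b s then P else Q) s t s1 -> exec (PIf b P Q) s t.+1 s1
| exec_while_end b P s : ~~ eval_test b s -> exec (PWhile b P) s 1%N s
| exec_while_step b P s s1 s2 t1 t2 :
    eval_test b s -> exec P s t1 s1 -> exec (PWhile b P) s1 t2 s2 ->
    exec (PWhile b P) s (t1 + t2).+1 s2.

(* Input: the integers |C| and k in n_0 and n_1, the real eps in x_0, and the
   coordinates of the points of C, point after point, in X; everything else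
   is 0. *)
Definition coords (R : realType) (d : nat) (C : seq 'rV[R]_d) : seq R :=
  flatten [seq [seq p ord0 j | j <- enum 'I_d] | p : 'rV[R]_d <- C].

Definition input (R : realType) (d : nat) (eps : R) (C : seq 'rV[R]_d) (k : nat)
    : state R :=
  State (fun i => nth 0%N [:: size C; k] i)
        (fun i => nth 0 [:: eps] i)
        (fun _ => 0%N)
        (fun a => nth 0 (coords C) a).

(* Output: the coordinates of k points, point after point, in X. *)
Definition output (R : realType) (d k : nat) (s : state R) : seq 'rV[R]_d :=
  [seq \row_(j < d) rmem s (i * d + j)%N | i <- iota 0 k].
Arguments output {R} d k s.

(* The base of the terms (1/eps)^{O(d)}.  It is 1/eps for eps <= 1/2.  For
   larger eps these terms are read, as usual, as those for eps = 1/2: taken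
   literally they do not exceed an absolute constant at eps = 1 and tend to 0
   as eps grows, so they would not even cover reading the d coordinates of
   each point. *)
Definition inv_eps (R : realType) (eps : R) : R := 1 / Num.min eps (1 / 2).

Definition kcenter_time (R : realType) (c0 c1 c2 c3 : R)
    (d : nat) (eps : R) (n k : nat) : R :=
  c0 * (n%:R * k%:R * inv_eps eps `^ (c1 * d%:R)
        + 2 `^ (c2 * (inv_eps eps `^ (c3 * d%:R)
                        * k%:R `^ (1 - 1 / d%:R) * ln k%:R
                      + d%:R * ln d%:R))).

(* Main.v *)
(** A farthest-first traversal of D * k steps, with D = (16 e)^d and e about
    8 / eps, yields a radius r with r / 2 <= opt <= r and, by a packing argument,
    a coreset: every input point is close to one of the D * k + 1 chosen points.
    Up to a factor 1 + O(1 / e) the centers may be taken among the points of a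
    lattice of mesh r / (e * d) around the coreset, and may be assumed to be
    r / e-separated.  A box containing two distinct points can then be cut by
    a hyperplane such that only O(k^(1-1/d)) of the balls around the centers that
    serve the box come near the cut: if the box is long, by averaging over
    parallel hyperplanes, and if it is short, by counting separated points near
    one hyperplane.  Cutting recursively, every box is left with
    O(k^(1-1/d)) centers that serve points on both sides of its boundary.

    The dynamic program has one entry for every pair of a box with candidate
    bounds and a set of at most O(k^(1-1/d)) candidates, and stores a set of
    candidates covering the box and containing the given set; for each of the
    3 e + 1 radii it replaces entries by unions of the entries of two smaller
    boxes until nothing can improve.  All loops are bounded by the number of
    entries, except those of the traversal, which is linear in the input.  If
    k is below the bound on these sets, boxes are superfluous, and all sets of at
    most k candidates are enumerated. *)
Require Import Defs.
From HB Require Import structures.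
From mathcomp Require Import all_boot all_order all_algebra.
From mathcomp Require Import all_classical all_reals all_analysis.
From mathcomp Require Import zify ring lra.

Set Implicit Arguments.
Unset Strict Implicit.
Unset Printing Implicit Defensive.

Import Order.TTheory GRing.Theory Num.Theory.
Local Open Scope nat_scope.

Inductive nexp :=
| NV (i : nat) | NC (c : nat) | NA (e f : nexp) | NB (e f : nexp)
| NM (c : nat) (e : nexp) | NG (a : nat) (e f : nexp).
Inductive rexp :=
| RV (i : nat) | RN (e : nexp) | RB (o : rop) (x y : rexp)
| RQ (x : rexp) | RG (e : nexp).
Inductive bexp := BN (e f : nexp) | BR (x y : rexp).
Inductive cmd :=
| CSkip
| CSet (i : nat) (e : nexp)
| CPut (a : nat) (e f g : nexp)
| CRSet (i : nat) (x : rexp)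
| CRPut (e : nexp) (x : rexp)
| CSeq (c1 c2 : cmd)
| CIf (b : bexp) (c1 c2 : cmd)
| CFor (tg i : nat) (e : nexp) (c : cmd).

Section Semantics.
Variable R : realType.

Record ist := Ist {
  iv : nat -> nat;
  rv : nat -> R;
  ia : nat -> nat -> nat -> nat;
  ra : nat -> R }.

Definition setv h i v := Ist (upd (iv h) i v) (rv h) (ia h) (ra h).
Definition setr h i v := Ist (iv h) (upd (rv h) i v) (ia h) (ra h).
Definition seta h a e f v :=
  Ist (iv h) (rv h)
      (fun a' e' f' => if (a' == a) && ((e' == e) && (f' == f)) then v
                       else ia h a' e' f') (ra h).
Definition setx h j v := Ist (iv h) (rv h) (ia h) (upd (ra h) j v).

Fixpoint nev (e : nexp) (h : ist) : nat :=
  match e with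
  | NV i => iv h i
  | NC c => c
  | NA e f => nev e h + nev f h
  | NB e f => nev e h - nev f h
  | NM c e => c * nev e h
  | NG a e f => ia h a (nev e h) (nev f h)
  end.

Fixpoint rev_ (x : rexp) (h : ist) : R :=
  match x with
  | RV i => rv h i
  | RN e => (nev e h)%:R
  | RB o x y => eval_rop o (rev_ x h) (rev_ y h)
  | RQ x => Num.sqrt (rev_ x h)
  | RG e => ra h (nev e h)
  end.

Definition bev (b : bexp) (h : ist) : bool :=
  match b with
  | BN e f => nev e h <= nev f h
  | BR x y => (rev_ x h <= rev_ y h)%R
  end.

Fixpoint run (c : cmd) (h : ist) : ist :=
  match c with
  | CSkip => h
  | CSet i e => setv h i (nev e h)
  | CPut a e f g => seta h a (nev e h) (nev f h) (nev g h)
  | CRSet i x => setr h i (rev_ x h)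
  | CRPut e x => setx h (nev e h) (rev_ x h)
  | CSeq c1 c2 => run c2 (run c1 h)
  | CIf b c1 c2 => if bev b h then run c1 h else run c2 h
  | CFor _ i e c => iteri (nev e h) (fun j h' => run c (setv h' i j)) h
  end.

Definition acost (a e : nat) : nat := 10 + 3 * (16 * e + a) + 1.

Fixpoint ncost (e : nexp) (h : ist) : nat :=
  match e with
  | NV i => 3
  | NC c => 1
  | NA e f | NB e f => ncost e h + ncost f h + 1
  | NM c e => ncost e h + (c + 2)
  | NG a e f => ncost f h + ncost e h + acost a (nev e h) + 1
  end.

Fixpoint rcost (x : rexp) (h : ist) : nat :=
  match x with
  | RV i => 4
  | RN e => ncost e h + 1
  | RB o x y => rcost x h + rcost y h + 1
  | RQ x => rcost x h + 1
  | RG e => ncost e h + 1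
  end.

Definition bcost (b : bexp) (h : ist) : nat :=
  match b with
  | BN e f => ncost e h + ncost f h
  | BR x y => rcost x h + rcost y h
  end.

Fixpoint cost (c : cmd) (h : ist) : nat :=
  match c with
  | CSkip => 1
  | CSet i e => ncost e h + 3
  | CPut a e f g =>
      ncost f h + ncost e h + acost a (nev e h) + ncost g h + 1
  | CRSet i x => rcost x h + 4
  | CRPut e x => ncost e h + rcost x h + 1
  | CSeq c1 c2 => cost c1 h + cost c2 (run c1 h)
  | CIf b c1 c2 => bcost b h + (if bev b h then cost c1 h else cost c2 h) + 1
  | CFor _ i e c =>
      ncost e h + 4 +
      \sum_(j < nev e h)
        (cost c (setv (iteri j (fun j h' => run c (setv h' i j)) h) i j) + 3)
  end.

Definition nvars := 60.

Fixpoint nwf (e : nexp) : bool :=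
  match e with
  | NV i => i < nvars
  | NC c => true
  | NA e f | NB e f => nwf e && nwf f
  | NM c e => nwf e
  | NG a e f => [&& a < 16, nwf e & nwf f]
  end.
Fixpoint rwf (x : rexp) : bool :=
  match x with
  | RV i => i < nvars
  | RN e | RG e => nwf e
  | RB o x y => rwf x && rwf y
  | RQ x => rwf x
  end.
Definition bwf (b : bexp) : bool :=
  match b with BN e f => nwf e && nwf f | BR x y => rwf x && rwf y end.
Fixpoint cwf (c : cmd) : bool :=
  match c with
  | CSkip => true
  | CSet i e => (i < nvars) && nwf e
  | CPut a e f g => [&& a < 16, nwf e, nwf f & nwf g]
  | CRSet i x => (i < nvars) && rwf x
  | CRPut e x => nwf e && rwf x
  | CSeq c1 c2 => cwf c1 && cwf c2
  | CIf b c1 c2 => [&& bwf b, cwf c1 & cwf c2]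
  | CFor _ i e c => [&& i < nvars, nwf e & cwf c]
  end.

Definition blk (l : seq instr) : prog :=
  foldr (fun a P => PSeq (PInstr a) P) PSkip l.
Arguments blk : simpl never.

(* The scratch registers of the code for an expression or a command are those
   numbered t and above; the value of an expression is left in register t. *)
Definition adrcode (a t : nat) : prog :=
  PSeq (blk [:: NAdd t.+1 t.+1 t.+1; NAdd t.+1 t.+1 t.+1;
                NAdd t.+1 t.+1 t.+1; NAdd t.+1 t.+1 t.+1;
                NConst t.+2 a; NAdd t.+1 t.+1 t.+2;
                NAdd t t t; NConst t.+2 1; NAdd t t t.+2])
       (PWhile (NLe t.+2 t.+1) (PSeq (PInstr (NAdd t t t))
                                     (PInstr (NSub t.+1 t.+1 t.+2)))).

Fixpoint ncomp (e : nexp) (t : nat) : prog :=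
  match e with
  | NV i => blk [:: NConst t 0; NAdd t i t]
  | NC c => PInstr (NConst t c)
  | NA e f => PSeq (ncomp e t) (PSeq (ncomp f t.+1) (PInstr (NAdd t t t.+1)))
  | NB e f => PSeq (ncomp e t) (PSeq (ncomp f t.+1) (PInstr (NSub t t t.+1)))
  | NM c e => PSeq (ncomp e t.+1)
                   (PSeq (PInstr (NConst t 0)) (blk (nseq c (NAdd t t t.+1))))
  | NG a e f => PSeq (ncomp f t) (PSeq (ncomp e t.+1)
                  (PSeq (adrcode a t) (PInstr (NLoad t t))))
  end.

Fixpoint rcomp (x : rexp) (t : nat) : prog :=
  match x with
  | RV i => blk [:: NConst t 0; ROfNat t t; ROp RAdd t i t]
  | RN e => PSeq (ncomp e t) (PInstr (ROfNat t t))
  | RB o x y => PSeq (rcomp x t) (PSeq (rcomp y t.+1) (PInstr (ROp o t t t.+1)))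
  | RQ x => PSeq (rcomp x t) (PInstr (RSqrt t t))
  | RG e => PSeq (ncomp e t) (PInstr (RLoad t t))
  end.

Definition bcomp (b : bexp) (t : nat) : prog :=
  match b with
  | BN e f => PSeq (ncomp e t) (ncomp f t.+1)
  | BR x y => PSeq (rcomp x t) (rcomp y t.+1)
  end.
Definition btest (b : bexp) (t : nat) : test :=
  match b with BN _ _ => NLe t t.+1 | BR _ _ => RLe t t.+1 end.

Fixpoint comp (c : cmd) (t : nat) : prog :=
  match c with
  | CSkip => PSkip
  | CSet i e => PSeq (ncomp e t) (blk [:: NConst t.+1 0; NAdd i t t.+1])
  | CPut a e f g => PSeq (ncomp f t) (PSeq (ncomp e t.+1)
      (PSeq (adrcode a t) (PSeq (ncomp g t.+1) (PInstr (NStore t t.+1)))))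
  | CRSet i x =>
      PSeq (rcomp x t) (blk [:: NConst t 0; ROfNat t.+1 t; ROp RAdd i t t.+1])
  | CRPut e x => PSeq (ncomp e t) (PSeq (rcomp x t.+1) (PInstr (RStore t t.+1)))
  | CSeq c1 c2 => PSeq (comp c1 t) (comp c2 t)
  | CIf b c1 c2 => PSeq (bcomp b t) (PIf (btest b t) (comp c1 t) (comp c2 t))
  | CFor _ i e c => PSeq (ncomp e t) (PSeq (blk [:: NConst t.+1 1; NConst t.+2 1])
      (PWhile (NLe t.+1 t)
        (PSeq (PInstr (NSub i t.+1 t.+2))
              (PSeq (comp c t.+3) (PInstr (NAdd t.+1 t.+1 t.+2))))))
  end.

(* The 2-adic valuation and the odd part of an address give back a, e and f, so
   that the two-dimensional arrays need no bounds; the address is computed by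
   repeated doubling. *)
Definition adr (a e f : nat) : nat := 2 ^ (16 * e + a) * (2 * f).+1.

Definition sim (h : ist) (s : state R) : Prop :=
  [/\ forall i, i < nvars -> nreg s i = iv h i,
      forall i, i < nvars -> rreg s i = rv h i,
      forall a e f, a < 16 -> nmem s (adr a e f) = ia h a e f &
      forall j, rmem s j = ra h j].

Definition agree (t : nat) (s s' : state R) : Prop :=
  [/\ forall i, i < t -> nreg s' i = nreg s i,
      forall i, i < t -> rreg s' i = rreg s i,
      nmem s' = nmem s & rmem s' = rmem s].

Lemma agree_trans t t1 t2 s1 s2 s3 :
  agree t1 s1 s2 -> agree t2 s2 s3 -> t <= t1 -> t <= t2 -> agree t s1 s3.
Proof.
move=> [a1 a2 a3 a4] [b1 b2 b3 b4] h h'; split=> [i hi|i hi||].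
- by rewrite b1 ?a1 //; lia.
- by rewrite b2 ?a2 //; lia.
- by rewrite b3.
- by rewrite b4.
Qed.

Lemma agree_sim h t s s' : nvars <= t -> sim h s -> agree t s s' -> sim h s'.
Proof.
move=> ht [a1 a2 a3 a4] [b1 b2 b3 b4]; split=> [i hi|i hi|a e f|j].
- by rewrite b1 ?a1 //; lia.
- by rewrite b2 ?a2 //; lia.
- by rewrite b3; apply: a3.
- by rewrite b4 a4.
Qed.

Lemma exec_blk l (s : state R) :
  exec (blk l) s (size l).+1 (foldl (fun s a => step a s) s l).
Proof.
elim: l s => [|a l IH] s /=; first exact: exec_skip.
by rewrite -[in X in exec _ _ X]add1n; apply: exec_seq (IH _); apply: exec_instr.
Qed.

Lemma exec_cost P (s : state R) t t' s' : exec P s t s' -> t = t' -> exec P s t' s'.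
Proof. by move=> H <-. Qed.

Ltac updl := rewrite /upd; repeat (case: eqP => ?; try lia).

Lemma adrcode_exec a t (s : state R) (e f : nat) :
  nreg s t = f -> nreg s t.+1 = e ->
  exists s', [/\ exec (adrcode a t) s (acost a e) s', agree t s s' &
                 nreg s' t = adr a e f].
Proof.
move=> hf he.
have loop r : forall s1 : state R, nreg s1 t.+1 = r -> nreg s1 t.+2 = 1 ->
  exists s', [/\ exec (PWhile (NLe t.+2 t.+1) (PSeq (PInstr (NAdd t t t))
                       (PInstr (NSub t.+1 t.+1 t.+2)))) s1 (3 * r + 1) s',
    agree t s1 s' & nreg s' t = 2 ^ r * nreg s1 t].
  elim: r => [|r IH] s1 h1 h2.
    exists s1; split=> //; last by rewrite mul1n.
    by apply: exec_while_end; rewrite /= h1 h2.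
  have [||s' [E [a1 a2 a3 a4] V]] :=
    IH (step (NSub t.+1 t.+1 t.+2) (step (NAdd t t t) s1)).
  - by rewrite /=; updl; rewrite h1 h2; lia.
  - by rewrite /=; updl.
  exists s'; split.
  - apply: (@exec_cost _ _ (1 + 1 + (3 * r + 1)).+1); last by lia.
    apply: exec_while_step E; first by rewrite /= h1 h2.
    by apply: exec_seq; apply: exec_instr.
  - split=> [i hi|i hi||].
    + by rewrite a1 //=; updl.
    + by rewrite a2.
    + by rewrite a3.
    + by rewrite a4.
  - rewrite V /=.
    have -> : upd (upd (nreg s1) t (nreg s1 t + nreg s1 t)) t.+1
       (upd (nreg s1) t (nreg s1 t + nreg s1 t) t.+1 -
        upd (nreg s1) t (nreg s1 t + nreg s1 t) t.+2) t = 2 * nreg s1 t.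
      by updl.
    by rewrite expnS mulnCA mulnA.
have := exec_blk [:: NAdd t.+1 t.+1 t.+1; NAdd t.+1 t.+1 t.+1;
                NAdd t.+1 t.+1 t.+1; NAdd t.+1 t.+1 t.+1;
                NConst t.+2 a; NAdd t.+1 t.+1 t.+2;
                NAdd t t t; NConst t.+2 1; NAdd t t t.+2] s.
set s1 := foldl _ _ _ => E1.
have v1 : nreg s1 t.+1 = 16 * e + a by rewrite /s1 /=; updl; rewrite -he; lia.
have v2 : nreg s1 t.+2 = 1 by rewrite /s1 /=; updl.
have v3 : nreg s1 t = (2 * f).+1 by rewrite /s1 /=; updl; rewrite -hf; lia.
have ag1 : agree t s s1 by split=> // i hi; rewrite /s1 /=; updl.
have [s2 [E2 ag2 V]] := loop _ _ v1 v2.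
exists s2; split; last by rewrite V v3.
- by apply: exec_cost (exec_seq E1 E2) _; rewrite /acost /=; lia.
- by apply: (agree_trans ag1 ag2).
Qed.

Lemma ncomp_exec e t h (s : state R) : nvars <= t -> nwf e -> sim h s ->
  exists s', [/\ exec (ncomp e t) s (ncost e h) s', agree t s s' &
                 nreg s' t = nev e h].
Proof.
elim: e t s => [i|c|e IHe f IHf|e IHe f IHf|c e IHe|a e IHe f IHf] t s ht /=.
- move=> hi hs; eexists; split; first exact: exec_blk.
  + by split=> // j hj; rewrite /=; updl.
  + by case: hs => h1 _ _ _; rewrite /= -(h1 _ hi); updl.
- move=> _ hs; eexists; split; first exact: exec_instr.
  + by split=> // j hj; rewrite /=; updl.
  + by rewrite /=; updl.
- case/andP=> we wf hs.
  have [s1 [E1 A1 V1]] := IHe t s ht we hs.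
  have [s2 [E2 A2 V2]] := IHf t.+1 s1 (leqW ht) wf (agree_sim ht hs A1).
  exists (step (NAdd t t t.+1) s2); split.
  + apply: exec_cost (exec_seq E1 (exec_seq E2 (exec_instr _ _))) _; lia.
  + apply: (agree_trans A1 (t2 := t)) => //; apply: (agree_trans A2 (t2 := t)) => //.
    by split=> // j hj; rewrite /=; updl.
  + rewrite /=; updl; rewrite V2; case: A2 => -> //; rewrite V1; lia.
- case/andP=> we wf hs.
  have [s1 [E1 A1 V1]] := IHe t s ht we hs.
  have [s2 [E2 A2 V2]] := IHf t.+1 s1 (leqW ht) wf (agree_sim ht hs A1).
  exists (step (NSub t t t.+1) s2); split.
  + apply: exec_cost (exec_seq E1 (exec_seq E2 (exec_instr _ _))) _; lia.
  + apply: (agree_trans A1 (t2 := t)) => //; apply: (agree_trans A2 (t2 := t)) => //.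
    by split=> // j hj; rewrite /=; updl.
  + rewrite /=; updl; rewrite V2; case: A2 => -> //; rewrite V1; lia.
- move=> we hs.
  have [s1 [E1 A1 V1]] := IHe t.+1 s (leqW ht) we hs.
  set s2 := step (NConst t 0) s1.
  have rep n : forall s3 : state R,
    agree t s3 (foldl (fun s a => step a s) s3 (nseq n (NAdd t t t.+1))) /\
    nreg (foldl (fun s a => step a s) s3 (nseq n (NAdd t t t.+1))) t =
    nreg s3 t + n * nreg s3 t.+1.
    elim: n => [|n IH] s3 /=; first by split=> //; lia.
    case: (IH (step (NAdd t t t.+1) s3)) => [a1 a2]; split.
      by apply: (agree_trans (t1 := t) _ a1) => //; split=> // j hj /=; updl.
    by rewrite a2 /=; updl; lia.
  have [r1 r2] := rep c s2.
  exists (foldl (fun s a => step a s) s2 (nseq c (NAdd t t t.+1))); split.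
  + apply: exec_cost (exec_seq E1 (exec_seq (exec_instr _ _) (exec_blk _ _))) _.
    rewrite size_nseq; lia.
  + apply: (agree_trans (t1 := t) _ r1) => //.
    case: A1 => a1 a2 a3 a4; split=> // j hj; rewrite /s2 /=.
      by updl; apply: a1; lia.
    by apply: a2; lia.
  + by rewrite r2 /=; updl; rewrite V1; lia.
- case/and3P=> ha we wf hs.
  have [s1 [E1 A1 V1]] := IHf t s ht wf hs.
  have [s2 [E2 A2 V2]] := IHe t.+1 s1 (leqW ht) we (agree_sim ht hs A1).
  have V1' : nreg s2 t = nev f h by case: A2 => -> //.
  have [s3 [E3 A3 V3]] := adrcode_exec a V1' V2.
  have A : agree t s s3.
    by apply: (agree_trans A1 (t2 := t)) => //; apply: (agree_trans A2 A3).
  exists (step (NLoad t t) s3); split.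
  + apply: exec_cost (exec_seq E1 (exec_seq E2 (exec_seq E3 (exec_instr _ _)))) _; lia.
  + by apply: (agree_trans A (t2 := t)) => //; split=> // j hj /=; updl.
  + have [_ _ h3 _] := agree_sim ht hs A.
    by rewrite /=; updl; rewrite V3 h3.
Qed.

Lemma rcomp_exec x t h (s : state R) : nvars <= t -> rwf x -> sim h s ->
  exists s', [/\ exec (rcomp x t) s (rcost x h) s', agree t s s' &
                 rreg s' t = rev_ x h].
Proof.
elim: x t s => [i|e|o x IHx y IHy|x IHx|e] t s ht /=.
- move=> hi hs; eexists; split; first exact: exec_blk.
  + by split=> // j hj; rewrite /=; updl.
  + case: hs => _ h1 _ _; rewrite /= -(h1 _ hi) /upd !eqxx addr0.
    by case: eqP => //; lia.
- move=> we hs; have [s1 [E1 A1 V1]] := ncomp_exec ht we hs.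
  exists (step (ROfNat t t) s1); split.
  + exact: exec_seq E1 (exec_instr _ _).
  + by apply: (agree_trans A1 (t2 := t)) => //; split=> // j hj /=; updl.
  + by rewrite /= /upd eqxx V1.
- case/andP=> we wf hs.
  have [s1 [E1 A1 V1]] := IHx t s ht we hs.
  have [s2 [E2 A2 V2]] := IHy t.+1 s1 (leqW ht) wf (agree_sim ht hs A1).
  exists (step (ROp o t t t.+1) s2); split.
  + apply: exec_cost (exec_seq E1 (exec_seq E2 (exec_instr _ _))) _; lia.
  + apply: (agree_trans A1 (t2 := t)) => //; apply: (agree_trans A2 (t2 := t)) => //.
    by split=> // j hj; rewrite /=; updl.
  + by rewrite /= /upd eqxx V2; case: A2 => _ -> //; rewrite V1.
- move=> we hs; have [s1 [E1 A1 V1]] := IHx t s ht we hs.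
  exists (step (RSqrt t t) s1); split.
  + exact: exec_seq E1 (exec_instr _ _).
  + by apply: (agree_trans A1 (t2 := t)) => //; split=> // j hj /=; updl.
  + by rewrite /= /upd eqxx V1.
- move=> we hs; have [s1 [E1 A1 V1]] := ncomp_exec ht we hs.
  exists (step (RLoad t t) s1); split.
  + exact: exec_seq E1 (exec_instr _ _).
  + by apply: (agree_trans A1 (t2 := t)) => //; split=> // j hj /=; updl.
  + have [_ _ _ h4] := agree_sim ht hs A1.
    by rewrite /= /upd eqxx V1 h4.
Qed.

Lemma bcomp_exec b t h (s : state R) : nvars <= t -> bwf b -> sim h s ->
  exists s', [/\ exec (bcomp b t) s (bcost b h) s', agree t s s' &
                 eval_test (btest b t) s' = bev b h].
Proof.
case: b => [e f|x y] ht /= /andP[we wf] hs.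
- have [s1 [E1 A1 V1]] := ncomp_exec ht we hs.
  have [s2 [E2 A2 V2]] := ncomp_exec (leqW ht) wf (agree_sim ht hs A1).
  exists s2; split.
  + exact: exec_seq E1 E2.
  + by apply: (agree_trans A1 A2).
  + by rewrite V2; case: A2 => -> //; rewrite V1.
- have [s1 [E1 A1 V1]] := rcomp_exec ht we hs.
  have [s2 [E2 A2 V2]] := rcomp_exec (leqW ht) wf (agree_sim ht hs A1).
  exists s2; split.
  + exact: exec_seq E1 E2.
  + by apply: (agree_trans A1 A2).
  + by rewrite V2; case: A2 => _ -> //; rewrite V1.
Qed.

Lemma adr_inj a e f a' e' f' : a < 16 -> a' < 16 ->
  adr a e f = adr a' e' f' -> [/\ a = a', e = e' & f = f'].
Proof.
move=> ha ha'; rewrite /adr.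
have pinj r r' g g' : 2 ^ r * (2 * g).+1 = 2 ^ r' * (2 * g').+1 -> r = r' /\ g = g'.
  elim: r r' => [|r IH] [|r']; rewrite ?expn0 ?mul1n ?expnS.
  - by move=> h; split=> //; lia.
  - by rewrite -mulnA; lia.
  - by rewrite -mulnA; lia.
  - rewrite -!mulnA => h; have [h1 h2] : r = r' /\ g = g' by apply: IH; lia.
    by rewrite h1 h2. 
by move=> /pinj[h1 h2]; split; lia.
Qed.

Definition keep (t : nat) (s s' : state R) : Prop :=
  forall i, nvars <= i < t -> nreg s' i = nreg s i.

Lemma agree_keep t s s' : agree t s s' -> keep t s s'.
Proof. by case=> h _ _ _ i /andP[_]; apply: h. Qed.

Lemma keep_trans t t' s1 s2 s3 :
  keep t s1 s2 -> keep t' s2 s3 -> t <= t' -> keep t s1 s3.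
Proof. by move=> h1 h2 h i hi; rewrite h2 ?h1 //; lia. Qed.

Lemma comp_exec c t h (s : state R) : nvars <= t -> cwf c -> sim h s ->
  exists s', [/\ exec (comp c t) s (cost c h) s', sim (run c h) s' & keep t s s'].
Proof.
elim: c t h s => [|i e|a e f g|i x|e x|c1 IH1 c2 IH2|b c1 IH1 c2 IH2|tg i e c IH] t h s ht /=.
- by move=> _ hs; exists s; split=> //; apply: exec_skip.
- case/andP=> hi we hs; have [s1 [E1 A1 V1]] := ncomp_exec ht we hs.
  have [h1 h2 h3 h4] := agree_sim ht hs A1.
  eexists; split.
  + by apply: exec_cost (exec_seq E1 (exec_blk _ _)) _.
  + split=> //= j hj; rewrite /upd !eqxx; case: eqP => // _.
      by rewrite -V1; case: eqP; lia.
    by case: eqP; [lia|rewrite h1].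
  + by move=> j /andP[hj1 hj2] /=; updl; case: A1 => ->.
- case/and4P=> ha we wf wg hs.
  have [s1 [E1 A1 V1]] := ncomp_exec ht wf hs.
  have [s2 [E2 A2 V2]] := ncomp_exec (leqW ht) we (agree_sim ht hs A1).
  have V1' : nreg s2 t = nev f h by case: A2 => -> //.
  have [s3 [E3 A3 V3]] := adrcode_exec a V1' V2.
  have A : agree t s s3.
    by apply: (agree_trans A1 (t2 := t)) => //; apply: (agree_trans A2 A3).
  have [s4 [E4 A4 V4]] := ncomp_exec (leqW ht) wg (agree_sim ht hs A).
  have A' : agree t s s4 by apply: (agree_trans A A4).
  have [h1 h2 h3 h4] := agree_sim ht hs A'.
  exists (step (NStore t t.+1) s4); split.
  + apply: exec_cost
      (exec_seq E1 (exec_seq E2 (exec_seq E3 (exec_seq E4 (exec_instr _ _))))) _; lia.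
  + split=> //= a' e' f' ha'.
    have -> : nreg s4 t = adr a (nev e h) (nev f h) by case: A4 => -> //.
    rewrite V4 /upd; case: eqP => [/adr_inj[] // -> -> ->|hne]; first by rewrite !eqxx.
    rewrite h3 //; case: ifP => // /andP[/eqP h5 /andP[/eqP h6 /eqP h7]].
    by rewrite h5 h6 h7 in hne.
  + by move=> j /andP[hj1 hj2] /=; case: A' => ->.
- case/andP=> hi we hs; have [s1 [E1 A1 V1]] := rcomp_exec ht we hs.
  have [h1 h2 h3 h4] := agree_sim ht hs A1.
  eexists; split.
  + by apply: exec_cost (exec_seq E1 (exec_blk _ _)) _.
  + split=> //= j hj; last first.
      rewrite /upd !eqxx addr0; case: eqP => // _.
        by rewrite -V1; case: eqP => // ?; lia.
      by case: eqP => ?; [lia|rewrite h2].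
    by updl; rewrite h1.
  + by move=> j /andP[hj1 hj2] /=; updl; case: A1 => ->.
- case/andP=> we wx hs; have [s1 [E1 A1 V1]] := ncomp_exec ht we hs.
  have [s2 [E2 A2 V2]] := rcomp_exec (leqW ht) wx (agree_sim ht hs A1).
  have A : agree t s s2 by apply: (agree_trans A1 A2).
  have [h1 h2 h3 h4] := agree_sim ht hs A.
  exists (step (RStore t t.+1) s2); split.
  + apply: exec_cost (exec_seq E1 (exec_seq E2 (exec_instr _ _))) _; lia.
  + split=> //= j; rewrite V2.
    have -> : nreg s2 t = nev e h by case: A2 => -> //.
    by rewrite /upd; case: eqP.
  + by move=> j /andP[hj1 hj2] /=; case: A => ->.
- case/andP=> w1 w2 hs; have [s1 [E1 S1 K1]] := IH1 t h s ht w1 hs.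
  have [s2 [E2 S2 K2]] := IH2 t _ s1 ht w2 S1.
  exists s2; split=> //; first exact: exec_seq E1 E2.
  exact: keep_trans K1 K2 _.
- case/and3P=> wb w1 w2 hs; have [s1 [E1 A1 V1]] := bcomp_exec ht wb hs.
  have hs1 := agree_sim ht hs A1.
  have [s2 [E2 S2 K2]] : exists s', [/\
     exec (if bev b h then comp c1 t else comp c2 t) s1
          (if bev b h then cost c1 h else cost c2 h) s',
     sim (if bev b h then run c1 h else run c2 h) s' & keep t s1 s'].
    by case: (bev b h); [apply: IH1|apply: IH2].
  exists s2; split=> //; last exact: keep_trans (agree_keep A1) K2 _.
  rewrite -V1 in E2.
  by apply: exec_cost (exec_seq E1 (exec_if E2)) _; rewrite V1; lia.
- case/and3P=> hi we wc hs; have [s1 [E1 A1 V1]] := ncomp_exec ht we hs.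
  set N := nev e h in V1 *.
  set g := fun j h' => run c (setv h' i j).
  pose W := PWhile (NLe t.+1 t) (PSeq (PInstr (NSub i t.+1 t.+2))
              (PSeq (comp c t.+3) (PInstr (NAdd t.+1 t.+1 t.+2)))).
  have loop r : forall j (s2 : state R), j + r = N -> sim (iteri j g h) s2 ->
    nreg s2 t = N -> nreg s2 t.+1 = j.+1 -> nreg s2 t.+2 = 1 ->
    exists s', [/\ exec W s2
      (\sum_(j <= l < N) (cost c (setv (iteri l g h) i l) + 3)).+1 s',
      sim (iteri N g h) s' & keep t s2 s'].
    elim: r => [|r IHr] j s2 hj hsim n0 n1 n2.
      exists s2; rewrite addn0 in hj; rewrite -hj big_geq //; split=> //.
      by apply: exec_while_end => /=; rewrite n0 n1; lia.
    have sim3 : sim (setv (iteri j g h) i j) (step (NSub i t.+1 t.+2) s2).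
      case: hsim => h1 h2 h3 h4; split=> //= l hl; rewrite /upd.
      by case: eqP => // _; [rewrite n1 n2; lia|rewrite h1].
    have [s3 [E3 S3 K3]] := IH t.+3 _ _ (leqW (leqW (leqW ht))) wc sim3.
    have k3 l : nvars <= l < t.+3 -> nreg s3 l = nreg s2 l.
      by move=> hl; rewrite K3 //= /upd; case: eqP => //; lia.
    have [|||||s4 [E4 S4 K4]] := IHr j.+1 (step (NAdd t.+1 t.+1 t.+2) s3).
    + lia.
    + case: S3 => h1 h2 h3 h4; split=> //= l hl; rewrite -h1 //; updl.
    + by rewrite /=; updl; rewrite k3 //; lia.
    + by rewrite /= /upd eqxx !k3 ?n1 ?n2; lia.
    + by rewrite /=; updl; rewrite k3 //; lia.
    exists s4; split=> //.
    + apply: exec_cost; first apply: exec_while_step E4.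
      * by rewrite /= n0 n1; lia.
      * exact: exec_seq (exec_instr _ _) (exec_seq E3 (exec_instr _ _)).
      * by rewrite [in RHS]big_ltn; lia.
    + move=> l hl; rewrite K4 //= /upd; case: eqP => [|_]; first lia.
      by rewrite k3; lia.
  pose s2 := foldl (fun s a => step a s) s1 [:: NConst t.+1 1; NConst t.+2 1].
  have A2 : agree t s1 s2 by split=> // l hl /=; updl.
  have [|||||s3 [E3 S3 K3]] := loop N 0 s2.
  + lia.
  + by apply: agree_sim ht hs _; apply: (agree_trans A1 A2).
  + by rewrite /=; updl.
  + by rewrite /=; updl.
  + by rewrite /=; updl.
  exists s3; split=> //.
  + apply: exec_cost (exec_seq E1 (exec_seq (exec_blk _ _) E3)) _.
    by rewrite big_mkord /= -addnA; congr (_ + _); lia.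
  + have A : agree t s s2 by apply: (agree_trans A1 A2).
    exact: keep_trans (agree_keep A) K3 _.
Qed.
End Semantics.

(** * Hoare logic with cost *)

Section Logic.
Variable R : realType.
Implicit Types h : ist R.

(* The bounds b : b 0 bounds the constants of NM and the row indices, b tg the
   number of iterations of the loops with tag tg. *)
Fixpoint nok (B : nat) (e : nexp) h : Prop :=
  match e with
  | NV _ | NC _ => True
  | NA e f | NB e f => nok B e h /\ nok B f h
  | NM c e => c <= B /\ nok B e h
  | NG a e f => [/\ nok B e h, nok B f h & nev e h <= B]
  end.

Fixpoint rok (B : nat) (x : rexp) h : Prop :=
  match x with
  | RV _ => True
  | RN e | RG e => nok B e h
  | RB o x y => rok B x h /\ rok B y h
  | RQ x => rok B x h
  end.

Definition bok (B : nat) (b : bexp) h : Prop :=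
  match b with
  | BN e f => nok B e h /\ nok B f h
  | BR x y => rok B x h /\ rok B y h
  end.

Fixpoint ok (b : nat -> nat) (c : cmd) h : Prop :=
  match c with
  | CSkip => True
  | CSet _ e => nok (b 0) e h
  | CPut _ e f g => [/\ nok (b 0) e h, nok (b 0) f h, nok (b 0) g h & nev e h <= b 0]
  | CRSet _ x => rok (b 0) x h
  | CRPut e x => nok (b 0) e h /\ rok (b 0) x h
  | CSeq c1 c2 => ok b c1 h /\ ok b c2 (run c1 h)
  | CIf t c1 c2 => bok (b 0) t h /\ (if bev t h then ok b c1 h else ok b c2 h)
  | CFor tg i e c =>
      [/\ nok (b 0) e h, nev e h <= b tg &
      forall j, j < nev e h ->
        ok b c (setv (iteri j (fun j h' => run c (setv h' i j)) h) i j)]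
  end.

Fixpoint nsz (e : nexp) : nat :=
  match e with
  | NV _ => 3 | NC _ => 1
  | NA e f | NB e f => nsz e + nsz f + 1
  | NM _ e => nsz e + 2
  | NG a e f => nsz e + nsz f + (60 + 3 * a)
  end.
Fixpoint rsz (x : rexp) : nat :=
  match x with
  | RV _ => 4
  | RN e | RG e => nsz e + 1
  | RB _ x y => rsz x + rsz y + 1
  | RQ x => rsz x + 1
  end.
Definition bsz (b : bexp) : nat :=
  match b with BN e f => nsz e + nsz f | BR x y => rsz x + rsz y end.
Fixpoint csz (c : cmd) : nat :=
  match c with
  | CSkip => 1
  | CSet _ e => nsz e + 3
  | CPut a e f g => nsz e + nsz f + nsz g + (60 + 3 * a)
  | CRSet _ x => rsz x + 4
  | CRPut e x => nsz e + rsz x + 1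
  | CSeq c1 c2 => csz c1 + csz c2
  | CIf b c1 c2 => bsz b + (csz c1 + csz c2) + 1
  | CFor _ _ e c => nsz e + 4 + (csz c + 3)
  end.
Fixpoint dep (tg : nat) (c : cmd) : nat :=
  match c with
  | CSeq c1 c2 | CIf _ c1 c2 => maxn (dep tg c1) (dep tg c2)
  | CFor tg' _ _ c => (tg' == tg) + dep tg c
  | _ => 0
  end.
Fixpoint tags (c : cmd) : bool :=
  match c with
  | CSeq c1 c2 | CIf _ c1 c2 => tags c1 && tags c2
  | CFor tg' _ _ c => (tg' < 3) && tags c
  | _ => true
  end.

Lemma ncost_le B e h : nok B e h -> ncost e h <= nsz e * B.+1.
Proof.
elim: e => [i|c|e IHe f IHf|e IHe f IHf|c e IHe|a e IHe f IHf] //=; try lia.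
- by move=> [/IHe h1 /IHf h2]; lia.
- by move=> [/IHe h1 /IHf h2]; lia.
- by move=> [hc /IHe h1]; lia.
- by move=> [/IHe h1 /IHf h2 hB]; rewrite /acost; nia.
Qed.

Lemma rcost_le B x h : rok B x h -> rcost x h <= rsz x * B.+1.
Proof.
elim: x => [i|e|o x IHx y IHy|x IHx|e] //=; try lia.
- by move=> /ncost_le; lia.
- by move=> [/IHx h1 /IHy h2]; lia.
- by move=> /IHx h1; lia.
- by move=> /ncost_le; lia.
Qed.

Lemma bcost_le B b h : bok B b h -> bcost b h <= bsz b * B.+1.
Proof.
case: b => [e f|x y] /= [].
- by move=> /ncost_le h1 /ncost_le h2; lia.
- by move=> /rcost_le h1 /rcost_le h2; lia.
Qed.

Definition wgt (b : nat -> nat) (c : cmd) : nat :=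
  (b 0).+1 ^ (dep 0 c).+1 * (b 1).+1 ^ dep 1 c * (b 2).+1 ^ dep 2 c.

Lemma cost_le b c h : tags c -> ok b c h -> cost c h <= csz c * wgt b c.
Proof.
have atom n m w : n <= m * (b 0).+1 -> (b 0).+1 <= w -> n <= m * w.
  by move=> h1 h2; apply: leq_trans h1 _; rewrite leq_mul2l h2 orbT.
have wB c' : (b 0).+1 <= wgt b c'.
  by rewrite /wgt expnS -!mulnA leq_pmulr // !muln_gt0 !expn_gt0.
elim: c h => [|i e|a e f g|i x|e x|c1 IH1 c2 IH2|t c1 IH1 c2 IH2|tg i e c IH] h /=.
- by move=> _ _; apply: atom (wB _); lia.
- by move=> _ /ncost_le h1; apply: atom (wB _); lia.
- move=> _ [/ncost_le h1 /ncost_le h2 /ncost_le h3 h4]; apply: atom (wB _).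
  by rewrite /acost; nia.
- by move=> _ /rcost_le h1; apply: atom (wB _); lia.
- by move=> _ [/ncost_le h1 /rcost_le h2]; apply: atom (wB _); lia.
- move=> /andP[t1 t2] [/(IH1 _ t1) h1 /(IH2 _ t2) h2].
  have m1 : wgt b c1 <= wgt b (CSeq c1 c2).
    by rewrite /wgt /= !leq_mul // leq_pexp2l // ?ltnS leq_maxl.
  have m2 : wgt b c2 <= wgt b (CSeq c1 c2).
    by rewrite /wgt /= !leq_mul // leq_pexp2l // ?ltnS leq_maxr.
  by nia.
- move=> /andP[t1 t2] [/bcost_le h0 h12].
  have m1 : wgt b c1 <= wgt b (CIf t c1 c2).
    by rewrite /wgt /= !leq_mul // leq_pexp2l // ?ltnS leq_maxl.
  have m2 : wgt b c2 <= wgt b (CIf t c1 c2).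
    by rewrite /wgt /= !leq_mul // leq_pexp2l // ?ltnS leq_maxr.
  have := wB (CIf t c1 c2).
  have : (if bev t h then cost c1 h else cost c2 h) <=
         (csz c1 + csz c2) * wgt b (CIf t c1 c2).
    by case: (bev t h) h12 => [/(IH1 _ t1)|/(IH2 _ t2)] hh;
      apply: leq_trans hh _; apply: leq_mul => //; [exact: leq_addr|exact: leq_addl].
  by nia.
- move=> /andP[t1 t2] [/ncost_le h1 h2 h3].
  have m1 : wgt b (CFor tg i e c) = (b tg).+1 * wgt b c.
    rewrite /wgt /=; case: tg t1 {h2} => [|[|[|//]]] _ /=;
      rewrite ?add1n ?add0n ?expnS; ring.
  have h4 : \sum_(j < nev e h)
        (cost c (setv (iteri j (fun j h' => run c (setv h' i j)) h) i j) + 3)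
        <= b tg * (csz c * wgt b c + 3).
    apply: leq_trans (_ : nev e h * (csz c * wgt b c + 3) <= _); last first.
      by rewrite leq_mul2r h2 orbT.
    rewrite -[X in X * _]card_ord -sum_nat_const; apply: leq_sum => j _.
    by rewrite leq_add2r; apply: IH t2 (h3 _ (ltn_ord j)).
  apply: leq_trans (leq_add (leq_add h1 (leqnn 4)) h4) _; rewrite m1.
  move: (wB c); move: (wgt b c) (csz c) (nsz e) (b tg) (b 0) => W cs ne T B hW.
  have e1 : ne * B.+1 <= ne * (T.+1 * W) by rewrite leq_mul2l; apply/orP; right; nia.
  have e2 : T <= T * W by nia.
  nia.
Qed.

Fixpoint modV (c : cmd) : seq nat :=
  match c with
  | CSet i _ => [:: i]
  | CSeq c1 c2 | CIf _ c1 c2 => modV c1 ++ modV c2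
  | CFor _ i _ c => i :: modV c
  | _ => [::]
  end.
Fixpoint modR (c : cmd) : seq nat :=
  match c with
  | CRSet i _ => [:: i]
  | CSeq c1 c2 | CIf _ c1 c2 => modR c1 ++ modR c2
  | CFor _ _ _ c => modR c
  | _ => [::]
  end.
Fixpoint modA (c : cmd) : seq nat :=
  match c with
  | CPut a _ _ _ => [:: a]
  | CSeq c1 c2 | CIf _ c1 c2 => modA c1 ++ modA c2
  | CFor _ _ _ c => modA c
  | _ => [::]
  end.
Fixpoint modX (c : cmd) : bool :=
  match c with
  | CRPut _ _ => true
  | CSeq c1 c2 | CIf _ c1 c2 => modX c1 || modX c2
  | CFor _ _ _ c => modX c
  | _ => false
  end.

Definition fr (c : cmd) h h' : Prop :=
  [/\ forall i, i \notin modV c -> iv h' i = iv h i,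
      forall i, i \notin modR c -> rv h' i = rv h i,
      forall a, a \notin modA c -> ia h' a = ia h a &
      modX c = false -> ra h' = ra h].

Lemma frV c h h' : fr c h h' -> forall i, i \notin modV c -> iv h' i = iv h i.
Proof. by case. Qed.
Lemma frR c h h' : fr c h h' -> forall i, i \notin modR c -> rv h' i = rv h i.
Proof. by case. Qed.
Lemma frA c h h' : fr c h h' -> forall a, a \notin modA c -> ia h' a = ia h a.
Proof. by case. Qed.
Lemma frX c h h' : fr c h h' -> modX c = false -> ra h' = ra h.
Proof. by case. Qed.

Lemma fr_iteri tg i e c h N : (forall h, fr c h (run c h)) ->
  fr (CFor tg i e c) h (iteri N (fun j h' => run c (setv h' i j)) h).
Proof.
move=> H; elim: N => [|N IH]; first by split.
rewrite iteriS; case: IH => a1 a2 a3 a4.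
have [b1 b2 b3 b4] := H (setv (iteri N (fun j h' => run c (setv h' i j)) h) i N).
split=> [l hl|l hl|a ha|hx].
- rewrite b1 /=; last by move: hl; rewrite inE negb_or => /andP[].
  by rewrite /upd; move: (hl); rewrite inE negb_or => /andP[/negPf -> _]; apply: a1.
- by rewrite b2 // a2.
- by rewrite b3 // a3.
- by rewrite b4 // a4.
Qed.

Lemma run_fr c h : fr c h (run c h).
Proof.
elim: c h => [|i e|a e f g|i x|e x|c1 IH1 c2 IH2|t c1 IH1 c2 IH2|tg i e c IH] h /=.
- by split.
- by split=> // l; rewrite inE /= /upd => /negPf ->.
- split=> // l; rewrite inE /= => /negPf hl.
  by apply/funext => e'; apply/funext => f'; rewrite hl.
- by split=> // l; rewrite inE /= /upd => /negPf ->.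
- by split.
- have [a1 a2 a3 a4] := IH1 h; have [b1 b2 b3 b4] := IH2 (run c1 h).
  split=> [l|l|l|] /=.
  + by rewrite mem_cat negb_or => /andP[h1 h2]; rewrite b1 ?a1.
  + by rewrite mem_cat negb_or => /andP[h1 h2]; rewrite b2 ?a2.
  + by rewrite mem_cat negb_or => /andP[h1 h2]; rewrite b3 ?a3.
  + by case/norP => /negPf h1 /negPf h2; rewrite b4 ?a4.
- have [a1 a2 a3 a4] := IH1 h; have [b1 b2 b3 b4] := IH2 h.
  case: (bev t h); split=> [l|l|l|] /=; rewrite ?mem_cat.
  + by case/norP=> h1 h2; rewrite a1.
  + by case/norP=> h1 h2; rewrite a2.
  + by case/norP=> h1 h2; rewrite a3.
  + by case/norP => /negPf h1 /negPf h2; rewrite a4.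
  + by case/norP=> h1 h2; rewrite b1.
  + by case/norP=> h1 h2; rewrite b2.
  + by case/norP=> h1 h2; rewrite b3.
  + by case/norP => /negPf h1 /negPf h2; rewrite b4.
- exact: fr_iteri.
Qed.

Definition wp (b : nat -> nat) (c : cmd) (Q : ist R -> Prop) h : Prop :=
  ok b c h /\ Q (run c h).

Lemma wp_conseq b c (Q Q' : ist R -> Prop) h :
  wp b c Q h -> (forall h', fr c h h' -> Q h' -> Q' h') -> wp b c Q' h.
Proof. by move=> [h1 h2] H; split=> //; apply: H h2; apply: run_fr. Qed.

Lemma wp_seq b c1 c2 Q h :
  wp b c1 (wp b c2 Q) h -> wp b (CSeq c1 c2) Q h.
Proof. by case=> h1 [h2 h3]; split. Qed.

Lemma wp_skip b Q h : Q h -> wp b CSkip Q h.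
Proof. by []. Qed.

Lemma wp_set b i e Q h : nok (b 0) e h -> Q (setv h i (nev e h)) -> wp b (CSet i e) Q h.
Proof. by []. Qed.

Lemma wp_put b a e f g Q h :
  [/\ nok (b 0) e h, nok (b 0) f h, nok (b 0) g h & nev e h <= b 0] ->
  Q (seta h a (nev e h) (nev f h) (nev g h)) -> wp b (CPut a e f g) Q h.
Proof. by []. Qed.

Lemma wp_rset b i x Q h : rok (b 0) x h -> Q (setr h i (rev_ x h)) -> wp b (CRSet i x) Q h.
Proof. by []. Qed.

Lemma wp_rput b e x Q h : nok (b 0) e h /\ rok (b 0) x h ->
  Q (setx h (nev e h) (rev_ x h)) -> wp b (CRPut e x) Q h.
Proof. by []. Qed.

Lemma wp_if b t c1 c2 Q h : bok (b 0) t h ->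
  (if bev t h then wp b c1 Q h else wp b c2 Q h) -> wp b (CIf t c1 c2) Q h.
Proof. by rewrite /wp /=; case: (bev t h) => h1 [h2 h3]. Qed.

Lemma wp_for (I : nat -> ist R -> Prop) b tg i e c Q h :
  nok (b 0) e h -> nev e h <= b tg -> I 0 h ->
  (forall j h', j < nev e h -> fr (CFor tg i e c) h h' -> I j h' ->
     wp b c (I j.+1) (setv h' i j)) ->
  (forall h', fr (CFor tg i e c) h h' -> I (nev e h) h' -> Q h') ->
  wp b (CFor tg i e c) Q h.
Proof.
move=> h1 h2 h3 h4 h5.
have frI N : fr (CFor tg i e c) h (iteri N (fun j h' => run c (setv h' i j)) h).
  by apply: fr_iteri; apply: run_fr.
have II N : N <= nev e h -> I N (iteri N (fun j h' => run c (setv h' i j)) h).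
  elim: N => [//|N IH] hN; rewrite iteriS.
  by have [] := h4 N _ hN (frI N) (IH (ltnW hN)).
split; last by apply: h5; [apply: frI|apply: II].
by split=> // j hj; have [] := h4 j _ hj (frI j) (II j (ltnW hj)).
Qed.

End Logic.

(* Restates the hypotheses on the store h0 for the later store of the frame F. *)
Ltac mv h0 F :=
  repeat match goal with
  | H : context [iv h0 ?i] |- _ =>
      let E := fresh "E" in have E := frV F (i := i) isT; rewrite /= /upd /= in E;
      rewrite -E in H; clear E
  | H : context [rv h0 ?i] |- _ =>
      let E := fresh "E" in have E := frR F (i := i) isT; rewrite /= /upd /= in E;
      rewrite -E in H; clear E
  | H : context [ia h0 ?a] |- _ =>
      let E := fresh "E" in have E := frA F (a := a) isT; rewrite /= in E;
      rewrite -E in H; clear E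
  | H : context [ra h0] |- _ =>
      let E := fresh "E" in have E := frX F erefl; rewrite /= in E;
      rewrite -E in H; clear E
  end.
#[global] Arguments upd {T} f a v b /.

(** * Farthest-first traversal *)

(* Names of integer registers (v...), real registers (x...) and integer arrays
   (a...).  The coreset points are the input points aQI[q], q < vm.  Candidate
   c < vkap is the lattice point Q_(aKQ[c]) + xeta * (aKZ[c, .] - Zc).  Row
   w < vZ consists of a set aIN[w, .] of coreset points and a set aSIG[w, .] of
   candidates; aT[w, .] is the best cover of aIN[w, .] found so far and
   aCNT[w] its size.  Results are written from address vob on. *)
Notation vn := 0 (only parsing). Notation vk := 1 (only parsing).
Notation vob := 2 (only parsing). Notation vf := 3 (only parsing).
Notation vm := 4 (only parsing). Notation vkap := 5 (only parsing).
Notation vZ := 6 (only parsing). Notation vS := 7 (only parsing).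
Notation vnb := 8 (only parsing). Notation vs0 := 9 (only parsing).
Notation vbest := 10 (only parsing). Notation vj := 11 (only parsing).
Notation vp := 12 (only parsing). Notation vl := 13 (only parsing).
Notation vq := 14 (only parsing). Notation vc := 15 (only parsing).
Notation vw := 16 (only parsing). Notation vu := 17 (only parsing).
Notation vv := 18 (only parsing). Notation vi := 19 (only parsing).
Notation vt := 20 (only parsing). Notation vjj := 21 (only parsing).
Notation vrd := 22 (only parsing). Notation vok := 23 (only parsing).
Notation vcnt := 24 (only parsing). Notation vcv := 25 (only parsing).
Notation vdup := 26 (only parsing). Notation veq := 27 (only parsing).
Notation xr2 := 1 (only parsing). Notation xeta := 2 (only parsing).
Notation xrho := 3 (only parsing). Notation xx := 4 (only parsing).
Notation xy := 5 (only parsing). Notation xbd := 6 (only parsing).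
Notation aQI := 0 (only parsing). Notation aOWN := 1 (only parsing).
Notation aKQ := 2 (only parsing). Notation aKZ := 3 (only parsing).
Notation aIN := 4 (only parsing). Notation aSIG := 5 (only parsing).
Notation aT := 6 (only parsing). Notation aCNT := 7 (only parsing).
Notation aNEW := 8 (only parsing). Notation aRES := 9 (only parsing).
Notation "c1 ;; c2" := (CSeq c1 c2) (at level 81, right associativity).
Notation G1 a e := (NG a (NC 0) e) (only parsing).
Notation INC i := (CSet i (NA (NV i) (NC 1))) (only parsing).

Definition sqd (d x l : nat) (A B : rexp) : cmd :=
  CRSet x (RN (NC 0)) ;;
  CFor 0 l (NC d) (CRSet x (RB RAdd (RV x) (RB RMul (RB RSub A B) (RB RSub A B)))).

Definition ptC (d : nat) (e : nexp) : rexp := RG (NA (NM d e) (NV vl)).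

Definition gonz (d D : nat) : cmd :=
  CSet vm (NM D (NV vk)) ;;
  CPut aQI (NC 0) (NC 0) (NC 0) ;;
  CFor 2 vp (NV vn) (CPut aOWN (NC 0) (NV vp) (NC 0)) ;;
  CFor 1 vj (NV vm) (
    CRSet xbd (RB RSub (RN (NC 0)) (RN (NC 1))) ;;
    CSet vbest (NC 0) ;;
    CFor 2 vp (NV vn) (
      sqd d xx vl (ptC d (NV vp)) (ptC d (G1 aOWN (NV vp))) ;;
      CIf (BR (RV xbd) (RV xx)) (CRSet xbd (RV xx) ;; CSet vbest (NV vp)) CSkip) ;;
    CIf (BN (NA (NV vj) (NC 1)) (NV vk)) (CRSet xr2 (RV xbd)) CSkip ;;
    CPut aQI (NC 0) (NA (NV vj) (NC 1)) (NV vbest) ;;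
    CFor 2 vp (NV vn) (
      sqd d xx vl (ptC d (NV vp)) (ptC d (G1 aOWN (NV vp))) ;;
      sqd d xy vl (ptC d (NV vp)) (ptC d (NV vbest)) ;;
      CIf (BR (RV xy) (RV xx)) (CPut aOWN (NC 0) (NV vp) (NV vbest)) CSkip)) ;;
  CSet vm (NA (NV vm) (NC 1)).

Section Specs.
Variable R : realType.
Implicit Types (h : ist R) (P : nat -> nat -> R).

Definition sqdist (d : nat) (f g : nat -> R) : R :=
  (\sum_(l < d) (f l - g l) * (f l - g l))%R.

Lemma sqdist_ge0 d f g : (0 <= sqdist d f g)%R.
Proof. by apply: sumr_ge0 => l _; rewrite -expr2 sqr_ge0. Qed.

Lemma sqdistC d f g : sqdist d f g = sqdist d g f.
Proof. by apply: eq_bigr => l _; ring. Qed.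

Lemma sqdistxx d f : sqdist d f f = 0%R.
Proof. by rewrite /sqdist big1 // => l _; rewrite subrr mulr0. Qed.

Lemma wp_sqd (f g : nat -> R) b d x l A B Q h : d <= b 0 ->
  (forall h' l', l' < d -> fr (sqd d x l A B) h h' -> iv h' l = l' ->
     [/\ rok (b 0) A h', rok (b 0) B h', rev_ A h' = f l' & rev_ B h' = g l']) ->
  (forall h', fr (sqd d x l A B) h h' -> rv h' x = sqdist d f g -> Q h') ->
  wp b (sqd d x l A B) Q h.
Proof.
move=> hd H1 H2.
suff: wp b (sqd d x l A B) (fun h' => rv h' x = sqdist d f g) h.
  by move/wp_conseq; apply.
apply: wp_seq; apply: wp_rset => //=.
apply: (wp_for (I := fun j h' => rv h' x =
  (\sum_(l < j) (f l - g l) * (f l - g l))%R)) => //=.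
- by rewrite big_ord0 /upd eqxx.
- move=> j h' hj F hx.
  have [||a1 a2 a3 a4] := H1 (setv h' l j) j hj.
  + case: F => /= f1 f2 f3 f4; split=> //=.
    * by move=> i hi; rewrite /upd -f1 //; move: hi; rewrite inE => /negPf ->.
    * move=> i hi; rewrite f2 /upd; last by move: hi; rewrite !inE orbb.
      by move: hi; rewrite !inE => /norP[/negPf ->].
  + by rewrite /= /upd eqxx.
  apply: wp_rset; first by [].
  by rewrite /= a3 a4 /upd eqxx big_ord_recr /= hx.
Qed.

Definition ptX (d : nat) (X : nat -> R) (p l : nat) : R := X (d * p + l).

(* The chosen points are q 0, ..., q J, and r2 is the squared radius with which
   the first k of them cover; it is at most the squared distance of any two of
   the first k + 1. *)
Definition gz n k d P (q : nat -> nat) (r2 : R) (J : nat) : Prop :=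
  [/\ forall j, j <= J -> q j < n,
      forall p, p < n -> exists2 j, j <= J & forall i i', i < i' -> i' <= J ->
        (sqdist d (P p) (P (q j)) <= sqdist d (P (q i)) (P (q i')))%R,
      k <= J -> forall p, p < n ->
        exists2 j, j < k & (sqdist d (P p) (P (q j)) <= r2)%R &
      k <= J -> forall i i', i < i' -> i' <= k ->
        (r2 <= sqdist d (P (q i)) (P (q i')))%R].

Lemma gonz_spec b d D n k X h : 0 < n -> 0 < k ->
  d <= b 0 -> D <= b 0 -> D * k <= b 1 -> n <= b 2 ->
  iv h vn = n -> iv h vk = k -> ra h = X -> 0 < D ->
  wp b (gonz d D) (fun h' => [/\ fr (gonz d D) h h', iv h' vm = (D * k).+1 &
    gz n k d (ptX d X) (ia h' aQI 0) (rv h' xr2) (D * k)]) h.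
Proof.
move=> n0 k0 hd hD hDk hn Hn Hk HX D0.
suff: wp b (gonz d D) (fun h' => iv h' vm = (D * k).+1 /\
    gz n k d (ptX d X) (ia h' aQI 0) (rv h' xr2) (D * k)) h.
  by move/wp_conseq; apply=> h' F [].
set P := ptX d X.
apply: wp_seq; apply: wp_set => //=.
apply: wp_seq; apply: wp_put => //=.
apply: wp_seq; rewrite /upd /= Hk.
set h0 := seta _ _ _ _ _.
have Hn0 : iv h0 vn = n by [].
have Hk0 : iv h0 vk = k by [].
have Hm0 : iv h0 vm = D * k by [].
have HX0 : ra h0 = X by [].
have HQ0 : ia h0 aQI 0 0 = 0 by [].
clearbody h0.
apply: (wp_for (I := fun j h' => forall p, p < j -> ia h' aOWN 0 p = 0)) => //=.
- by rewrite Hn0.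
- rewrite Hn0 => j h' hj F H; apply: wp_put => //= p; rewrite ltnS => hp.
  case: eqP => //= hne; apply: H; move: hne; rewrite /upd /=; lia.
rewrite Hn0 => h1 F1 H1.
mv h0 F1.
pose D2 p q := sqdist d (P p) (P q).
apply: wp_seq.
apply: (wp_for (I := fun j h' =>
  [/\ forall i, i <= j -> ia h' aQI 0 i < n,
      forall p, p < n -> exists2 i, i <= j & ia h' aOWN 0 p = ia h' aQI 0 i,
      forall p i, p < n -> i <= j ->
        (D2 p (ia h' aOWN 0 p) <= D2 p (ia h' aQI 0 i))%R,
      forall p i i', p < n -> i < i' -> i' <= j ->
        (D2 p (ia h' aOWN 0 p) <= D2 (ia h' aQI 0 i) (ia h' aQI 0 i'))%R &
      k <= j -> (forall p, p < n ->
        exists2 i, i < k & (D2 p (ia h' aQI 0 i) <= rv h' xr2)%R) /\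
        forall i i', i < i' -> i' <= k ->
        (rv h' xr2 <= D2 (ia h' aQI 0 i) (ia h' aQI 0 i'))%R])) => //=.
- by rewrite Hm0.
- split.
  + by move=> i; rewrite leqn0 => /eqP ->; rewrite HQ0.
  + by move=> p hp; exists 0 => //; rewrite HQ0 H1.
  + by move=> p i hp; rewrite leqn0 => /eqP ->; rewrite HQ0 H1.
  + by move=> p i i' _ h2 h3; lia.
  + by move=> h2; lia.
- rewrite Hm0 => j h2 hj F [I1 I2 I3 I4 I5].
  mv h1 F.
  apply: wp_seq; apply: wp_rset => //=.
  apply: wp_seq; apply: wp_set => //=.
  apply: wp_seq.
  apply: (wp_for (I := fun p h' => [/\ iv h' vbest < n,
     (rv h' xbd <= D2 (iv h' vbest) (ia h' aOWN 0 (iv h' vbest)))%R &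
     forall p', p' < p -> (D2 p' (ia h' aOWN 0 p') <= rv h' xbd)%R])) => //=.
  + by rewrite Hn0.
  + split=> //; apply: (le_trans (y := 0%R)); last exact: sqdist_ge0.
    by rewrite sub0r oppr_le0 ler01.
  + rewrite Hn0 => p h3 hp F3 [J1 J2 J3].
    mv h2 F3.
    apply: wp_seq.
    apply: (@wp_sqd (P p) (P (ia h3 aOWN 0 p))) => //.
      move=> h4 l hl F4 Hl; rewrite /= Hl.
      rewrite (frV F4 (i := vp)) // (frA F4) // (frX F4) //= HX0.
      by split.
    move=> h4 F4 Hx.
    mv h3 F4.
    have Hp : iv h4 vp = p by rewrite (frV F4).
    apply: wp_if => //=; rewrite Hx.
    case: ifPn => [|/negP/negP]; rewrite -?ltNge => hle.
      apply: wp_seq; apply: wp_rset => //=; apply: wp_set => //=.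
      rewrite Hp Hx; split=> // p'; rewrite ltnS leq_eqVlt => /orP[/eqP -> //|hp'].
      exact: le_trans (J3 _ hp') hle.
    apply: wp_skip; split=> // p'; rewrite ltnS leq_eqVlt => /orP[/eqP -> //|]; last exact: J3.
    exact: ltW.
  rewrite Hn0 => h3 F3 [J1 J2 J3].
  mv h2 F3.
  have Hj : iv h3 vj = j by rewrite (frV F3).
  set best := iv h3 vbest in J1 J2.
  have Jb : rv h3 xbd = D2 best (ia h3 aOWN 0 best).
    by apply/eqP; rewrite eq_le J2 J3.
  apply: wp_seq.
  apply: (@wp_conseq _ _ _ (fun h' => [/\ iv h' vn = n, iv h' vk = k, iv h' vm = D * k,
      ra h' = X & ia h' = ia h3] /\
     [/\ iv h' vbest = best, iv h' vj = j &
      rv h' xr2 = if j.+1 <= k then D2 best (ia h3 aOWN 0 best) else rv h3 xr2])).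
    apply: wp_if => //=; rewrite Hj addn1 Hk0.
    by case: ifP => hjk; [apply: wp_rset => //=; rewrite Jb|apply: wp_skip]; rewrite ?hjk.
  move=> h4 _ [[Hn4 Hk4 Hm4 HX4 Ha4] [Hb4 Hj4 Hr4]].
  rewrite -!Ha4 in Hr4 I1 I2 I3 I4 I5 J3 Jb.
  apply: wp_seq; apply: wp_put => //=; rewrite Hj4 Hb4 addn1.
  apply: (wp_for (I := fun p h' => forall p', p' < n ->
    ia h' aOWN 0 p' = if (p' < p) && (D2 p' best <= D2 p' (ia h4 aOWN 0 p'))%R
                      then best else ia h4 aOWN 0 p')) => //=.
  + by rewrite Hn4.
  + rewrite Hn4 => p h5 hp F5 J.
    have Ho : ia h5 aOWN 0 p = ia h4 aOWN 0 p by rewrite J // ltnn.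
    have HX5 : ra h5 = X by rewrite (frX F5).
    have Hb5 : iv h5 vbest = best by rewrite (frV F5).
    apply: wp_seq.
    apply: (@wp_sqd (P p) (P (ia h5 aOWN 0 p))) => //.
      move=> h6 l hl F6 Hl; rewrite /= Hl.
      rewrite (frV F6 (i := vp)) // (frA F6) // (frX F6) //= HX5.
      by split.
    move=> h6 F6 Hx6.
    mv h5 F6.
    have Hp6 : iv h6 vp = p by rewrite (frV F6).
    apply: wp_seq.
    apply: (@wp_sqd (P p) (P best)) => //.
      move=> h7 l hl F7 Hl; rewrite /= Hl.
      rewrite (frV F7 (i := vp)) // (frV F7 (i := vbest)) // (frX F7) //= HX5 Hb5 Hp6.
      by split.
    move=> h7 F7 Hx7.
    mv h6 F7.
    apply: wp_if => //=; rewrite Hx6 Hx7 Ho.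
    have step p' : p' < n -> p' != p -> (p' < p.+1) = (p' < p).
      by move=> _ h8; rewrite ltnS leq_eqVlt (negPf h8).
    case: ifPn => hle.
      apply: wp_put => //= p' hp'; rewrite Hb5 Hp6.
      case: eqP => [->|/eqP hne] /=; first by rewrite ltnSn hle.
      by rewrite J // step.
    apply: wp_skip => p' hp'; rewrite J //.
    have [->|hne] := eqVneq p' p; first by rewrite ltnn ltnSn (negPf hle).
    by rewrite step.
  rewrite Hn4 => h5 F5 J.
  have Hr5 : rv h5 xr2 = rv h4 xr2 by rewrite (frR F5).
  have HQ5 i : ia h5 aQI 0 i = if i == j.+1 then best else ia h4 aQI 0 i.
    by rewrite (frA F5) //=.
  have HQl i : i <= j -> ia h5 aQI 0 i = ia h4 aQI 0 i.
    by move=> hi; rewrite HQ5; case: eqP => // hh; lia.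
  have HQj : ia h5 aQI 0 j.+1 = best by rewrite HQ5 eqxx.
  have J' p : p < n -> ia h5 aOWN 0 p =
     if (D2 p best <= D2 p (ia h4 aOWN 0 p))%R then best else ia h4 aOWN 0 p.
    by move=> hp; rewrite J // hp.
  have own_le p : p < n -> (D2 p (ia h5 aOWN 0 p) <= D2 p (ia h4 aOWN 0 p))%R.
    by move=> hp; rewrite J' //; case: ifP.
  have K4 p i i' : p < n -> i < i' -> i' <= j.+1 ->
      (D2 p (ia h4 aOWN 0 p) <= D2 (ia h5 aQI 0 i) (ia h5 aQI 0 i'))%R.
    move=> hp hi; rewrite leq_eqVlt ltnS => /orP[/eqP hi'|hi'].
      rewrite hi' HQj HQl; last by lia.
      apply: le_trans (J3 _ hp) _; rewrite Jb [X in (_ <= X)%R]sqdistC.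
      by apply: I3 => //; lia.
    by rewrite !HQl; [apply: I4|lia|lia].
  split.
  + move=> i; rewrite leq_eqVlt ltnS => /orP[/eqP ->|hi]; first by rewrite HQj.
    by rewrite HQl //; apply: I1.
  + move=> p hp; rewrite J' //; case: ifP => _; first by exists j.+1; rewrite ?HQj.
    by have [i hi ->] := I2 _ hp; exists i; rewrite ?HQl // ltnW.
  + move=> p i hp; rewrite leq_eqVlt ltnS => /orP[/eqP ->|hi].
      by rewrite HQj J' //; case: ifPn => //; rewrite -ltNge => /ltW.
    by rewrite HQl //; apply: le_trans (own_le _ hp) (I3 _ _ hp hi).
  + move=> p i i' hp h8 h9; exact: le_trans (own_le _ hp) (K4 _ _ _ hp h8 h9).
  + move=> hkj; rewrite Hr5 Hr4; case: ifP => hjk.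
      have ek : k = j.+1 by lia.
      split=> [p hp|i i' hi hi'].
        have [i hi hi'] := I2 _ hp; exists i; first by lia.
        by rewrite HQl // -hi' -Jb; apply: J3.
      by apply: K4; lia.
    have [] := I5; first by lia.
    have -> : rv h3 xr2 = rv h4 xr2 by rewrite Hr4 hjk.
    move=> K5 K6; split=> [p hp|i i' hi hi'].
      by have [i hi hi'] := K5 _ hp; exists i; rewrite ?HQl //; lia.
    by rewrite !HQl; [apply: K6|lia|lia].
rewrite Hm0 => h2 F [I1 I2 I3 I4 I5].
mv h1 F.
apply: wp_set => //=; rewrite Hm0 addn1; split=> //; split=> //.
- move=> p hp; have [i hi hi'] := I2 _ hp; exists i => // a a' ha ha'.
  by rewrite -hi'; apply: I4.
- by move=> hk; case: (I5 hk).
- by move=> hk; case: (I5 hk).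
Qed.
End Specs.

(** * Candidates and rows *)

Definition ptQ (d : nat) (q l : nexp) : rexp := RG (NA (NM d (G1 aQI q)) l).
Definition ptK (d Zc : nat) (c l : nexp) : rexp :=
  RB RAdd (ptQ d (G1 aKQ c) l)
          (RB RMul (RV xeta) (RB RSub (RN (NG aKZ c l)) (RN (NC Zc)))).

(* Appends to the cv entries present at the start a modified copy of each one for
   every value of t; iterating it produces all combinations of choices. *)
Definition ext (cv w t : nat) (bnd : nexp) (body : cmd) : cmd :=
  CFor 0 w (NV cv) (CFor 0 t bnd (body ;; INC cv)).

Definition kbody (d : nat) : cmd :=
  CPut aKQ (NC 0) (NV vkap) (G1 aKQ (NV vw)) ;;
  CFor 0 vl (NC d) (CPut aKZ (NV vkap) (NV vl) (NG aKZ (NV vw) (NV vl))) ;;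
  CPut aKZ (NV vkap) (NV vi) (NV vt).

Definition kgen (d Zc : nat) : cmd :=
  CFor 0 vq (NV vm) (
    CPut aKQ (NC 0) (NV vq) (NV vq) ;;
    CFor 0 vl (NC d) (CPut aKZ (NV vq) (NV vl) (NC Zc))) ;;
  CSet vkap (NV vm) ;;
  CFor 0 vi (NC d) (ext vkap vw vt (NC (2 * Zc).+1) (kbody d)).

Definition rbody (bt : bexp) (sg : bool) : cmd :=
  CFor 0 vq (NV vm)
    (CIf bt (CPut aIN (NV vZ) (NV vq) (NG aIN (NV vw) (NV vq)))
            (CPut aIN (NV vZ) (NV vq) (NC 0))) ;;
  CFor 0 vt (NV vkap) (CPut aSIG (NV vZ) (NV vt) (NG aSIG (NV vw) (NV vt))) ;;
  CPut aSIG (NV vZ) (NV vc) (if sg then NC 1 else NG aSIG (NV vw) (NV vc)).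

Definition rext (bt : bexp) (sg : bool) : cmd :=
  ext vZ vw vc (NV vkap) (rbody bt sg).

Definition rows (d Zc : nat) : cmd :=
  CSet vZ (NC 1) ;;
  CFor 0 vq (NV vm) (CPut aIN (NC 0) (NV vq) (NC 1)) ;;
  CFor 0 vc (NV vkap) (CPut aSIG (NC 0) (NV vc) (NC 0)) ;;
  CFor 0 vi (NV vnb) (
    rext (BR (ptK d Zc (NV vc) (NV vi)) (ptQ d (NV vq) (NV vi))) false ;;
    rext (BR (ptQ d (NV vq) (NV vi)) (ptK d Zc (NV vc) (NV vi))) false) ;;
  CFor 0 vi (NV vS) (rext (BN (NC 0) (NC 0)) true).

Section Specs2.
Variable R : realType.
Implicit Types (h : ist R) (P : nat -> nat -> R).

Lemma wp_ext (A : Type) (repr : ist R -> nat -> A -> Prop) (f : nat -> A -> A)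
    b cv w t bnd body Z0 N h :
  cv \notin modV body -> w != cv -> t != cv ->
  w \notin modV body -> t \notin modV body -> w != t ->
  iv h cv = Z0 -> Z0 <= b 0 -> N <= b 0 ->
  (forall h', fr (ext cv w t bnd body) h h' -> nok (b 0) bnd h' /\ nev bnd h' = N) ->
  (forall h' w0 t0 Z, fr (ext cv w t bnd body) h h' ->
     iv h' w = w0 -> iv h' t = t0 -> iv h' cv = Z -> w0 < Z0 -> t0 < N ->
     Z0 <= Z -> Z < Z0 + Z0 * N ->
     wp b body (fun h'' => (forall a, repr h' w0 a -> repr h'' Z (f t0 a)) /\
        (forall w' a, w' < Z -> repr h' w' a -> repr h'' w' a)) h') ->
  (forall h' h'' w' a, ra h' = ra h'' -> ia h' = ia h'' ->
     (forall i, i \notin [:: cv; w; t] -> iv h' i = iv h'' i) ->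
     repr h' w' a -> repr h'' w' a) ->
  wp b (ext cv w t bnd body) (fun h'' =>
    [/\ iv h'' cv = Z0 + Z0 * N,
     forall w' a, w' < Z0 -> repr h w' a -> repr h'' w' a,
     forall w0 t0 a, w0 < Z0 -> t0 < N -> repr h w0 a ->
       exists2 w', w' < Z0 + Z0 * N & repr h'' w' (f t0 a) &
     (forall w', w' < Z0 -> exists a, repr h w' a) ->
     forall w', w' < Z0 + Z0 * N -> exists a, repr h'' w' a]) h.
Proof.
move=> ncv nwcv ntcv nw nt nwt Hcv HZ0 HN Hbnd Hbody Hloc.
pose J Z h' := [/\ iv h' cv = Z,
  forall w' a, w' < Z0 -> repr h w' a -> repr h' w' a &
  forall w0 t0 a, w0 < Z0 -> t0 < N -> Z0 + w0 * N + t0 < Z -> repr h w0 a ->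
    repr h' (Z0 + w0 * N + t0) (f t0 a)].
suff: wp b (ext cv w t bnd body) (J (Z0 + Z0 * N)) h.
  move/wp_conseq; apply=> h' F [J1 J2 J3]; split=> //.
    move=> w0 t0 a hw ht ha; have lt : Z0 + w0 * N + t0 < Z0 + Z0 * N by nia.
    by exists (Z0 + w0 * N + t0) => //; apply: J3.
  move=> all w' hw'; case: (ltnP w' Z0) => [hlt|hge].
    by have [a ha] := all _ hlt; exists a; apply: J2.
  have N0 : 0 < N by nia.
  pose v := w' - Z0; have ev := divn_eq v N.
  have h1 : v %/ N < Z0 by rewrite ltn_divLR // /v; nia.
  have [a ha] := all _ h1; exists (f (v %% N) a).
  have -> : w' = Z0 + v %/ N * N + v %% N by rewrite /v in ev *; lia.
  by apply: J3 => //; [rewrite ltn_mod | rewrite -addnA -ev /v; lia].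
have frt h1 h2 : fr (ext cv w t bnd body) h h1 -> ra h1 = ra h2 -> rv h1 = rv h2 ->
  ia h1 = ia h2 -> (forall i, i \notin [:: cv; w; t] -> iv h1 i = iv h2 i) ->
  fr (ext cv w t bnd body) h h2.
  move=> [f1 f2 f3 f4] e1 e2 e3 e4; split.
  + move=> i hi; rewrite -e4 ?f1 //; apply: contra hi.
    rewrite /= !inE mem_cat inE => /or3P[] /eqP ->; by rewrite eqxx ?orbT.
  + by move=> i hi; rewrite -e2 f2.
  + by move=> a ha; rewrite -e3 f3.
  + by move=> hx; rewrite -e1 f4.
apply: (wp_for (I := fun w0 h' => J (Z0 + w0 * N) h')) => //=.
- by rewrite Hcv.
- split=> // [|w0 t0 a]; first by rewrite mul0n addn0.
  by rewrite mul0n addn0 => *; lia.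
- rewrite Hcv => w0 h1 hw0 F1 [J1 J2 J3].
  have F1' : fr (ext cv w t bnd body) h (setv h1 w w0).
    apply: frt F1 _ _ _ _ => //= i; rewrite !inE !negb_or => /and3P[_ /negPf -> _] //.
  have [Hok HN1] := Hbnd _ F1'.
  apply: (wp_for (I := fun t0 h' => J (Z0 + w0 * N + t0) h' /\ iv h' w = w0)) => //=.
  + by rewrite HN1.
  + rewrite eqxx addn0; split=> //; split=> /=.
    * by rewrite eq_sym (negPf nwcv).
    * move=> w' a hw' ha; apply: Hloc (J2 _ _ hw' ha) => //= i.
      by rewrite !inE !negb_or => /and3P[_ /negPf -> _].
    * move=> w1 t1 a hw1 ht1 hlt ha; apply: Hloc (J3 _ _ _ hw1 ht1 hlt ha) => //= i.
      by rewrite !inE !negb_or => /and3P[_ /negPf -> _].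
  + rewrite HN1 => t0 h2 ht0 F2 [[K1 K2 K3] K4].
    have F2' : fr (ext cv w t bnd body) h (setv h2 t t0).
      have F2a : fr (ext cv w t bnd body) h h2.
        case: F1' F2 => f1 f2 f3 f4 [g1 g2 g3 g4]; split.
        - move=> i hi; rewrite g1 ?f1 //; apply: contra hi => /=; rewrite !inE.
          by move=> ->; rewrite orbT.
        - by move=> i hi; rewrite g2 ?f2.
        - by move=> i hi; rewrite g3 ?f3.
        - by move=> hx; rewrite g4 ?f4.
      apply: frt F2a _ _ _ _ => //= i; rewrite !inE !negb_or => /and3P[_ _ /negPf ->] //.
    apply: wp_seq.
    have Hb := Hbody (setv h2 t t0) w0 t0 (Z0 + w0 * N + t0) F2'.
    apply: wp_conseq (Hb _ _ _ _ _ _ _) _ => //=.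
    * by rewrite (negPf nwt).
    * by rewrite eqxx.
    * by rewrite eq_sym (negPf ntcv).
    * by lia.
    * by nia.
    move=> h3 F3 [L1 L2].
    have e1 : iv h3 cv = Z0 + w0 * N + t0.
      by rewrite (frV F3) //= eq_sym (negPf ntcv).
    apply: wp_set => //=; split=> /=; last first.
      by rewrite (negPf nwcv) (frV F3) //= (negPf nwt).
    have loc w' a : repr h3 w' a -> repr (setv h3 cv (iv h3 cv + 1)) w' a.
      apply: Hloc => //= i; rewrite !inE !negb_or => /and3P[/negPf -> _ _] //.
    have loc2 w' a : repr h2 w' a -> repr (setv h2 t t0) w' a.
      apply: Hloc => //= i; rewrite !inE !negb_or => /and3P[_ _ /negPf ->] //.
    split=> /=.
    * by rewrite eqxx e1; lia.
    * by move=> w' a hw' ha; apply/loc/L2/loc2/K2 => //; lia.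
    * move=> w1 t1 a hw1 ht1; rewrite addnS ltnS leq_eqVlt => /orP[/eqP he|hlt] ha.
        have [ew et] : w1 = w0 /\ t1 = t0.
          have e2 : w1 = w0 by case: (ltngtP w1 w0) => // ?; nia.
          by split=> //; subst; lia.
        by subst w1 t1; apply/loc/L1/loc2/K2.
      by apply/loc/L2/loc2/K3.
  + by rewrite HN1 => h2 F2 [[K1 K2 K3] _]; split=> //; rewrite -?K1 ?mulSn; 
       [rewrite K1; lia|move=> *; apply: K3 => //; lia].
- by rewrite Hcv.
Qed.

Definition krep m d Zc h w (a : nat * (nat -> nat)) : Prop :=
  [/\ ia h aKQ 0 w = a.1, forall l, l < d -> ia h aKZ w l = a.2 l, a.1 < m &
      forall l, l < d -> a.2 l <= 2 * Zc].

Lemma krep_ext m d Zc h w q z z' : (forall l, l < d -> z l = z' l) ->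
  krep m d Zc h w (q, z) -> krep m d Zc h w (q, z').
Proof.
move=> e [/= h1 h2 h3 h4]; split=> //= l hl; first by rewrite h2 // e.
by rewrite -e // h4.
Qed.

Lemma kgen_spec b d Zc m h : d <= b 0 -> (2 * Zc).+1 <= b 0 ->
  m * (2 * Zc).+2 ^ d <= b 0 -> iv h vm = m ->
  wp b (kgen d Zc) (fun h' => let kap := m * (2 * Zc).+2 ^ d in
    [/\ iv h' vkap = kap,
     forall w, w < kap -> exists a, krep m d Zc h' w a,
     forall q z, q < m -> (forall l, l < d -> z l <= 2 * Zc) ->
       exists2 w, w < kap & krep m d Zc h' w (q, z) &
     forall q, q < m -> krep m d Zc h' q (q, fun=> Zc)]) h.
Proof.
move=> hd hZ hb Hm.
have mb : m <= b 0.
  by apply: leq_trans hb; rewrite leq_pmulr // expn_gt0.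
apply: wp_seq.
apply: (wp_for (I := fun j h' => forall q, q < j -> krep m d Zc h' q (q, fun=> Zc))) => //=.
- by rewrite Hm.
- rewrite Hm => q h1 hq F1 I1.
  apply: wp_seq; apply: wp_put => //=.
  apply: (wp_for (I := fun j h' => (forall q', q' < q -> krep m d Zc h' q' (q', fun=> Zc)) /\
     ia h' aKQ 0 q = q /\ forall l, l < j -> ia h' aKZ q l = Zc)) => //=.
  + split; last by rewrite eqxx.
    move=> q' hq'; have [/= k1 k2 k3 k4] := I1 _ hq'; split=> //=.
    by rewrite (ltn_eqF hq').
  + move=> l h2 hl F2 [J1 [J2 J3]].
    have Hq : iv h2 vq = q by rewrite (frV F2).
    apply: wp_put => /=; first by rewrite Hq; split=> //; lia.
    rewrite Hq; split; [|split=> //].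
      move=> q' hq'; have [/= k1 k2 k3 k4] := J1 _ hq'; split=> //= l' hl'.
      by rewrite (ltn_eqF hq') /= k2.
    move=> l'; rewrite ltnS leq_eqVlt eqxx => /orP[->//|hl'].
    by case: eqP => // _; rewrite J3.
  + move=> h2 F2 [J1 [J2 J3]] q'; rewrite ltnS leq_eqVlt => /orP[/eqP ->|]; last exact: J1.
    by split=> //= l hl; lia.
rewrite Hm => h1 F1 I1.
mv h F1.
apply: wp_seq; apply: wp_set => //=; rewrite Hm.
apply: (wp_for (I := fun i h' => let kap := m * (2 * Zc).+2 ^ i in
    [/\ iv h' vkap = kap,
     forall w, w < kap -> exists a, krep m d Zc h' w a,
     forall q z, q < m -> (forall l, l < d -> z l <= 2 * Zc) ->
       (forall l, l < d -> i <= l -> z l = Zc) ->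
       exists2 w, w < kap & krep m d Zc h' w (q, z) &
     forall q, q < m -> krep m d Zc h' q (q, fun=> Zc)])) => //=.
- rewrite expn0 muln1; split=> //.
  + by move=> w hw; exists (w, fun=> Zc); apply: I1.
  + move=> q z hq hz hz'; exists q => //.
    by apply: krep_ext (I1 _ hq) => l hl; rewrite hz'.
- move=> i h2 hi F2 [J1 J2 J3 J4].
  set Z0 := m * (2 * Zc).+2 ^ i in J1 J2 J3 *.
  have eZ : m * (2 * Zc).+2 ^ i.+1 = Z0 + Z0 * (2 * Zc).+1.
    by rewrite expnS /Z0; lia.
  have Zb : m * (2 * Zc).+2 ^ i.+1 <= b 0.
    by apply: leq_trans hb; rewrite leq_mul2l leq_pexp2l ?orbT.
  rewrite eZ in Zb *.
  have H := @wp_ext _ (krep m d Zc) (fun t a => (a.1, upd a.2 i t)) b vkap vw vt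
    (NC (2 * Zc).+1) (kbody d) Z0 (2 * Zc).+1 (setv h2 vi i).
  apply: wp_conseq; first apply: H => //=.
  + by lia.
  + move=> h3 w0 t0 Z F3 Hw Ht HZ0 hw0 ht0 hge hlt.
    have Hi : iv h3 vi = i by rewrite (frV F3).
    apply: wp_seq; apply: wp_put => //=; rewrite Hw HZ0.
    have nwZ : w0 == Z = false by apply/eqP; lia.
    apply: wp_seq.
    apply: (wp_for (I := fun j h' => [/\
       forall w', ia h' aKQ 0 w' = if w' == Z then ia h3 aKQ 0 w0 else ia h3 aKQ 0 w',
       forall w' l, w' != Z -> ia h' aKZ w' l = ia h3 aKZ w' l &
       forall l, l < j -> ia h' aKZ Z l = ia h3 aKZ w0 l])) => //=.
    * move=> l h4 hl F4 [K1 K2 K3].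
      have Hw4 : iv h4 vw = w0 by rewrite (frV F4).
      have HZ4 : iv h4 vkap = Z by rewrite (frV F4).
      apply: wp_put => /=; first by rewrite Hw4 HZ4; split=> //; [split=> //; lia|lia].
      rewrite HZ4 Hw4; split=> //=.
        by move=> w' l' hw'; rewrite (negPf hw') /= K2.
      move=> l'; rewrite ltnS leq_eqVlt eqxx /= => /orP[/eqP ->|hl'].
        by rewrite eqxx K2 // nwZ.
      by case: eqP => [hh|_]; [lia|rewrite K3].
    * move=> h4 F4 [K1 K2 K3].
      have Ht4 : iv h4 vt = t0 by rewrite (frV F4).
      have HZ4 : iv h4 vkap = Z by rewrite (frV F4).
      have Hi4 : iv h4 vi = i by rewrite (frV F4).
      apply: wp_put => /=; first by rewrite HZ4; split=> //; lia.
      rewrite HZ4 Ht4 Hi4; split.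
        move=> a [k1 k2 k3 k4]; split=> //=.
        - by rewrite K1 eqxx.
        - by move=> l hl; rewrite eqxx /=; case: eqP => // _; rewrite K3 // k2.
        - by move=> l hl; case: eqP => // _; apply: k4.
      move=> w' a hw' [k1 k2 k3 k4].
      have nw' : w' == Z = false by apply/eqP; lia.
      by split=> //= [|l hl]; rewrite ?K1 nw' //= K2 ?nw' // k2.
  + move=> h' h'' w' a _ e2 _ [k1 k2 k3 k4]; split=> //.
      by rewrite -e2.
    by move=> l hl; rewrite -e2 k2.
  move=> h3 F3 [L1 L2 L3 L4]; split=> //.
  + by apply: L4; apply: J2.
  + move=> q z hq hz hz'.
    have [|||w hw kw] := J3 q (upd z i Zc).
    * by [].
    * by move=> l hl /=; case: eqP => // _; [lia|apply: hz].
    * move=> l hl hil /=; case: eqP => // hne; apply: hz' => //; lia.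
    have [w' hw' kw'] := L3 _ (z i) _ hw (hz i hi) kw.
    exists w' => //; apply: krep_ext kw' => l hl /=.
    by case: eqP => [->|].
  + move=> q hq; apply: L2 (J4 _ hq) .
    by apply: leq_trans hq _; rewrite leq_pmulr // expn_gt0.
- move=> h2 F2 [J1 J2 J3 J4]; split=> // q z hq hz; apply: J3 => // l hl; lia.
Qed.

Definition Qpt d h q l : R := ra h (d * ia h aQI 0 q + l).
Definition Kpt d Zc h c l : R :=
  (Qpt d h (ia h aKQ 0 c) l + rv h xeta * ((ia h aKZ c l)%:R - Zc%:R))%R.

Definition rrep m kap h w (a : (nat -> bool) * (nat -> bool)) : Prop :=
  (forall q, q < m -> ia h aIN w q = a.1 q :> nat) /\
  (forall c, c < kap -> ia h aSIG w c = a.2 c :> nat).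

Lemma wp_rext b bt sg m kap Z0 (tq : nat -> nat -> bool) h :
  iv h vm = m -> iv h vkap = kap -> iv h vZ = Z0 ->
  m <= b 0 -> kap <= b 0 -> Z0 + Z0 * kap <= b 0 ->
  (forall h' c q, c < kap -> q < m -> iv h' vc = c -> iv h' vq = q ->
     fr (rext bt sg) h h' -> bok (b 0) bt h' /\ bev bt h' = tq c q) ->
  wp b (rext bt sg) (fun h' =>
    [/\ iv h' vZ = Z0 + Z0 * kap,
     forall w a, w < Z0 -> rrep m kap h w a -> rrep m kap h' w a,
     forall w c a, w < Z0 -> c < kap -> rrep m kap h w a ->
       exists2 w', w' < Z0 + Z0 * kap & rrep m kap h' w'
         (fun q => tq c q && a.1 q, fun c' => (sg && (c' == c)) || a.2 c') &
     (forall w, w < Z0 -> exists a, rrep m kap h w a) ->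
     forall w, w < Z0 + Z0 * kap -> exists a, rrep m kap h' w a]) h.
Proof.
move=> Hm Hk HZ mb kb Zb Ht.
have H := @wp_ext _ (rrep m kap) (fun c a => (fun q => tq c q && a.1 q,
   fun c' => (sg && (c' == c)) || a.2 c')) b vZ vw vc (NV vkap) (rbody bt sg) Z0 kap h.
apply: H => //; try by case: (sg).
- by lia.
- by move=> h' F; split=> //=; rewrite (frV F).
- move=> h1 w c Z F Hw Hc HZ1 hw hc hge hlt.
  have nwZ : w == Z = false by apply/eqP; lia.
  have Hm1 : iv h1 vm = m by rewrite (frV F).
  have Hk1 : iv h1 vkap = kap by rewrite (frV F).
  apply: wp_seq.
  apply: (wp_for (I := fun j h' =>
     (forall w' q, w' != Z -> ia h' aIN w' q = ia h1 aIN w' q) /\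
     forall q, q < j -> ia h' aIN Z q = if tq c q then ia h1 aIN w q else 0)) => //=.
  + by rewrite Hm1.
  + rewrite Hm1 => q h2 hq F2 [J1 J2].
    have Hw2 : iv h2 vw = w by rewrite (frV F2).
    have HZ2 : iv h2 vZ = Z by rewrite (frV F2).
    have [|||Hok Hbt] := Ht (setv h2 vq q) c q hc hq.
    * by rewrite /= (frV F2).
    * by [].
    * case: F F2 => f1 f2 f3 f4 [g1 g2 g3 g4]; split.
      - move=> i hi /=; move: (hi); rewrite /rext /ext /= !inE => /norP[_ /norP[_ /norP[hne _]]].
        rewrite (negPf hne) g1 ?f1 //=; by rewrite !inE hne.
      - by move=> i hi; rewrite /= g2 ?f2.
      - move=> i hi; rewrite /= g3 ?f3 //.
        by move: hi; rewrite /= !inE !negb_or => /andP[-> _].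
      - by move=> hx /=; rewrite g4 ?f4.
    apply: wp_if => //=; rewrite Hbt; case: ifPn => ht.
      apply: wp_put => /=; first by rewrite Hw2 HZ2; split=> //; [split=> //; lia|lia].
      rewrite HZ2 Hw2; split=> /=.
        by move=> w' q' hw'; rewrite (negPf hw') /= J1.
      move=> q'; rewrite ltnS leq_eqVlt eqxx /= => /orP[/eqP ->|hq'].
        by rewrite eqxx J1 ?nwZ // ht.
      by case: eqP => [hh|_]; [lia|rewrite J2].
    apply: wp_put => /=; first by rewrite HZ2; split=> //; lia.
    rewrite HZ2; split=> /=.
      by move=> w' q' hw'; rewrite (negPf hw') /= J1.
    move=> q'; rewrite ltnS leq_eqVlt eqxx /= => /orP[/eqP ->|hq'].
      by rewrite eqxx (negPf ht).
    by case: eqP => [hh|_]; [lia|rewrite J2].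
  rewrite Hm1 => h2 F2 [J1 J2].
  mv h1 F2.
  apply: wp_seq.
  apply: (wp_for (I := fun j h' =>
     (forall w' q, w' != Z -> ia h' aSIG w' q = ia h2 aSIG w' q) /\
     forall q, q < j -> ia h' aSIG Z q = ia h2 aSIG w q)) => //=.
  + by rewrite Hk1.
  + rewrite Hk1 => q h3 hq F3 [K1 K2].
    have Hw3 : iv h3 vw = w by rewrite (frV F3).
    have HZ3 : iv h3 vZ = Z by rewrite (frV F3).
    apply: wp_put => /=; first by rewrite Hw3 HZ3; split=> //; [split=> //; lia|lia].
    rewrite HZ3 Hw3; split=> /=.
      by move=> w' q' hw'; rewrite (negPf hw') /= K1.
    move=> q'; rewrite ltnS leq_eqVlt eqxx /= => /orP[/eqP ->|hq'].
      by rewrite eqxx K1 ?nwZ.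
    by case: eqP => [hh|_]; [lia|rewrite K2].
  rewrite Hk1 => h3 F3 [K1 K2].
  have Hw3 : iv h3 vw = w by rewrite (frV F3).
  have Hc3 : iv h3 vc = c by rewrite (frV F3).
  have HZ3 : iv h3 vZ = Z by rewrite (frV F3).
  have eI : ia h3 aIN = ia h2 aIN by rewrite (frA F3).
  have e1 : ia h2 aSIG = ia h1 aSIG by rewrite (frA F2).
  apply: wp_put => /=.
    by rewrite HZ3; split=> //; [case: (sg) => //=; rewrite Hw3; split=> //|]; lia.
  rewrite HZ3 Hc3.
  have -> : nev (if sg then NC 1 else NG aSIG (NV vw) (NV vc)) h3 =
     if sg then 1 else ia h2 aSIG w c.
    by case: (sg) => //=; rewrite Hw3 Hc3 K1 ?nwZ.
  split.
    move=> a [r1 r2]; split=> /=.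
      by move=> q hq; rewrite eI J2 // r1 //; case: (tq c q).
    move=> c' hc'; rewrite eqxx /=; case: eqP => [->|_].
      by case: (sg) => //=; rewrite e1 r2.
    by rewrite andbF K2 // e1 r2.
  move=> w' a hw' [r1 r2]; have nw' : w' == Z = false by apply/eqP; lia.
  by split=> /= x hx; rewrite ?nw' ?eI /= ?J1 ?K1 ?nw' ?e1 ?r1 ?r2.
- move=> h' h'' w a _ e2 _ [r1 r2]; split=> [q hq|c hc]; rewrite -e2; [exact: r1|exact: r2].
Qed.

Lemma rrep_ext m kap h w a a' : (forall q, q < m -> a.1 q = a'.1 q) ->
  (forall c, c < kap -> a.2 c = a'.2 c) -> rrep m kap h w a -> rrep m kap h w a'.
Proof.
by move=> e1 e2 [r1 r2]; split=> x hx; [rewrite r1 // e1|rewrite r2 // e2].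
Qed.

Lemma rows_spec b d Zc m kap nb S h :
  iv h vm = m -> iv h vkap = kap -> iv h vnb = nb -> iv h vS = S ->
  m <= kap -> kap <= b 0 -> d <= b 0 -> nb <= b 0 -> S <= b 0 ->
  kap.+1 ^ (2 * nb + S) <= b 0 ->
  let T1 i c q := (Kpt d Zc h c i <= Qpt d h q i)%R in
  let T2 i c q := (Qpt d h q i <= Kpt d Zc h c i)%R in
  wp b (rows d Zc) (fun h' =>
    [/\ iv h' vZ = kap.+1 ^ (2 * nb + S),
     forall w, w < kap.+1 ^ (2 * nb + S) -> exists a, rrep m kap h' w a &
     forall (lo hi : nat -> nat) (s : seq nat), (forall i, i < nb -> lo i < kap) ->
       (forall i, i < nb -> hi i < kap) -> size s <= S -> all (fun c => c < kap) s ->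
       exists2 w, w < kap.+1 ^ (2 * nb + S) & rrep m kap h' w
         (fun q => all (fun i => T1 i (lo i) q && T2 i (hi i) q) (iota 0 nb),
          fun c => c \in s)]) h.
Proof.
move=> Hm Hk Hnb HS mk kb db nbb Sb Zb T1 T2.
apply: wp_seq; apply: wp_set => //=.
apply: wp_seq.
apply: (wp_for (I := fun j h' => forall q, q < j -> ia h' aIN 0 q = 1)) => //=.
- by rewrite Hm; lia.
- move=> q h1 hq F1 I1; apply: wp_put => //= q'; rewrite ltnS leq_eqVlt.
  by case: eqP => //= _ hq'; apply: I1.
rewrite Hm => h1 F1 I1.
mv h F1.
apply: wp_seq.
apply: (wp_for (I := fun j h' => forall q, q < j -> ia h' aSIG 0 q = 0)) => //=.
- by rewrite Hk.
- move=> q h2 hq F2 I2; apply: wp_put => //= q'; rewrite ltnS leq_eqVlt.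
  by case: eqP => //= _ hq'; apply: I2.
rewrite Hk => h2 F2 I2.
mv h1 F2.
have HZ : iv h2 vZ = 1 by rewrite (frV F2) //= (frV F1).
pose env h' := [/\ ra h' = ra h, rv h' xeta = rv h xeta, ia h' aQI = ia h aQI,
  ia h' aKQ = ia h aKQ & ia h' aKZ = ia h aKZ].
have env2 : env h2.
  by split; rewrite ?(frX F2) ?(frX F1) ?(frR F2) ?(frR F1) ?(frA F2) ?(frA F1).
have envK h' c i : env h' -> Kpt d Zc h' c i = Kpt d Zc h c i.
  by case=> e1 e2 e3 e4 e5; rewrite /Kpt /Qpt e1 e2 e3 e4 e5.
have envQ h' q i : env h' -> Qpt d h' q i = Qpt d h q i.
  by case=> e1 e2 e3 e4 e5; rewrite /Qpt e1 e3.
have envF c h' h'' : modX c = false -> xeta \notin modR c ->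
    [/\ aQI \notin modA c, aKQ \notin modA c & aKZ \notin modA c] ->
    fr c h' h'' -> env h' -> env h''.
  move=> m1 m2 [m3 m4 m5] [f1 f2 f3 f4] [e1 e2 e3 e4 e5].
  by split; rewrite ?f4 ?f2 ?f3.
apply: wp_seq.
apply: (wp_for (I := fun j h' => [/\ env h', iv h' vZ = kap.+1 ^ (2 * j),
     forall w, w < kap.+1 ^ (2 * j) -> exists a, rrep m kap h' w a &
     forall (lo hi : nat -> nat), (forall i, i < j -> lo i < kap) ->
       (forall i, i < j -> hi i < kap) -> 
       exists2 w, w < kap.+1 ^ (2 * j) & rrep m kap h' w
         (fun q => all (fun i => T1 i (lo i) q && T2 i (hi i) q) (iota 0 j),
          fun=> false)])) => //=.
- by rewrite Hnb.
- rewrite muln0 expn0; split=> //.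
    move=> w hw; exists (fun=> true, fun=> false); split=> /= x hx.
      have -> : w = 0 by lia.
      by rewrite I1.
    have -> : w = 0 by lia.
    by rewrite I2.
  by move=> lo hi _ _; exists 0.
- rewrite Hnb => i h3 hi F3 [E3 J1 J2 J3].
  mv h2 F3.
  have Zb3 : kap.+1 ^ (2 * i.+1) <= b 0.
    by apply: leq_trans Zb; rewrite leq_pexp2l //; lia.
  have eZ : kap.+1 ^ (2 * i.+1) = kap.+1 ^ (2 * i) * kap.+1 * kap.+1.
    by rewrite -!expnSr; congr (_ ^ _); lia.
  set Z0 := kap.+1 ^ (2 * i) in J1 J2 J3 eZ.
  set h3' := setv h3 vi i.
  have Zb3' : (Z0 + Z0 * kap) + (Z0 + Z0 * kap) * kap <= b 0 by move: Zb3; rewrite eZ; lia.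
  have E3' : env h3' by [].
  apply: wp_seq.
  apply: wp_conseq.
    apply: (@wp_rext b _ false m kap Z0 (T1 i) h3') => //; try lia.
    move=> h' c q hc hq Hc Hq F.
    have E : env h' by apply: envF F E3'.
    have Hi : iv h' vi = i by rewrite (frV F).
    rewrite /= /T1 -(envK _ _ _ E) -(envQ _ _ _ E) /Kpt /Qpt Hc Hq Hi.
    by do ?split=> //; lia.
  move=> h4 F4 [L1 L2 L3 L4].
  have E4 : env h4 by apply: envF F4 E3'.
  apply: wp_conseq.
    apply: (@wp_rext b _ false m kap (Z0 + Z0 * kap) (T2 i) h4) => //; try lia.
    + by rewrite (frV F4).
    + by rewrite (frV F4).
    move=> h' c q hc hq Hc Hq F.
    have E : env h' by apply: envF F E4.
    have Hi : iv h' vi = i by rewrite (frV F) // (frV F4).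
    rewrite /= /T2 -(envK _ _ _ E) -(envQ _ _ _ E) /Kpt /Qpt Hc Hq Hi.
    by do ?split=> //; lia.
  move=> h5 F5 [M1 M2 M3 M4].
  have eZ' : kap.+1 ^ (2 * i.+1) = (Z0 + Z0 * kap) + (Z0 + Z0 * kap) * kap by rewrite eZ; lia.
  rewrite eZ'; split=> //.
  + exact: envF F5 E4.
  + by apply: M4; apply: L4.
  + move=> lo hj hlo hhi.
    have [||w hw rw] := J3 lo hj.
    * by move=> l hl; apply: hlo; lia.
    * by move=> l hl; apply: hhi; lia.
    have [w1 hw1 rw1] := L3 w _ _ hw (hlo i (ltnSn i)) rw.
    have [w2 hw2 rw2] := M3 w1 _ _ hw1 (hhi i (ltnSn i)) rw1.
    exists w2 => //; apply: rrep_ext rw2 => // q hq.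
    rewrite -[RHS]/(all (fun i => T1 i (lo i) q && T2 i (hj i) q) (iota 0 i.+1)).
    rewrite -addn1 iotaD all_cat /= add0n andbT.
    by case: (T1 _ _ _); case: (T2 _ _ _); rewrite ?andbT ?andbF.
rewrite Hnb => h3 F3 [E3 J1 J2 J3].
mv h2 F3.
apply: (wp_for (I := fun j h' => [/\ env h', iv h' vZ = kap.+1 ^ (2 * nb + j),
     forall w, w < kap.+1 ^ (2 * nb + j) -> exists a, rrep m kap h' w a &
     forall (lo hi : nat -> nat) (s : seq nat), (forall i, i < nb -> lo i < kap) ->
       (forall i, i < nb -> hi i < kap) -> size s <= j -> all (fun c => c < kap) s ->
       exists2 w, w < kap.+1 ^ (2 * nb + j) & rrep m kap h' w
         (fun q => all (fun i => T1 i (lo i) q && T2 i (hi i) q) (iota 0 nb),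
          fun c => c \in s)])) => //=.
- by rewrite HS.
- rewrite addn0; split=> // lo hi s hlo hhi; rewrite leqn0 => /nilP -> _.
  exact: J3.
- rewrite HS => j h4 hj F4 [E4 L1 L2 L3].
  mv h3 F4.
  set Z0 := kap.+1 ^ (2 * nb + j) in L1 L2 L3.
  have eZ : kap.+1 ^ (2 * nb + j.+1) = Z0 + Z0 * kap by rewrite addnS expnS; lia.
  have Zb4 : Z0 + Z0 * kap <= b 0.
    by rewrite -eZ; apply: leq_trans Zb; rewrite leq_pexp2l //; lia.
  apply: wp_conseq.
    apply: (@wp_rext b _ true m kap Z0 (fun _ _ => true)) => //; try lia.
  move=> h5 F5 [M1 M2 M3 M4]; rewrite eZ; split=> //.
  + by apply: envF F5 _ => //.
  + by apply: M4.
  + move=> lo hi [|c s] hlo hhi hs hall.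
      have [//|//|w hw rw] := L3 lo hi [::] hlo hhi.
      by exists w; [lia|apply: M2].
    move: hall => /= /andP[hc hall].
    have [w hw rw] := L3 lo hi s hlo hhi hs hall.
    have [w1 hw1 rw1] := M3 w c _ hw hc rw.
    exists w1 => //; apply: rrep_ext rw1 => //.
rewrite HS => h4 F4 [E4 L1 L2 L3].
by split.
Qed.
End Specs2.

(** * The dynamic program *)

(* vs0 is the least s with k ^ (d - 1) <= s ^ d, that is k^(1-1/d) rounded up;
   the powers are taken in the reals, where multiplication is available. *)
Definition seps (d M : nat) : cmd :=
  CSet vs0 (NC 0) ;;
  CFor 0 vq (NV vk) (
    CRSet xx (RN (NC 1)) ;;
    CFor 0 vl (NC d) (CRSet xx (RB RMul (RV xx) (RN (NV vq)))) ;;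
    CRSet xy (RN (NC 1)) ;;
    CFor 0 vl (NC d.-1) (CRSet xy (RB RMul (RV xy) (RN (NV vk)))) ;;
    CIf (BR (RV xy) (RV xx)) CSkip (CSet vs0 (NA (NV vq) (NC 1)))) ;;
  CSet vS (NM M (NV vs0)) ;;
  CIf (BN (NV vk) (NV vS)) (CSet vS (NV vk) ;; CSet vnb (NC 0)) (CSet vnb (NC d)).

Definition init (d Zc : nat) : cmd :=
  CFor 0 vw (NV vZ) (
    CSet vok (NC 1) ;;
    CFor 0 vq (NV vm) (CIf (BN (NC 1) (NG aIN (NV vw) (NV vq))) (
      CSet vcv (NC 0) ;;
      CFor 0 vc (NV vkap) (CIf (BN (NC 1) (NG aSIG (NV vw) (NV vc))) (
        sqd d xx vl (ptQ d (NV vq) (NV vl)) (ptK d Zc (NV vc) (NV vl)) ;;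
        CIf (BR (RV xx) (RV xrho)) (CSet vcv (NC 1)) CSkip) CSkip) ;;
      CIf (BN (NC 1) (NV vcv)) CSkip (CSet vok (NC 0))) CSkip) ;;
    CSet vcnt (NC 0) ;;
    CFor 0 vc (NV vkap) (
      CIf (BN (NC 1) (NV vok))
        (CPut aT (NV vw) (NV vc) (NG aSIG (NV vw) (NV vc)))
        (CPut aT (NV vw) (NV vc) (NC 1)) ;;
      CSet vcnt (NA (NV vcnt) (NG aT (NV vw) (NV vc)))) ;;
    CPut aCNT (NC 0) (NV vw) (NV vcnt)).

Definition satbody : cmd :=
  CSet vok (NC 1) ;;
  CFor 0 vq (NV vm)
    (CIf (BN (NG aIN (NV vw) (NV vq))
             (NA (NG aIN (NV vu) (NV vq)) (NG aIN (NV vv) (NV vq))))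
       CSkip (CSet vok (NC 0))) ;;
  CSet vcnt (NC 0) ;;
  CFor 0 vc (NV vkap)
    (CIf (BN (NC 1) (NA (NG aSIG (NV vw) (NV vc))
             (NA (NG aT (NV vu) (NV vc)) (NG aT (NV vv) (NV vc)))))
       (CPut aNEW (NC 0) (NV vc) (NC 1) ;; INC vcnt)
       (CPut aNEW (NC 0) (NV vc) (NC 0))) ;;
  CIf (BN (NC 1) (NV vok))
    (CIf (BN (NA (NV vcnt) (NC 1)) (G1 aCNT (NV vw)))
      (CFor 0 vc (NV vkap) (CPut aT (NV vw) (NV vc) (G1 aNEW (NV vc))) ;;
       CPut aCNT (NC 0) (NV vw) (NV vcnt)) CSkip) CSkip.

Definition sat : cmd :=
  CFor 0 vrd (NV vm) (CFor 0 vw (NV vZ) (CFor 0 vu (NV vZ) (CFor 0 vv (NV vZ) satbody))).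

Definition sel : cmd :=
  CFor 0 vw (NV vZ) (
    CSet vok (NC 1) ;;
    CFor 0 vq (NV vm)
      (CIf (BN (NC 1) (NG aIN (NV vw) (NV vq))) CSkip (CSet vok (NC 0))) ;;
    CIf (BN (NC 1) (NV vok))
      (CIf (BN (G1 aCNT (NV vw)) (NV vk))
         (CFor 0 vc (NV vkap) (CPut aRES (NC 0) (NV vc) (NG aT (NV vw) (NV vc))))
         CSkip) CSkip).

Definition cnt (kap : nat) (p : nat -> bool) : nat := count p (iota 0 kap).
Definition alln (n : nat) (p : nat -> bool) : bool := all p (iota 0 n).
Definition hasn (n : nat) (p : nat -> bool) : bool := has p (iota 0 n).
Arguments cnt : simpl never.
Arguments alln : simpl never.
Arguments hasn : simpl never.

Lemma allnS n p : alln n.+1 p = alln n p && p n.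
Proof. by rewrite /alln -addn1 iotaD all_cat /= andbT. Qed.

Lemma hasnS n p : hasn n.+1 p = hasn n p || p n.
Proof. by rewrite /hasn -addn1 iotaD has_cat /= orbF. Qed.

Lemma allnP n (p : nat -> bool) : reflect (forall i, i < n -> p i) (alln n p).
Proof.
apply: (iffP allP) => H i; first by move=> hi; apply: H; rewrite mem_iota.
by rewrite mem_iota; apply: H.
Qed.

Lemma hasnP n (p : nat -> bool) : reflect (exists2 i, i < n & p i) (hasn n p).
Proof.
apply: (iffP hasP) => [[i]|[i hi hp]]; first by rewrite mem_iota => hi hp; exists i.
by exists i; rewrite ?mem_iota.
Qed.

Lemma cntS kap p : cnt kap.+1 p = cnt kap p + p kap.
Proof. by rewrite /cnt -addn1 iotaD count_cat /= addn0. Qed.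

Lemma eq_cnt kap (p p' : nat -> bool) : (forall c, c < kap -> p c = p' c) -> cnt kap p = cnt kap p'.
Proof. by move=> H; apply: eq_in_count => c; rewrite mem_iota; apply: H. Qed.

Lemma cnt_le kap (p p' : nat -> bool) : (forall c, c < kap -> p c -> p' c) -> cnt kap p <= cnt kap p'.
Proof.
elim: kap => // kap IH H; rewrite !cntS leq_add //.
  by apply: IH => c hc; apply: H; lia.
by case E: (p kap) => //; rewrite H.
Qed.

Lemma cntUI kap (p q : nat -> bool) : cnt kap (fun c => p c || q c) + cnt kap (fun c => p c && q c) =
  cnt kap p + cnt kap q.
Proof. exact: count_predUI. Qed.

Section Specs3.
Variable R : realType.
Implicit Types (h : ist R).

Lemma seps_spec b d M k h : 0 < d -> 0 < k -> k <= b 0 -> d <= b 0 -> M <= b 0 ->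
  iv h vk = k ->
  wp b (seps d M) (fun h' => exists s0, [/\ 0 < s0, s0 <= k, k ^ d.-1 <= s0 ^ d,
    s0.-1 ^ d < k ^ d.-1 &
    if k <= M * s0 then iv h' vS = k /\ iv h' vnb = 0
    else iv h' vS = M * s0 /\ iv h' vnb = d]) h.
Proof.
move=> d0 k0 hk hd hM Hk.
apply: wp_seq; apply: wp_set => //=.
apply: wp_seq.
apply: (wp_for (I := fun y h' => [/\ iv h' vs0 <= y,
    forall y', y' < y -> y' ^ d < k ^ d.-1 -> y' < iv h' vs0 &
    0 < iv h' vs0 -> (iv h' vs0).-1 ^ d < k ^ d.-1])) => //=.
- by rewrite Hk.
- rewrite Hk => y h1 hy F1 [J1 J2 J3].
  mv h F1.
  apply: wp_seq; apply: wp_rset => //=.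
  apply: wp_seq.
  apply: (wp_for (I := fun j h' => rv h' xx = ((y ^ j)%:R)%R)) => //=.
    move=> j h2 hj F2 Hx; apply: wp_rset => //=.
    by rewrite Hx (frV F2) //= -natrM expnSr.
  move=> h2 F2 Hx.
  mv h1 F2.
  have Hy : iv h2 vq = y by rewrite (frV F2).
  apply: wp_seq; apply: wp_rset => //=.
  apply: wp_seq.
  apply: (wp_for (I := fun j h' => rv h' xy = ((k ^ j)%:R)%R)) => //=.
    by lia.
    move=> j h3 hj F3 Hz; apply: wp_rset => //=.
    by rewrite Hz (frV F3) //= Hk -natrM expnSr.
  move=> h3 F3 Hz.
  mv h2 F3.
  apply: wp_if => //=; rewrite Hz Hx ler_nat.
  case: leqP => hle.
    apply: wp_skip; split=> //; first by lia.
    move=> y'; rewrite ltnS leq_eqVlt => /orP[/eqP ->|]; last exact: J2.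
    by rewrite ltnNge hle.
  apply: wp_set => //=; rewrite Hy addn1; split=> //.
rewrite Hk => h1 F1 [J1 J2 J3].
mv h F1.
apply: wp_seq; apply: wp_set => //=.
set s0 := iv h1 vs0 in J1 J2 J3 *.
have s0k : k ^ d.-1 <= s0 ^ d.
  rewrite leqNgt; apply/negP => hlt.
  have [hs|hs] := ltnP s0 k; first by have := J2 _ hs hlt; rewrite ltnn.
  have e : s0 = k by lia.
  by move: hlt; rewrite e ltnNge leq_pexp2l // leq_pred.
have s00 : 0 < s0.
  rewrite lt0n; apply/eqP => e; move: s0k; rewrite e exp0n //.
  by rewrite leqn0 expn_eq0; lia.
apply: wp_if => //=; rewrite Hk.
case: ifP => hle.
  apply: wp_seq; apply: wp_set => //=; apply: wp_set => //=.
  by exists s0; rewrite hle Hk; split=> //; apply: J3.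
by apply: wp_set => //=; exists s0; rewrite hle; split=> //; apply: J3.
Qed.

Section Sat.
Variables (b : nat -> nat) (d Zc m kap Z k : nat) (In Sg : nat -> nat -> bool).
Variable cov : nat -> nat -> bool.
Hypotheses (mb : m <= b 0) (kb : kap <= b 0) (Zb : Z <= b 0) (db : d <= b 0).

Definition tab h : Prop := [/\ iv h vm = m, iv h vkap = kap, iv h vZ = Z, iv h vk = k &
  (forall w, w < Z -> rrep m kap h w (In w, Sg w))].

Definition trep h (T : nat -> nat -> bool) : Prop := forall w, w < Z ->
  (forall c, c < kap -> ia h aT w c = T w c :> nat) /\ ia h aCNT 0 w = cnt kap (T w).

Definition sound (T : nat -> nat -> bool) : Prop := forall w, w < Z ->
  (forall c, c < kap -> Sg w c -> T w c) /\
  (forall q, q < m -> In w q -> exists c, [/\ c < kap, T w c & cov q c]).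

Definition leafr w : Prop := forall q, q < m -> In w q ->
  exists c, [/\ c < kap, Sg w c & cov q c].

(* x bounds the size of the set that the dynamic program stores for row w after j
   rounds; it is read off a binary tree of rows of height at most j, in which
   the candidates of Sg u and Sg v are not counted twice. *)
Inductive bnd : nat -> nat -> nat -> Prop :=
| bnd_leaf j w : w < Z -> leafr w -> bnd j w (cnt kap (Sg w))
| bnd_split j w u v x1 x2 : w < Z -> u < Z -> v < Z ->
    (forall q, q < m -> In w q -> In u q || In v q) ->
    bnd j u x1 -> bnd j v x2 ->
    bnd j.+1 w (cnt kap (fun c => Sg w c || (Sg u c || Sg v c)) +
      (x1 - cnt kap (Sg u)) + (x2 - cnt kap (Sg v))).

Lemma bit1 (x : bool) : (1 <= x) = x.
Proof. by case: x. Qed.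

Lemma init_spec h : tab h ->
  (forall q c, cov q c = (sqdist d (Qpt d h q) (Kpt d Zc h c) <= rv h xrho)%R) ->
  (forall q, q < m -> exists2 c, c < kap & cov q c) ->
  wp b (init d Zc) (fun h' => exists T, [/\ trep h' T, sound T &
     forall w, w < Z -> leafr w -> cnt kap (T w) <= cnt kap (Sg w)]) h.
Proof.
move=> [Hm Hk HZ Hkk Hr] Hcov all_cov.
pose lf w := alln m (fun q => In w q ==> hasn kap (fun c => Sg w c && cov q c)).
pose T w c := if lf w then Sg w c else true.
have lfP w : reflect (leafr w) (lf w).
  apply: (iffP (allnP _ _)) => [H q hq hin|H q hq].
    by have /implyP/(_ hin)/hasnP[c hc /andP[h1 h2]] := H q hq; exists c.
  apply/implyP=> hin; apply/hasnP.
  by have [c [h1 h2 h3]] := H q hq hin; exists c; rewrite ?h2.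
suff: wp b (init d Zc) (fun h' => trep h' T) h.
  move/wp_conseq; apply=> h' _ HT; exists T; split=> //.
    move=> w hw; split=> [c hc|q hq hin]; first by rewrite /T; case: ifP.
    rewrite /T; case: lfP => [hl|_]; first by apply: hl.
    by have [c h1 h2] := all_cov q hq; exists c.
  by move=> w hw /lfP hl; rewrite /T hl.
apply: (wp_for (I := fun j h' => forall w, w < j ->
  (forall c, c < kap -> ia h' aT w c = T w c :> nat) /\ ia h' aCNT 0 w = cnt kap (T w))) => //=.
- by rewrite HZ.
- rewrite HZ => w h1 hw F1 I1.
  have [/= rI rS] := Hr w hw.
  mv h F1.
  apply: wp_seq; apply: wp_set => //=.
  apply: wp_seq.
  apply: (wp_for (I := fun j h' => iv h' vok =
     alln j (fun q => In w q ==> hasn kap (fun c => Sg w c && cov q c)))) => //=.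
  + by rewrite Hm.
  + rewrite Hm => q h2 hq F2 J.
    have Hw2 : iv h2 vw = w by rewrite (frV F2).
    mv h1 F2.
    apply: wp_if => /=; first by rewrite Hw2; do !split=> //; lia.
    rewrite Hw2 rI // bit1 allnS.
    case: ifP => hin; last by apply: wp_skip => /=; rewrite J hin /= andbT.
    apply: wp_seq; apply: wp_set => //=.
    apply: wp_seq.
    apply: (wp_for (I := fun j h' => iv h' vcv =
       hasn j (fun c => Sg w c && cov q c))) => //=.
    * by rewrite Hk.
    * rewrite Hk => c h3 hc F3 J3.
      have Hw3 : iv h3 vw = w by rewrite (frV F3).
      have Hq3 : iv h3 vq = q by rewrite (frV F3).
      mv h2 F3.
      apply: wp_if => /=; first by rewrite Hw3; do !split=> //; lia.
      rewrite Hw3 rS // bit1 hasnS.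
      case: ifP => hs; last by apply: wp_skip => /=; rewrite J3 hs /= orbF.
      apply: wp_seq.
      apply: (@wp_sqd _ (Qpt d h q) (Kpt d Zc h c)) => //.
        move=> h4 l hl F4 Hl; rewrite /= /Kpt /Qpt Hl.
        rewrite (frV F4 (i := vq)) // (frV F4 (i := vc)) //= !(frA F4) // (frX F4) //.
        rewrite (frR F4 (i := xeta)) //=.
        rewrite (frA F3) // (frA F3 (a := aKQ)) // (frA F3 (a := aKZ)) // (frX F3) //.
        rewrite (frR F3 (i := xeta)) //=.
        rewrite (frA F2) // (frA F2 (a := aKQ)) // (frA F2 (a := aKZ)) // (frX F2) //.
        rewrite (frR F2 (i := xeta)) //=.
        rewrite (frA F1) // (frA F1 (a := aKQ)) // (frA F1 (a := aKZ)) // (frX F1) //.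
        rewrite (frR F1 (i := xeta)) //= Hq3.
        by do !split=> //; lia.
      move=> h4 F4 Hx.
      have Hrho : rv h4 xrho = rv h3 xrho by rewrite (frR F4).
      have Hcv : iv h4 vcv = iv h3 vcv by rewrite (frV F4).
      apply: wp_if => //=; rewrite Hx Hrho -Hcov.
      case: ifP => hcc; first by apply: wp_set => //=; rewrite hs hcc orbT.
      by apply: wp_skip => /=; rewrite Hcv J3 hs hcc orbF.
    * rewrite Hk => h3 F3 J3.
      apply: wp_if => //=; rewrite J3 bit1.
      have Hok : iv h3 vok = iv h2 vok by rewrite (frV F3).
      case: ifP => hh; first by apply: wp_skip => /=; rewrite Hok J hin hh andbT.
      by apply: wp_set => //=; rewrite hin hh andbF.
  rewrite Hm => h2 F2 J; rewrite -/(lf w) in J.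
  have Hw2 : iv h2 vw = w by rewrite (frV F2).
  mv h1 F2.
  apply: wp_seq; apply: wp_set => //=.
  apply: wp_seq.
  apply: (wp_for (I := fun j h' => [/\ iv h' vcnt = cnt j (T w),
     forall w' c, w' != w -> ia h' aT w' c = ia h2 aT w' c &
     forall c, c < j -> ia h' aT w c = T w c :> nat])) => //=.
  + by rewrite Hk.
  + rewrite Hk => c h3 hc F3 [J1 J2 J3].
    have Hw3 : iv h3 vw = w by rewrite (frV F3).
    have Hok : iv h3 vok = lf w by rewrite (frV F3).
    mv h2 F3.
    apply: wp_seq.
    apply: (@wp_conseq _ _ _ (fun h' => [/\ iv h' vcnt = cnt c (T w),
       forall w' c', w' != w -> ia h' aT w' c' = ia h2 aT w' c' &
       forall c', c' < c.+1 -> ia h' aT w c' = T w c' :> nat])).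
      apply: wp_if => //=; rewrite Hok bit1; case: ifP => hlf.
        apply: wp_put => /=; first by rewrite Hw3; do !split=> //; lia.
        rewrite Hw3 rS //; split=> //=.
          by move=> w' c' hw'; rewrite (negPf hw') /= J2.
        move=> c'; rewrite ltnS leq_eqVlt eqxx /=.
        by case: eqP => /= [->|_ hc']; rewrite ?J3 // /T hlf.
      apply: wp_put => /=; first by rewrite Hw3; do !split=> //; lia.
      rewrite Hw3; split=> //=.
        by move=> w' c' hw'; rewrite (negPf hw') /= J2.
      move=> c'; rewrite ltnS leq_eqVlt eqxx /=.
      by case: eqP => /= [->|_ hc']; rewrite ?J3 // /T hlf.
    move=> h4 F4 [K1 K2 K3].
    have Hw4 : iv h4 vw = w by rewrite (frV F4).
    have Hc4 : iv h4 vc = c by rewrite (frV F4).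
    apply: wp_set => /=; first by rewrite Hw4; do !split=> //; lia.
    by rewrite Hw4 Hc4 K1 K3 // cntS; split.
  + rewrite Hk => h3 F3 [J1 J2 J3].
    have Hw3 : iv h3 vw = w by rewrite (frV F3).
    have Hcnt : ia h3 aCNT = ia h2 aCNT by rewrite (frA F3).
    apply: wp_put => //= w'; rewrite Hw3 J1 ltnS leq_eqVlt.
    case: eqP => [-> _|/eqP hne /= hw'].
      by split=> // c hc; apply: J3.
    have [i1 i2] := I1 _ hw'; split=> /= [c hc|]; last by rewrite Hcnt.
    by rewrite J2 // i1.
- by rewrite HZ => h' F' H w hw; apply: H.
Qed.

Definition news (T : nat -> nat -> bool) w u v c := Sg w c || (T u c || T v c).

Definition stepT (w u v : nat) (T T' : nat -> nat -> bool) : Prop :=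
  let c1 := alln m (fun q => In w q ==> (In u q || In v q)) in
  let new := news T w u v in
  T' = if c1 && (cnt kap new < cnt kap (T w)) then upd T w new else T.

Lemma satbody_spec h w u v T : tab h -> trep h T -> w < Z -> u < Z -> v < Z ->
  iv h vw = w -> iv h vu = u -> iv h vv = v ->
  wp b satbody (fun h' => exists2 T', trep h' T' & stepT w u v T T') h.
Proof.
move=> [Hm Hk HZ Hkk Hr] HT hw hu hv Hw Hu Hv.
have [/= rIw rSw] := Hr w hw; have [/= rIu _] := Hr u hu; have [/= rIv _] := Hr v hv.
have [rTw rCw] := HT w hw; have [rTu _] := HT u hu; have [rTv _] := HT v hv.
set new := news T w u v.
apply: wp_seq; apply: wp_set => //=.
apply: wp_seq.
apply: (wp_for (I := fun j h' => iv h' vok =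
   alln j (fun q => In w q ==> (In u q || In v q)))) => //=.
- by rewrite Hm.
- rewrite Hm => q h1 hq F1 J.
  mv h F1.
  apply: wp_if => /=; first by rewrite Hw Hu Hv; do !split=> //; lia.
  rewrite Hw Hu Hv rIw // rIu // rIv // allnS.
  case: ifP => hle; first (apply: wp_skip => /=; rewrite J).
    by move: hle; case: (In w q); case: (In u q); case: (In v q); rewrite ?andbT.
  apply: wp_set => //=.
  by move: hle; case: (In w q); case: (In u q); case: (In v q); rewrite ?andbF.
rewrite Hm => h1 F1 J.
mv h F1.
apply: wp_seq; apply: wp_set => //=.
apply: wp_seq.
apply: (wp_for (I := fun j h' => iv h' vcnt = cnt j new /\
   forall c, c < j -> ia h' aNEW 0 c = new c :> nat)) => //=.
- by rewrite Hk.
- rewrite Hk => c h2 hc F2 [J1 J2].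
  mv h1 F2.
  apply: wp_if => /=; first by rewrite Hw Hu Hv; do !split=> //; lia.
  rewrite Hw Hu Hv rSw // rTu // rTv // cntS.
  have -> : (0 < Sg w c + (T u c + T v c)) = new c.
    by rewrite /new /news; case: (Sg w c); case: (T u c); case: (T v c).
  case: ifP => hn.
    apply: wp_seq; apply: wp_put => //=; apply: wp_set => //=.
    rewrite J1 hn; split=> // c'; rewrite ltnS leq_eqVlt.
    by case: eqP => /= [->|_ hc']; rewrite ?hn ?J2.
  apply: wp_put => //=.
  rewrite J1 hn addn0; split=> // c'; rewrite ltnS leq_eqVlt.
  by case: eqP => /= [->|_ hc']; rewrite ?hn ?J2.
rewrite Hk => h2 F2 [J1 J2].
have Hok : iv h2 vok = alln m (fun q => In w q ==> (In u q || In v q)).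
  by rewrite (frV F2).
have HT2 : trep h2 T.
  move=> w' hw'; have [t1 t2] := HT _ hw'.
  have e1 : ia h2 aT = ia h1 aT by rewrite (frA F2).
  have e2 : ia h2 aCNT = ia h1 aCNT by rewrite (frA F2).
  have e3 : ia h1 aT = ia h aT by rewrite (frA F1).
  have e4 : ia h1 aCNT = ia h aCNT by rewrite (frA F1).
  by rewrite e1 e2 ?e3 ?e4.
mv h1 F2.
apply: wp_if => //=; rewrite Hok bit1.
case: ifP => hc1; last first.
  by apply: wp_skip; exists T => //; rewrite /stepT hc1.
apply: wp_if => //=; rewrite Hw rCw J1 addn1.
case: ifP => hc2; last first.
  by apply: wp_skip; exists T => //; rewrite /stepT hc1 hc2.
apply: wp_seq.
apply: (wp_for (I := fun j h' => (forall w' c, w' != w -> ia h' aT w' c = ia h2 aT w' c) /\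
   forall c, c < j -> ia h' aT w c = new c :> nat)) => //=.
- by rewrite Hk.
- rewrite Hk => c h3 hc F3 [K1 K2].
  have Hw3 : iv h3 vw = w by rewrite (frV F3).
  have HN3 : ia h3 aNEW = ia h2 aNEW by rewrite (frA F3).
  apply: wp_put => /=; first by rewrite Hw3; do !split=> //; lia.
  rewrite Hw3 HN3; split.
    by move=> w' c' hw'; rewrite (negPf hw') /= K1.
  move=> c'; rewrite ltnS leq_eqVlt eqxx /=.
  by case: eqP => /= [->|_ hc']; rewrite ?J2 ?K2.
- rewrite Hk => h3 F3 [K1 K2].
  have Hw3 : iv h3 vw = w by rewrite (frV F3).
  have Hc3 : iv h3 vcnt = cnt kap new by rewrite (frV F3).
  have HC3 : ia h3 aCNT = ia h2 aCNT by rewrite (frA F3).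
  apply: wp_put => //=; exists (upd T w new).
    move=> w' hw'; rewrite /= Hw3 Hc3; case: eqP => [->|/eqP hne] /=; first by split.
    have [t1 t2] := HT2 _ hw'; rewrite HC3; split=> // c hc.
    by rewrite K1 // t1.
  by rewrite /stepT hc1 hc2.
Qed.

Lemma stepT_sound w u v T T' : w < Z -> u < Z -> v < Z ->
  sound T -> stepT w u v T T' -> sound T'.
Proof.
move=> hw hu hv HT; rewrite /stepT => ->; case: ifP => // /andP[/allnP h1 _] w' hw'.
rewrite /upd; case: eqP => [->|_]; last exact: HT.
rewrite /news; split=> [c hc -> //|q hq hin].
have /implyP/(_ hin)/orP[hi|hi] := h1 q hq.
  have [_ /(_ q hq hi) [c [c1 c2 c3]]] := HT u hu.
  by exists c; rewrite c2 orbT.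
have [_ /(_ q hq hi) [c [c1 c2 c3]]] := HT v hv.
by exists c; rewrite c2 !orbT.
Qed.

Lemma stepT_mono w u v T T' : stepT w u v T T' ->
  forall w', cnt kap (T' w') <= cnt kap (T w').
Proof.
rewrite /stepT => -> w'; case: ifP => // /andP[_ h2].
by rewrite /upd; case: eqP => [->|//]; exact: ltnW.
Qed.

Lemma stepT_le w u v T T' : stepT w u v T T' ->
  (forall q, q < m -> In w q -> In u q || In v q) ->
  cnt kap (T' w) <= cnt kap (news T w u v).
Proof.
move=> + H; rewrite /stepT.
have -> /= : alln m (fun q => In w q ==> (In u q || In v q)).
  by apply/allnP => q hq; apply/implyP; apply: H.
move=> ->; case: ltnP => //= h.
by rewrite /upd eqxx.
Qed.

Lemma news_cnt T w u v x1 x2 : sound T -> u < Z -> v < Z ->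
  cnt kap (T u) <= x1 -> cnt kap (T v) <= x2 ->
  cnt kap (news T w u v) <= cnt kap (fun c => Sg w c || (Sg u c || Sg v c)) +
      (x1 - cnt kap (Sg u)) + (x2 - cnt kap (Sg v)).
Proof.
move=> HT hu hv h1 h2.
have [su _] := HT u hu; have [sv _] := HT v hv.
have: forall n, n <= kap -> cnt n (news T w u v) + cnt n (Sg u) + cnt n (Sg v) <=
   cnt n (fun c => Sg w c || (Sg u c || Sg v c)) + cnt n (T u) + cnt n (T v).
  elim=> // n IH hn; rewrite !cntS.
  have := IH (ltnW hn); have := su n hn; have := sv n hn; rewrite /news.
  by case: (Sg w n); case: (Sg u n); case: (Sg v n); case: (T u n); case: (T v n) => //=;
    intuition; lia.
move=> /(_ kap (leqnn _)).
have l1 : cnt kap (Sg u) <= cnt kap (T u) by apply: cnt_le.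
have l2 : cnt kap (Sg v) <= cnt kap (T v) by apply: cnt_le.
lia.
Qed.

Lemma bndS_inv j w x : bnd j.+1 w x ->
  (leafr w /\ x = cnt kap (Sg w) /\ w < Z) \/
  exists u v x1 x2, [/\ w < Z, u < Z, v < Z &
    [/\ (forall q, q < m -> In w q -> In u q || In v q), bnd j u x1, bnd j v x2 &
      x = cnt kap (fun c => Sg w c || (Sg u c || Sg v c)) +
      (x1 - cnt kap (Sg u)) + (x2 - cnt kap (Sg v))]].
Proof.
move=> H; inversion H; subst; first by left.
by right; exists u, v, x1, x2.
Qed.

Lemma bnd0_inv w x : bnd 0 w x -> leafr w /\ x = cnt kap (Sg w) /\ w < Z.
Proof. by move=> H; inversion H; subst. Qed.

Lemma sat_spec h T0 : tab h -> trep h T0 -> sound T0 ->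
  (forall w, w < Z -> leafr w -> cnt kap (T0 w) <= cnt kap (Sg w)) ->
  wp b sat (fun h' => exists T, [/\ trep h' T, sound T &
     forall w x, bnd m w x -> cnt kap (T w) <= x]) h.
Proof.
move=> Htab HT0 HS0 Hleaf.
have tabF c h1 h2 : tab h1 -> fr c h1 h2 ->
    [/\ vm \notin modV c, vkap \notin modV c, vZ \notin modV c & vk \notin modV c] ->
    aIN \notin modA c -> aSIG \notin modA c -> tab h2.
  move=> [t1 t2 t3 t4 t5] [f1 f2 f3 f4] [m1 m2 m3 m4] m5 m6; split; rewrite ?f1 //.
  by move=> w hw; rewrite /rrep !f3 //; apply: t5.
have tabV h1 i x : tab h1 -> i \notin [:: vm; vkap; vZ; vk] -> tab (setv h1 i x).
  move=> [t1 t2 t3 t4 t5]; rewrite !inE !negb_or => /and4P[n1 n2 n3 n4].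
  by split=> //=; rewrite eq_sym ?(negPf n1) ?(negPf n2) ?(negPf n3) ?(negPf n4).
pose done_ j T := (forall w x, bnd j w x -> cnt kap (T w) <= x).
pose Q0 T := sound T /\
  (forall w, w < Z -> leafr w -> cnt kap (T w) <= cnt kap (Sg w)).
have [Hm Hk HZ _ _] := Htab.
apply: (wp_for (I := fun j h' => exists T, [/\ trep h' T, Q0 T &
   (0 < j -> forall w x, bnd j w x -> cnt kap (T w) <= x)])) => //=.
- by rewrite Hm.
- by exists T0.
- rewrite Hm => j h1 hj F1 [T1 [HT1 Q1 D1]].
  have D1' : done_ j T1.
    case: j hj F1 D1 => [|j] _ _ D1; last exact: D1.
    by move=> w x /bnd0_inv[h2 [-> h3]]; case: Q1 => _; apply.
  have tab1 : tab (setv h1 vrd j) by apply: tabV => //; apply: tabF Htab F1 _ _ _.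
  (* the triples treated so far satisfy the bound of round j+1 *)
  pose ddone T w u v := forall x1 x2, bnd j u x1 -> bnd j v x2 ->
      (forall q, q < m -> In w q -> In u q || In v q) ->
      cnt kap (T w) <= cnt kap (fun c => Sg w c || (Sg u c || Sg v c)) +
        (x1 - cnt kap (Sg u)) + (x2 - cnt kap (Sg v)).
  apply: (wp_for (I := fun w h' => exists T, [/\ trep h' T, Q0 T, done_ j T &
    forall w', w' < w -> forall u v, u < Z -> v < Z -> ddone T w' u v])) => //=.
  + by have [_ _ /= ->] := tab1.
  + by exists T1.
  + have [_ _ /= HZ1 _ _] := tab1; rewrite HZ1 => w h2 hw F2 [T2 [HT2 Q2 D2 E2]].
    have tab2 : tab (setv h2 vw w) by apply: tabV => //; apply: tabF tab1 F2 _ _ _.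
    apply: (wp_for (I := fun u h' => exists T, [/\ trep h' T, Q0 T, done_ j T &
      (forall w', w' < w -> forall u v, u < Z -> v < Z -> ddone T w' u v) /\
      (forall u', u' < u -> forall v, v < Z -> ddone T w u' v)])) => //=.
    * by have [_ _ /= ->] := tab2.
    * by exists T2.
    * have [_ _ /= HZ2 _ _] := tab2; rewrite HZ2 => u h3 hu F3 [T3 [HT3 Q3 D3 [E3 E3']]].
      have tab3 : tab (setv h3 vu u) by apply: tabV => //; apply: tabF tab2 F3 _ _ _.
      have Hw3 : iv h3 vw = w by rewrite (frV F3).
      apply: (wp_for (I := fun v h' => exists T, [/\ trep h' T, Q0 T, done_ j T &
        [/\ (forall w', w' < w -> forall u v, u < Z -> v < Z -> ddone T w' u v),
        (forall u', u' < u -> forall v, v < Z -> ddone T w u' v) &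
        (forall v', v' < v -> ddone T w u v')]])) => //=.
      - by have [_ _ /= ->] := tab3.
      - by exists T3.
      - have [_ _ /= HZ3 _ _] := tab3; rewrite HZ3 => v h4 hv F4 [T4 [HT4 Q4 D4 [E4 E4' E4'']]].
        have tab4 : tab (setv h4 vv v) by apply: tabV => //; apply: tabF tab3 F4 _ _ _.
        have Hw4 : iv h4 vw = w by rewrite (frV F4).
        have Hu4 : iv h4 vu = u by rewrite (frV F4).
        apply: wp_conseq; first by apply: (@satbody_spec (setv h4 vv v) w u v T4).
        move=> h5 _ [T5 HT5 S5]; exists T5.
        have mon := stepT_mono S5.
        case: Q4 => q1 q2.
        split=> //.
        + split; first exact: stepT_sound S5.
          by move=> w' hw' hl; apply: leq_trans (mon _) _; apply: q2.
        + by move=> w' x hx; apply: leq_trans (mon _) _; apply: D4.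
        + split.
          * move=> w' hw' u' v' hu' hv' x1 x2 b1 b2 hin.
            by apply: leq_trans (mon _) _; apply: E4.
          * move=> u' hu' v' hv' x1 x2 b1 b2 hin.
            by apply: leq_trans (mon _) _; apply: E4'.
          * move=> v'; rewrite ltnS leq_eqVlt => /orP[/eqP ->|hv'] x1 x2 b1 b2 hin.
              apply: leq_trans (stepT_le S5 hin) _.
              by apply: news_cnt => //; apply: D4.
            by apply: leq_trans (mon _) _; apply: E4''.
      - have [_ _ /= HZ3 _ _] := tab3; rewrite HZ3 => h4 F4 [T4 [HT4 Q4 D4 [E4 E4' E4'']]].
        exists T4; split=> //; split=> // u'.
        by rewrite ltnS leq_eqVlt => /orP[/eqP ->|hu'] //; apply: E4'.
    * have [_ _ /= HZ2 _ _] := tab2; rewrite HZ2 => h3 F3 [T3 [HT3 Q3 D3 [E3 E3']]].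
      exists T3; split=> // w'.
      rewrite ltnS leq_eqVlt => /orP[/eqP ->|hu']; last exact: E3.
      by move=> u v hu hv; apply: E3'.
  + have [_ _ /= HZ1 _ _] := tab1; rewrite HZ1 => h2 F2 [T2 [HT2 Q2 D2 E2]].
    exists T2; split=> // _ w x /bndS_inv[[h3 [-> h4]]|].
      by case: Q2 => _; apply.
    move=> [u [v [x1 [x2 [hw hu hv [hin b1 b2 ->]]]]]].
    by apply: E2.
- rewrite Hm => h1 F1 [T1 [HT1 [Q1 Q2] D1]]; exists T1; split=> // w x hx.
  case: (posnP m) => [m0|m0]; last exact: D1.
  by move: hx; rewrite m0 => /bnd0_inv[h2 [-> h3]]; apply: Q2.
Qed.

Lemma sel_spec h T : tab h -> trep h T ->
  let good w := [/\ w < Z, forall q, q < m -> In w q & cnt kap (T w) <= k] in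
  wp b sel (fun h' => (ia h' aRES = ia h aRES /\ forall w, ~ good w) \/
    exists2 w, good w & forall c, c < kap -> ia h' aRES 0 c = T w c :> nat) h.
Proof.
move=> [Hm Hk HZ Hkk Hr] HT good.
apply: (wp_for (I := fun j h' => (ia h' aRES = ia h aRES /\ forall w, w < j -> ~ good w) \/
    exists2 w, good w & forall c, c < kap -> ia h' aRES 0 c = T w c :> nat)) => //=.
- by rewrite HZ.
- by left.
- rewrite HZ => w h1 hw F1 J.
  have [/= rI _] := Hr w hw; have [rT rC] := HT w hw.
  mv h F1.
  apply: wp_seq; apply: wp_set => //=.
  apply: wp_seq.
  apply: (wp_for (I := fun j h' => iv h' vok = alln j (In w))) => //=.
  + by rewrite Hm.
  + rewrite Hm => q h2 hq F2 K.
    have Hw2 : iv h2 vw = w by rewrite (frV F2).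
    mv h1 F2.
    apply: wp_if => /=; first by rewrite Hw2; do !split=> //; lia.
    rewrite Hw2 rI // bit1 allnS.
    case: ifP => hin; first by apply: wp_skip => /=; rewrite K hin andbT.
    by apply: wp_set => //=; rewrite hin andbF.
  rewrite Hm => h2 F2 K.
  have Hw2 : iv h2 vw = w by rewrite (frV F2).
  mv h1 F2.
  have step (h' : ist R) : (~ good w) -> ia h' aRES = ia h2 aRES ->
    (ia h' aRES = ia h aRES /\ (forall w', w' < w.+1 -> ~ good w')) \/
      exists2 w, good w & forall c, c < kap -> ia h' aRES 0 c = T w c :> nat.
    move=> ng ->; case: J => [[e H]|[w' g H]]; last by right; exists w'.
    by left; split=> // w'; rewrite ltnS leq_eqVlt => /orP[/eqP ->|]; last exact: H.
  apply: wp_if => //=; rewrite K bit1.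
  case: ifP => hall; last first.
    apply: wp_skip; apply: step => // -[_ H _].
    by move/negP: hall; apply; apply/allnP.
  apply: wp_if => //=; rewrite Hw2 rC Hkk.
  case: ifP => hle; last by apply: wp_skip; apply: step => // -[_ _]; rewrite hle.
  apply: (wp_for (I := fun j h' => forall c, c < j -> ia h' aRES 0 c = T w c :> nat)) => //=.
  + by rewrite Hk.
  + rewrite Hk => c h3 hc F3 L.
    have Hw3 : iv h3 vw = w by rewrite (frV F3).
    have HT3 : ia h3 aT = ia h2 aT by rewrite (frA F3).
    apply: wp_put => /=; first by rewrite Hw3; do !split=> //; lia.
    move=> c'; rewrite Hw3 HT3 ltnS leq_eqVlt.
    by case: eqP => /= [->|_ hc']; rewrite ?rT ?L.
  + rewrite Hk => h3 F3 L; right; exists w => //.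
    by split=> //; apply/allnP.
- rewrite HZ => h1 F1 [[e H]|[w g H]]; last by right; exists w.
  by left; split=> // w g; apply: (H w) => //; case: g.
Qed.
End Sat.
End Specs3.

Definition xscale (e : nat) : rexp := RN (NB (NC (4 * e)) (NV vjj)).

Definition rholoop (d Zc e : nat) : cmd :=
  CFor 0 vjj (NC (3 * e).+1) (
    CRSet xrho (RB RDiv (RB RMul (RV xr2) (RB RMul (xscale e) (xscale e)))
                        (RN (NC (4 * e * e)))) ;;
    init d Zc ;; sat ;; sel).

Definition outp (d Zc : nat) : cmd :=
  CSet vf (NC 0) ;;
  CFor 0 vc (NV vkap) (CIf (BN (NC 1) (G1 aRES (NV vc)))
    (CFor 0 vl (NC d) (CRPut (NA (NV vob) (NA (NM d (NV vf)) (NV vl)))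
                             (ptK d Zc (NV vc) (NV vl))) ;;
     INC vf) CSkip).

Definition stage2 (d e M Zc : nat) : cmd :=
  CRSet xeta (RB RDiv (RQ (RV xr2)) (RN (NC (e * d)))) ;;
  kgen d Zc ;; seps d M ;; rows d Zc ;; rholoop d Zc e ;; outp d Zc.

Definition orow (d : nat) (p l : nexp) : rexp := RG (NA (NV vob) (NA (NM d p) l)).

(* The output must consist of k distinct points: missing and repeated points are
   replaced by points whose first coordinate exceeds all those in use. *)
Definition fin (d : nat) : cmd :=
  CRSet xbd (RN (NC 1)) ;;
  CFor 0 vp (NV vf)
    (CIf (BR (RB RAdd (orow d (NV vp) (NC 0)) (RN (NC 1))) (RV xbd)) CSkip
       (CRSet xbd (RB RAdd (orow d (NV vp) (NC 0)) (RN (NC 1))))) ;;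
  CFor 0 vj (NV vk) (
    CSet vdup (NC 0) ;;
    CIf (BN (NV vf) (NV vj)) (CSet vdup (NC 1)) CSkip ;;
    CFor 0 vp (NV vj) (
      CSet veq (NC 1) ;;
      CFor 0 vl (NC d) (
        CIf (BR (orow d (NV vp) (NV vl)) (orow d (NV vj) (NV vl))) CSkip (CSet veq (NC 0)) ;;
        CIf (BR (orow d (NV vj) (NV vl)) (orow d (NV vp) (NV vl))) CSkip (CSet veq (NC 0))) ;;
      CIf (BN (NC 1) (NV veq)) (CSet vdup (NC 1)) CSkip) ;;
    CIf (BN (NC 1) (NV vdup))
      (CRPut (NA (NV vob) (NM d (NV vj))) (RB RAdd (RV xbd) (RN (NV vj)))) CSkip) ;;
  CFor 0 vj (NM d (NV vk)) (CRPut (NV vj) (RG (NA (NV vob) (NV vj)))).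

Section Specs4.
Variable R : realType.
Implicit Types (h : ist R).

Definition rho2 (e : nat) (r2 : R) (jj : nat) : R :=
  (r2 * ((4 * e - jj)%:R * (4 * e - jj)%:R) / (4 * e * e)%:R)%R.

Lemma rho2_mono e r2 jj jj' : (0 <= r2)%R -> jj <= jj' ->
  (rho2 e r2 jj' <= rho2 e r2 jj)%R.
Proof.
move=> h1 h2; rewrite /rho2 ler_wpM2r ?invr_ge0 ?ler0n // ler_wpM2l //.
by rewrite -!natrM ler_nat leq_mul // leq_sub2l.
Qed.

Lemma tab_fr m kap Z k In Sg c h1 h2 : tab m kap Z k In Sg h1 -> fr c h1 h2 ->
    [/\ vm \notin modV c, vkap \notin modV c, vZ \notin modV c & vk \notin modV c] ->
    aIN \notin modA c -> aSIG \notin modA c -> tab m kap Z k In Sg h2.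
Proof.
move=> [t1 t2 t3 t4 t5] [f1 f2 f3 f4] [m1 m2 m3 m4] m5 m6; split; rewrite ?f1 //.
by move=> w hw; rewrite /rrep !f3 //; apply: t5.
Qed.

Definition covr d Zc e h jj q c :=
  (sqdist d (Qpt d h q) (Kpt d Zc h c) <= rho2 e (rv h xr2) jj)%R.

Definition feasr d Zc e m kap Z k (In Sg : nat -> nat -> bool) h jj : Prop := exists w x, [/\ w < Z,
  forall q, q < m -> In w q, x <= k &
  bnd m kap Z In Sg (covr d Zc e h jj) m w x].

Lemma rholoop_spec b d Zc e m kap Z k In Sg h : tab m kap Z k In Sg h ->
  m <= b 0 -> kap <= b 0 -> Z <= b 0 -> d <= b 0 -> (3 * e).+1 <= b 0 ->
  (0 <= rv h xr2)%R ->
  (forall q jj, q < m -> exists2 c, c < kap & covr d Zc e h jj q c) ->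
  wp b (rholoop d Zc e) (fun h' => forall jj, jj <= 3 * e ->
    feasr d Zc e m kap Z k In Sg h jj -> exists RT : nat -> bool,
    [/\ forall c, c < kap -> ia h' aRES 0 c = RT c :> nat, cnt kap RT <= k &
        forall q, q < m -> exists c, [/\ c < kap, RT c & covr d Zc e h jj q c]]) h.
Proof.
move=> Htab mb kb Zb db eb r0 Hall.
pose I N h' := forall jj, jj < N ->
    feasr d Zc e m kap Z k In Sg h jj -> exists RT : nat -> bool,
    [/\ forall c, c < kap -> ia h' aRES 0 c = RT c :> nat, cnt kap RT <= k &
        forall q, q < m -> exists c, [/\ c < kap, RT c & covr d Zc e h jj q c]].
apply: (wp_for (I := I)) => //=.
- rewrite /I => jj h1 hjj F1 J.
  have Hr : rv h1 xr2 = rv h xr2 by rewrite (frR F1).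
  have tab1 : tab m kap Z k In Sg h1 by apply: tab_fr Htab F1 _ _ _.
  apply: wp_seq; apply: wp_rset => //=.
  rewrite Hr -/(rho2 e (rv h xr2) jj).
  set h2 := setr _ _ _.
  have tab2 : tab m kap Z k In Sg h2 by [].
  have HK c l : Kpt d Zc h2 c l = Kpt d Zc h c l.
    rewrite /Kpt /Qpt /h2 /= !(frA F1) // (frX F1) //; have /= -> := frR F1 (i := xeta) isT.
    by [].
  have HQ q l : Qpt d h2 q l = Qpt d h q l.
    by rewrite /Qpt /h2 /= !(frA F1) // (frX F1).
  have HKf c : Kpt d Zc h2 c = Kpt d Zc h c by apply/funext => l.
  have HQf c : Qpt d h2 c = Qpt d h c by apply/funext => l.
  apply: wp_seq.
  apply: wp_conseq; first apply: (@init_spec _ b d Zc m kap Z k In Sg (covr d Zc e h jj)) => //.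
  + by move=> q c; rewrite HKf HQf /covr.
  + by move=> q hq; apply: Hall.
  move=> h3 F3 [T [HT HS Hl]].
  have tab3 : tab m kap Z k In Sg h3 by apply: tab_fr tab2 F3 _ _ _.
  have R3 : ia h3 aRES = ia h1 aRES by rewrite (frA F3).
  apply: wp_seq.
  apply: wp_conseq; first by apply: (@sat_spec _ b d m kap Z k In Sg (covr d Zc e h jj)) HT HS Hl.
  move=> h4 F4 [T' [HT' HS' Hl']].
  have tab4 : tab m kap Z k In Sg h4 by apply: tab_fr tab3 F4 _ _ _.
  have R4 : ia h4 aRES = ia h1 aRES by rewrite (frA F4).
  apply: wp_conseq; first by apply: (@sel_spec _ b d m kap Z k In Sg) tab4 HT'.
  move=> h5 F5 [[e5 Hno]|[w [hw hin hcnt] Hres]] jj'.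
    rewrite ltnS leq_eqVlt => /orP[/eqP ->|hlt].
      move=> [w [x [hw hin hx hb]]]; case: (Hno w); split=> //.
      exact: leq_trans (Hl' _ _ hb) hx.
    by move=> hf; rewrite e5 R4; apply: J.
  rewrite ltnS => hle _; exists (T' w); split=> // q hq.
  have [_ /(_ q hq (hin q hq)) [c [h6 h7 h8]]] := HS' w hw.
  exists c; split=> //; apply: le_trans h8 _; exact: rho2_mono.
Qed.

Lemma outp_spec b d Zc m kap n k (RT : nat -> bool) X h : iv h vkap = kap -> ra h = X ->
  kap <= b 0 -> d <= b 0 -> d * n <= iv h vob ->
  (forall c, c < kap -> (1 <= ia h aRES 0 c) = RT c) ->
  (forall c, c < kap -> ia h aKQ 0 c < m) ->
  (forall q, q < m -> ia h aQI 0 q < n) ->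
  iv h vk = k ->
  wp b (outp d Zc) (fun h' => iv h' vf = cnt kap RT /\
    forall c, c < kap -> RT c -> exists2 j, j < cnt kap RT &
      forall l, l < d -> ra h' (iv h vob + (d * j + l)) = Kpt d Zc h c l) h.
Proof.
move=> Hk HX kb db Hob HR HKQ HQI Hkk.
apply: wp_seq; apply: wp_set => //=.
set ob := iv h vob in Hob *.
have Eob : iv h vob = ob by [].
apply: (wp_for (I := fun j h' => [/\ iv h' vf = cnt j RT,
  forall i, i < ob -> ra h' i = ra h i &
  forall c, c < j -> RT c -> exists2 j', j' < cnt j RT &
      forall l, l < d -> ra h' (ob + (d * j' + l)) = Kpt d Zc h c l])) => //=.
- by rewrite Hk.
- rewrite Hk => c h1 hc F1 [J1 J2 J3].
  have Hob1 : iv h1 vob = ob by rewrite (frV F1).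
  have HR1 : ia h1 aRES = ia h aRES by rewrite (frA F1).
  have HQ1 : ia h1 aQI = ia h aQI by rewrite (frA F1).
  have HKQ1 : ia h1 aKQ = ia h aKQ by rewrite (frA F1).
  have HKZ1 : ia h1 aKZ = ia h aKZ by rewrite (frA F1).
  have Heta : rv h1 xeta = rv h xeta by rewrite (frR F1).
  apply: wp_if => //=; rewrite HR1 HR //.
  case: ifP => hRT; last first.
    apply: wp_skip => /=; rewrite cntS hRT addn0; split=> // c'.
    rewrite ltnS leq_eqVlt => /orP[/eqP ->|hc']; first by rewrite hRT.
    exact: J3.
  apply: wp_seq.
  apply: (wp_for (I := fun j h' => [/\ iv h' vf = cnt c RT,
    forall i, i < ob + d * cnt c RT -> ra h' i = ra h1 i &
    forall l, l < j -> ra h' (ob + (d * cnt c RT + l)) = Kpt d Zc h c l])) => //=.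
  + move=> l h2 hl F2 [K1 K2 K3].
    have Hob2 : iv h2 vob = ob by rewrite (frV F2).
    have Hc2 : iv h2 vc = c by rewrite (frV F2).
    apply: wp_rput => /=; first by rewrite Hc2; do !split=> //; lia.
    rewrite Hob2 Hc2 K1 !(frA F2) //= HKQ1 HQ1 HKZ1.
    have -> : rv h2 xeta = rv h xeta by rewrite (frR F2).
    have Ek : ra h2 (d * ia h aQI 0 (ia h aKQ 0 c) + l) = ra h (d * ia h aQI 0 (ia h aKQ 0 c) + l).
      have := HQI _ (HKQ c hc) => lt1.
      have lt2 : d * ia h aQI 0 (ia h aKQ 0 c) + l < ob by nia.
      by rewrite K2 ?J2 //; lia.
    split=> //.
      by move=> i hi; rewrite /upd; case: eqP => [|_]; [lia|apply: K2].
    move=> l'; rewrite ltnS leq_eqVlt => /orP[/eqP ->|hl'].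
      by rewrite /upd eqxx Ek.
    by rewrite /upd; case: eqP => [|_]; [lia|apply: K3].
  + move=> h2 F2 [K1 K2 K3].
    apply: wp_set => //=; rewrite K1 cntS hRT; split=> //.
      by move=> i hi; rewrite K2 ?J2 //; lia.
    move=> c'; rewrite ltnS leq_eqVlt => /orP[/eqP -> _|hc' hr].
      by exists (cnt c RT); [lia|].
    have [j' hj' Hj'] := J3 _ hc' hr; exists j'; first by lia.
    move=> l hl; rewrite K2 ?Hj' //.
    have : d * j'.+1 <= d * cnt c RT by rewrite leq_mul2l hj' orbT.
    by rewrite mulnS; lia.
- by rewrite Hk => h1 F1 [J1 J2 J3].
Qed.

Lemma fin_spec b d k f h : 0 < d -> 0 < k -> iv h vk = k -> iv h vf = f -> f <= k ->
  d * k <= iv h vob -> d * k <= b 0 ->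
  wp b (fin d) (fun h' =>
    (forall i j, i < j -> j < k -> exists2 l, l < d &
       ra h' (i * d + l) != ra h' (j * d + l)) /\
    (forall j, j < f -> exists2 j', j' < k &
       forall l, l < d -> ra h' (j' * d + l) = ra h (iv h vob + (d * j + l)))) h.
Proof.
move=> d0 k0 Hk Hf fk Hob bb.
have kb : k <= b 0 by apply: leq_trans bb; rewrite leq_pmull.
set ob := iv h vob in Hob *.
have Eob : iv h vob = ob by [].
pose O j l := ra h (ob + (d * j + l)).
have db : d <= b 0 by apply: leq_trans bb; rewrite leq_pmulr.
apply: wp_seq; apply: wp_rset => //=.
apply: wp_seq.
apply: (wp_for (I := fun j h' => forall p, p < j -> (O p 0 < rv h' xbd)%R)) => //=.
- by rewrite Hf; lia.
- rewrite Hf => p h1 hp F1 J.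
  have Hob1 : iv h1 vob = ob by rewrite (frV F1).
  have HX1 : ra h1 = ra h by rewrite (frX F1).
  apply: wp_if => //=; rewrite HX1 Hob1 -/(O p 0).
  case: leP => hle.
    apply: wp_skip => /= p'; rewrite ltnS leq_eqVlt => /orP[/eqP ->|]; last exact: J.
    by apply: lt_le_trans hle; rewrite ltrDl ltr01.
  apply: wp_rset => //= p'; rewrite HX1 Hob1 -/(O p 0) ltnS leq_eqVlt => /orP[/eqP ->|hp'].
    by rewrite ltrDl ltr01.
  exact: lt_trans (J _ hp') hle.
rewrite Hf => h1 F1 J1.
mv h F1.
have HX1 : ra h1 = ra h by rewrite (frX F1).
set bd := rv h1 xbd in J1.
have Ebd : rv h1 xbd = bd by [].
pose O' h' j l := ra h' (ob + (d * j + l)).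
pose A h' j := (j < f /\ (forall l, l < d -> O' h' j l = O j l) /\
    forall i, i < j -> exists2 l, l < d & O' h' i l != O' h' j l) \/
  (O' h' j 0 = (bd + j%:R)%R /\ (j < f -> exists2 i, i < j &
     forall l, l < d -> O' h' i l = O j l)).
have Aext (h' h'' : ist R) j : (forall i l, i <= j -> l < d -> O' h' i l = O' h'' i l) ->
   A h' j -> A h'' j.
  move=> e [[a1 [a2 a3]]|[a1 a2]]; [left|right].
    split=> //; split=> [l hl|i hi]; first by rewrite -e ?a2.
    by have [l hl hn] := a3 _ hi; exists l; rewrite -?e //; lia.
  split=> [|hjf]; first by rewrite -e.
  by have [i hi H] := a2 hjf; exists i => // l hl; rewrite -e ?H //; lia.
apply: wp_seq.
apply: (wp_for (I := fun j h' =>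
  (forall j' l, j <= j' -> l < d -> O' h' j' l = O j' l) /\
  (forall j', j' < j -> A h' j'))) => //=.
- by rewrite Hk.
- by split=> // j' l _ _; rewrite /O' HX1.
- rewrite Hk => j h2 hj F2 [J2 J3].
  mv h1 F2.
  apply: wp_seq; apply: wp_set => //=.
  apply: wp_seq.
  apply: (@wp_conseq _ _ _ (fun h' => [/\ iv h' vob = ob, iv h' vf = f, iv h' vk = k,
     iv h' vj = j & [/\ rv h' xbd = bd, ra h' = ra h2 & iv h' vdup = (f <= j)]])).
    apply: wp_if => //=; rewrite Hf.
    by case: ifP => hfj; [apply: wp_set|apply: wp_skip] => //=; rewrite hfj.
  move=> h3 _ [Eob3 Hf3 Hk3 Hj3 [Ebd3 HX3 Hd3]].
  pose same i := alln d (fun l => O' h2 i l == O' h2 j l).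
  apply: wp_seq.
  apply: (wp_for (I := fun p h' => iv h' vdup = (f <= j) || hasn p same)) => //=.
  + by rewrite Hj3; lia.
  + by rewrite Hd3; case: (f <= j).
  + rewrite Hj3 => p h4 hp F4 K.
    have Hob4 : iv h4 vob = ob by rewrite (frV F4).
    have Hj4 : iv h4 vj = j by rewrite (frV F4).
    have HX4 : ra h4 = ra h2 by rewrite (frX F4).
    apply: wp_seq; apply: wp_set => //=.
    apply: wp_seq.
    apply: (wp_for (I := fun l h' => iv h' veq =
       alln l (fun l => O' h2 p l == O' h2 j l))) => //=.
    * move=> l h5 hl F5 L.
      have Hob5 : iv h5 vob = ob by rewrite (frV F5).
      have Hj5 : iv h5 vj = j by rewrite (frV F5).
      have Hp5 : iv h5 vp = p by rewrite (frV F5).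
      have HX5 : ra h5 = ra h2 by rewrite (frX F5).
      apply: wp_seq.
      apply: (@wp_conseq _ _ _ (fun h' => [/\ iv h' vob = ob, iv h' vj = j,
        iv h' vp = p, iv h' vl = l & ra h' = ra h2 /\
        iv h' veq = alln l (fun l => O' h2 p l == O' h2 j l) && (O' h2 p l <= O' h2 j l)%R])).
        apply: wp_if => //=; rewrite HX5 Hob5 Hp5 Hj5 -/(O' h2 p l) -/(O' h2 j l).
        by case: ifP => hle; [apply: wp_skip|apply: wp_set] => //=; rewrite hle ?L ?andbT ?andbF.
      move=> h6 _ [Hob6 Hj6 Hp6 Hl6 [HX6 L6]].
      apply: wp_if => //=; rewrite HX6 Hob6 Hp6 Hj6 Hl6 -/(O' h2 p l) -/(O' h2 j l) allnS eq_le.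
      case: ifP => hle; [apply: wp_skip => /=|apply: wp_set => //=]; rewrite ?L6 ?hle ?andbT ?andbF //.
    * move=> h5 F5 L; rewrite -/(same p) in L.
      have Hd5 : iv h5 vdup = iv h4 vdup by rewrite (frV F5).
      apply: wp_if => //=; rewrite L bit1 hasnS.
      by case: ifP => hs; [apply: wp_set => //=|apply: wp_skip => /=]; rewrite ?hs ?orbT ?orbF ?Hd5 ?K.
  + rewrite Hj3 => h4 F4 K.
    have Hob4 : iv h4 vob = ob by rewrite (frV F4).
    have Hj4 : iv h4 vj = j by rewrite (frV F4).
    have HX4 : ra h4 = ra h2 by rewrite (frX F4).
    have Hbd4 : rv h4 xbd = bd by rewrite (frR F4).
    have addr i l : l < d -> i != j -> ob + (d * i + l) == ob + d * j = false.
      move=> hl hij; apply/eqP => e0; have e1 : d * i + l = d * j by lia.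
      case: (ltngtP i j) => // hlt; last by lia.
        have : d * i.+1 <= d * j by rewrite leq_mul2l hlt orbT.
        by rewrite mulnS; lia.
      have : d * j.+1 <= d * i by rewrite leq_mul2l hlt orbT.
      by rewrite mulnS; lia.
    apply: wp_if => //=; rewrite K bit1.
    case: ifP => hdup.
      apply: wp_rput => //=; rewrite Hob4 Hj4 Hbd4 HX4.
      set h5 := setx _ _ _.
      have O5 i l : l < d -> i != j -> O' h5 i l = O' h2 i l.
        by move=> hl hij; rewrite /O' /h5 /= addr // HX4.
      split.
        move=> j' l hj' hl; rewrite addr //; last by lia.
        by apply: J2 => //; lia.
      move=> j'; rewrite ltnS leq_eqVlt => /orP[/eqP ->|hj'].
        right; split; first by rewrite /O' /h5 /= addn0 eqxx.
        move=> hjf; have := hdup; rewrite leqNgt hjf orFb => /hasnP[i hi hs].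
        exists i => // l hl; rewrite (O5 i l hl); last by rewrite neq_ltn hi.
        by move/allnP: hs => /(_ l hl) /eqP ->; apply: J2.
      apply: Aext (J3 _ hj') => i l hi hl; rewrite O5 //; lia.
    apply: wp_skip => /=.
    have O4 i l : O' h4 i l = O' h2 i l by rewrite /O' HX4.
    split; first by move=> j' l hj' hl; rewrite O4 J2 //; lia.
    move=> j'; rewrite ltnS leq_eqVlt => /orP[/eqP ->|hj'].
      move/negbT: hdup; rewrite negb_or -ltnNge => /andP[hjf hns].
      left; split=> //; split=> [l hl|i hi]; first by rewrite O4 J2.
      have : ~~ same i by apply: contra hns => hs; apply/hasnP; exists i.
      move=> /allnP/existsNP[l /not_implyP[hl /negP hne]].
      by exists l; rewrite ?O4.
    by apply: Aext (J3 _ hj') => i l hi hl; rewrite O4.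
- rewrite Hk => h2 F2 [J2 J3].
  mv h1 F2.
  apply: (wp_for (I := fun j h' => (forall i, i < j -> ra h' i = ra h2 (ob + i)) /\
     forall i, d * k <= i -> ra h' i = ra h2 i)) => //=.
  + by rewrite Hk.
  + rewrite Hk => j h3 hj F3 [K1 K2].
    have Hob3 : iv h3 vob = ob by rewrite (frV F3).
    apply: wp_rput => //=; rewrite Hob3; split=> i hi; last first.
      by case: eqP => [|_]; [lia|apply: K2].
    case: eqP => [->|hne]; first by rewrite K2 //; lia.
    by apply: K1; lia.
  + rewrite Hk => h3 F3 [K1 K2].
    have E j l : j < k -> l < d -> ra h3 (j * d + l) = O' h2 j l.
      move=> hj hl; rewrite K1 /O' 1?mulnC //.
      have : d * j.+1 <= d * k by rewrite leq_mul2l hj orbT.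
      by rewrite mulnS; lia.
    split.
      move=> i j hij hj.
      have hi : i < k by lia.
      case: (J3 j hj) => [[a1 [a2 a3]]|[a1 a2]].
        by have [l hl hn] := a3 i hij; exists l; rewrite ?E.
      exists 0; rewrite // !E // a1.
      case: (J3 i hi) => [[b1 [b2 b3]]|[b1 b2]].
        rewrite b2 // lt_eqF //; apply: lt_le_trans (J1 _ b1) _.
        by rewrite lerDl ler0n.
      by rewrite b1 (inj_eq (addrI _)) eqr_nat; lia.
    move=> j hj; have hjk : j < k by lia.
    case: (J3 j hjk) => [[a1 [a2 a3]]|[a1 a2]].
      by exists j => // l hl; rewrite E ?a2.
    have [i hi H] := a2 hj; exists i; first by lia.
    by move=> l hl; rewrite E ?H //; lia.
Qed.
End Specs4.

(** * The algorithm *)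

Definition copyp (d : nat) : cmd :=
  CSet vf (NV vn) ;;
  CFor 0 vj (NM d (NV vn)) (CRPut (NA (NV vob) (NV vj)) (RG (NV vj))).

Definition setob (d : nat) : cmd := CSet vob (NM d (NA (NV vn) (NV vk))).

Definition mainp (d D e M Zc : nat) : cmd :=
  setob d ;;
  CIf (BN (NV vn) (NV vk)) (copyp d) (gonz d D ;; stage2 d e M Zc) ;;
  fin d.

Section Specs5.
Variable R : realType.
Implicit Types (h : ist R).

Lemma Kpt_fr d Zc c h1 h2 : fr c h1 h2 -> modX c = false -> xeta \notin modR c ->
  [/\ aQI \notin modA c, aKQ \notin modA c & aKZ \notin modA c] ->
  Kpt d Zc h2 = Kpt d Zc h1 /\ Qpt d h2 = Qpt d h1.
Proof.
move=> [f1 f2 f3 f4] m1 m2 [m3 m4 m5].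
have eQ : Qpt d h2 = Qpt d h1.
  by apply/funext => q; apply/funext => l; rewrite /Qpt f4 // f3.
split=> //; apply/funext => q; apply/funext => l.
by rewrite /Kpt eQ f2 // !f3.
Qed.

(* What the later stages guarantee: the candidates contain all lattice points
   around the coreset, the rows contain all boxes with candidate bounds and all
   small sets, and the output covers the coreset with every radius for which
   the dynamic program has a tree with at most k centers. *)
Definition st2 d e M Zc m k (Qp : nat -> nat -> R) (r2 : R) f (out : nat -> nat -> R)
    : Prop :=
  let kap := m * (2 * Zc).+2 ^ d in
  exists (KQ : nat -> nat) (KZ : nat -> nat -> nat) (s0 nb S Z : nat)
    (In Sg : nat -> nat -> bool),
  let Kp c l := (Qp (KQ c) l + Num.sqrt r2 / (e * d)%:R * ((KZ c l)%:R - Zc%:R))%R in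
  let cov jj q c := (sqdist d (Qp q) (Kp c) <= rho2 e r2 jj)%R in
  [/\ forall c, c < kap -> KQ c < m,
    forall q z, q < m -> (forall l, l < d -> z l <= 2 * Zc) ->
      exists2 c, c < kap & KQ c = q /\ forall l, l < d -> KZ c l = z l,
    [/\ 0 < s0, k ^ d.-1 <= s0 ^ d &
      if k <= M * s0 then S = k /\ nb = 0 else S = M * s0 /\ nb = d],
    forall (lo hi : nat -> nat) (s : seq nat), (forall i, i < nb -> lo i < kap) ->
       (forall i, i < nb -> hi i < kap) -> size s <= S -> all (fun c => c < kap) s ->
       exists w, [/\ w < Z,
         forall q, q < m -> In w q = all (fun i => (Kp (lo i) i <= Qp q i)%R &&
            (Qp q i <= Kp (hi i) i)%R) (iota 0 nb) &
         forall c, c < kap -> Sg w c = (c \in s)] &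
    forall jj, jj <= 3 * e ->
      (exists w x, [/\ w < Z, forall q, q < m -> In w q, x <= k &
        bnd m kap Z In Sg (cov jj) m w x]) ->
      f <= k /\ forall q, q < m -> exists2 j, j < f &
        (sqdist d (Qp q) (out j) <= rho2 e r2 jj)%R].

Lemma bnd_ext m kap Z In Sg cov In' Sg' cov' j w x :
  (forall w q, w < Z -> q < m -> In w q = In' w q) ->
  (forall w c, w < Z -> c < kap -> Sg w c = Sg' w c) ->
  (forall q c, q < m -> c < kap -> cov q c = cov' q c) ->
  bnd m kap Z In Sg cov j w x -> bnd m kap Z In' Sg' cov' j w x.
Proof.
move=> e1 e2 e3; elim=> {j w x} [j w hw hl|j w u v x1 x2 hw hu hv hin b1 IH1 b2 IH2].
  rewrite (eq_cnt (p' := Sg' w)); last by move=> c hc; apply: e2.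
  apply: bnd_leaf => // q hq; rewrite -e1 // => /(hl q hq)[c [h1 h2 h3]].
  by exists c; rewrite -e2 // -e3.
rewrite (eq_cnt (p' := fun c => Sg' w c || (Sg' u c || Sg' v c))); last first.
  by move=> c hc; rewrite !e2.
rewrite (@eq_cnt _ (Sg u) (Sg' u)); last by move=> c hc; apply: e2.
rewrite (@eq_cnt _ (Sg v) (Sg' v)); last by move=> c hc; apply: e2.
apply: bnd_split => // q hq; rewrite -!e1 //; exact: hin.
Qed.

Lemma stage2_spec b d e M Zc m k n h :
  let kap := m * (2 * Zc).+2 ^ d in
  0 < d -> 0 < k -> iv h vm = m -> iv h vk = k -> d * n <= iv h vob ->
  (forall q, q < m -> ia h aQI 0 q < n) -> (0 <= rv h xr2)%R ->
  d <= b 0 -> M <= b 0 -> (2 * Zc).+1 <= b 0 -> kap <= b 0 -> k <= b 0 ->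
  (3 * e).+1 <= b 0 ->
  (forall s0, 0 < s0 -> s0 <= k -> k ^ d.-1 <= s0 ^ d -> s0.-1 ^ d < k ^ d.-1 ->
     kap.+1 ^ (if k <= M * s0 then k else 2 * d + M * s0) <= b 0) ->
  wp b (stage2 d e M Zc) (fun h' =>
    st2 d e M Zc m k (Qpt d h) (rv h xr2) (iv h' vf)
       (fun j l => ra h' (iv h vob + (d * j + l)))) h.
Proof.
move=> kap d0 k0 Hm Hk Hob HQI hr2 hd hM hZ hkap hkb he Hsep.
apply: wp_seq; apply: wp_rset => //.
set h0 := setr h xeta _.
have Hm0 : iv h0 vm = m by [].
have Hk0 : iv h0 vk = k by [].
have HQ0 : Qpt d h0 = Qpt d h by [].
have Heta : rv h0 xeta = (Num.sqrt (rv h xr2) / (e * d)%:R)%R by [].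
have Hr0 : rv h0 xr2 = rv h xr2 by [].
have HA0 : ia h0 aQI = ia h aQI by [].
have Hob0 : iv h0 vob = iv h vob by [].
have HX0 : ra h0 = ra h by [].
clearbody h0.
have mkap : m <= kap by rewrite /kap leq_pmulr // expn_gt0.
apply: wp_seq.
apply: wp_conseq; first by apply: (@kgen_spec _ b d Zc m) => //.
move=> h1 F1 /= [Hkap1 Kall Kex Kfst].
rewrite -/kap in Hkap1 Kall Kex.
mv h0 F1.
have HQ1 : Qpt d h1 = Qpt d h.
  by apply/funext => q; apply/funext => l; rewrite /Qpt HX0 HA0.
apply: wp_seq.
apply: wp_conseq; first by apply: (@seps_spec _ b d M k) => //.
move=> h2 F2 [s0 [s01 s0k s0p s0m HS]].
mv h1 F2.
have [HK2 HQ2] : Kpt d Zc h2 = Kpt d Zc h1 /\ Qpt d h2 = Qpt d h1 by apply: Kpt_fr F2 _ _ _.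
set nb := if k <= M * s0 then 0 else d.
set S := if k <= M * s0 then k else M * s0.
have [HS2 Hnb2] : iv h2 vS = S /\ iv h2 vnb = nb by rewrite /S /nb; case: ifP HS => _ [].
have Hpow : kap.+1 ^ (2 * nb + S) <= b 0.
  by have := Hsep s0 s01 s0k s0p s0m; rewrite /S /nb; case: ifP => _; rewrite ?muln0.
apply: wp_seq.
apply: wp_conseq.
  apply: (@rows_spec _ b d Zc m kap nb S) => //.
    by rewrite /nb; case: ifP.
  by rewrite /S; case: (leqP k (M * s0)) => // hh; exact: leq_trans (ltnW hh) hkb.
move=> h3 F3 [HZ3 Rall Rex].
mv h2 F3.
have [HK3 HQ3] : Kpt d Zc h3 = Kpt d Zc h2 /\ Qpt d h3 = Qpt d h2 by apply: Kpt_fr F3 _ _ _.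
set Z := kap.+1 ^ (2 * nb + S) in HZ3 Rall Rex Hpow.
pose In w q := ia h3 aIN w q == 1.
pose Sg w c := ia h3 aSIG w c == 1.
have tab3 : tab m kap Z k In Sg h3.
  split=> // w hw; have [[A B] [/= r1 r2]] := Rall w hw.
  by split=> x hx /=; rewrite /In /Sg ?r1 ?r2 //; [case: (A x)|case: (B x)].
have covself q jj : q < m -> exists2 c, c < kap & covr d Zc e h3 jj q c.
  move=> hq; exists q; first by lia.
  rewrite /covr HK3 HQ3 HK2 HQ2.
  have [/= k1 k2 _ _] := Kfst q hq.
  have -> : sqdist d (Qpt d h1 q) (Kpt d Zc h1 q) = 0%R.
    apply: big1 => l _.
    by rewrite /Kpt k1 k2 // !subrr mulr0 addr0 subrr mulr0.
  by rewrite /rho2 !mulr_ge0 ?invr_ge0 ?ler0n ?Hr0.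
apply: wp_seq.
apply: wp_conseq.
  apply: (@rholoop_spec _ b d Zc e m kap Z k In Sg) => //; try lia.
  by rewrite Hr0.
move=> h4 F4 Hrho.
have [HK4 HQ4] : Kpt d Zc h4 = Kpt d Zc h3 /\ Qpt d h4 = Qpt d h3 by apply: Kpt_fr F4 _ _ _.
have rho_e : rv h3 xr2 = rv h xr2 by rewrite Hr0.
have Hkap4 : iv h4 vkap = kap by rewrite (frV F4).
have Hob4 : iv h4 vob = iv h vob by rewrite (frV F4).
have Hk4 : iv h4 vk = k by rewrite (frV F4).
have HKQ4 : ia h4 aKQ = ia h3 aKQ by rewrite (frA F4).
have HQI4 : ia h4 aQI = ia h aQI by rewrite (frA F4).
have HKQ1 : ia h1 aKQ = ia h3 aKQ by rewrite (frA F3) // (frA F2).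
have HKZ1 : ia h1 aKZ = ia h3 aKZ by rewrite (frA F3) // (frA F2).
have Heta1 : rv h1 xeta = rv h3 xeta by rewrite (frR F3) // (frR F2).
set KQ := ia h3 aKQ 0; set KZ := ia h3 aKZ.
pose Kp c l := (Qpt d h (KQ c) l + Num.sqrt (rv h xr2) / (e * d)%:R * ((KZ c l)%:R - Zc%:R))%R.
have HKp : Kpt d Zc h3 = Kp.
  rewrite HK3 HK2; apply/funext => c; apply/funext => l.
  by rewrite /Kpt /Kp HKQ1 HKZ1 HQ1 Heta1 Heta.
have HQp : Qpt d h3 = Qpt d h by rewrite HQ3 HQ2 HQ1.
have KQm c : c < kap -> KQ c < m.
  by move=> hc; have [[q z] [/= a1 _ a3 _]] := Kall c hc; rewrite /KQ -HKQ1 a1.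
have base (f : nat) (out : nat -> nat -> R) :
   (forall jj, jj <= 3 * e -> (exists w x, [/\ w < Z, forall q, q < m -> In w q, x <= k &
        bnd m kap Z In Sg (fun q c => (sqdist d (Qpt d h q) (Kp c) <= rho2 e (rv h xr2) jj)%R) m w x]) ->
      f <= k /\ forall q, q < m -> exists2 j, j < f &
        (sqdist d (Qpt d h q) (out j) <= rho2 e (rv h xr2) jj)%R) ->
  st2 d e M Zc m k (Qpt d h) (rv h xr2) f out.
  move=> H; exists KQ, KZ, s0, nb, S, Z, In, Sg; split=> //.
  - move=> q z hq hz; have [w hw [/= a1 a2 a3 a4]] := Kex q z hq hz.
    by exists w => //; rewrite /KQ /KZ -HKQ1 -HKZ1; split=> // l hl; rewrite a2.
  - by split=> //; rewrite /S /nb; case: (k <= M * s0).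
  - move=> lo hi s hlo hhi hs hall.
    have [w hw [/= r1 r2]] := Rex lo hi s hlo hhi hs hall.
    exists w; split=> // x hx; last by rewrite /Sg r2 //; case: (_ \in _).
    rewrite /In r1 // -HK3 HKp -HQ3 HQp -/(Kp _ _).
    by case: (all _ _).
pose RT c := 1 <= ia h4 aRES 0 c.
apply: wp_conseq.
  apply: (@outp_spec _ b d Zc m kap n k RT (ra h4)) => //.
  - by rewrite Hob4.
  - by move=> c hc; rewrite HKQ4; apply: KQm.
  - by rewrite HQI4.
move=> h5 F5 [Hf5 Hout].
apply: base => jj' hjj' [w [x [hw hin hx hb]]].
have hf' : feasr d Zc e m kap Z k In Sg h3 jj'.
  exists w, x; split=> //; apply: bnd_ext hb => // q c hq hc.
  by rewrite /covr HKp HQp rho_e.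
have [RT' [Hbits' Hcnt' Hcov']] := Hrho jj' hjj' hf'.
have eRT c : c < kap -> RT c = RT' c by move=> hc; rewrite /RT Hbits' // bit1.
split; first by rewrite Hf5 (eq_cnt eRT).
move=> q hq; have [c [c1 c2 c3]] := Hcov' q hq.
rewrite -eRT // in c2.
have [j hj Hj] := Hout c c1 c2.
exists j; first by rewrite Hf5.
move: c3; rewrite /covr HKp HQp rho_e; congr (_ <= _)%R; apply: eq_bigr => l _.
by rewrite -Hob4 Hj // HK4 HKp.
Qed.

Lemma main_small b d D e M Zc n k X h : 0 < d -> 0 < k -> n <= k ->
  iv h vn = n -> iv h vk = k -> ra h = X -> d * k <= b 0 ->
  wp b (mainp d D e M Zc) (fun h' =>
    (forall i j, i < j -> j < k -> exists2 l, l < d &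
       ra h' (i * d + l) != ra h' (j * d + l)) /\
    (forall p, p < n -> exists2 j', j' < k &
       forall l, l < d -> ra h' (j' * d + l) = ptX d X p l)) h.
Proof.
move=> d0 k0 nk Hn Hk HX hb.
have db : d <= b 0 by apply: leq_trans hb; rewrite leq_pmulr.
apply: wp_seq; apply: wp_set => //=; rewrite Hn Hk.
apply: wp_seq; apply: wp_if => //=; rewrite Hn Hk nk.
apply: wp_seq; apply: wp_set => //=; rewrite Hn.
have dn : d * n <= d * k by rewrite leq_mul2l nk orbT.
apply: (wp_for (I := fun j h' => (forall i, i < d * (n + k) -> ra h' i = X i) /\
   forall i, i < j -> ra h' (d * (n + k) + i) = X i)) => //=.
- by rewrite Hn; lia.
- by rewrite HX.
- rewrite Hn => j h1 hj F1 [J1 J2].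
  have Hob : iv h1 vob = d * (n + k) by rewrite (frV F1).
  apply: wp_rput => //=; rewrite Hob; split=> i hi.
    by case: eqP => [hh|_]; [lia|apply: J1].
  case: eqP => [hh|hne].
    have -> : i = j by lia.
    by apply: J1; lia.
  by apply: J2; lia.
- rewrite Hn => h1 F1 [J1 J2].
  have Hob : iv h1 vob = d * (n + k) by rewrite (frV F1).
  have Hk1 : iv h1 vk = k by rewrite (frV F1).
  have Hf1 : iv h1 vf = n by rewrite (frV F1).
  apply: wp_conseq.
    by apply: (@fin_spec _ b d k n) => //; rewrite Hob; lia.
  move=> h2 F2 [K1 K2]; split=> // p hp.
  have [j' hj' H] := K2 p hp; exists j' => // l hl.
  rewrite H // Hob J2 //.
  have : d * p.+1 <= d * n by rewrite leq_mul2l hp orbT.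
  by rewrite mulnS; lia.
Qed.

Definition ctime (c : cmd) (b : nat -> nat) : nat := csz c * wgt b c.

Lemma wp_time b c Q h : tags c -> wp b c Q h -> cost c h <= ctime c b /\ Q (run c h).
Proof. by move=> ht [h1 h2]; split=> //; apply: cost_le. Qed.

Lemma main_large bA b d D e M Zc n k X h (Good : nat -> (nat -> nat -> R) -> Prop) :
  let m := (D * k).+1 in
  let kap := m * (2 * Zc).+2 ^ d in
  0 < d -> 0 < k -> 0 < D -> k < n ->
  iv h vn = n -> iv h vk = k -> ra h = X ->
  d <= bA 0 -> D <= bA 0 -> D * k <= bA 1 -> n <= bA 2 ->
  d * k <= b 0 -> M <= b 0 -> (2 * Zc).+1 <= b 0 -> kap <= b 0 -> (3 * e).+1 <= b 0 ->
  (forall s0, 0 < s0 -> s0 <= k -> k ^ d.-1 <= s0 ^ d -> s0.-1 ^ d < k ^ d.-1 ->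
     kap.+1 ^ (if k <= M * s0 then k else 2 * d + M * s0) <= b 0) ->
  (forall q r2 f out, gz n k d (ptX d X) q r2 (D * k) ->
     st2 d e M Zc m k (fun j => ptX d X (q j)) r2 f out -> f <= k /\ Good f out) ->
  cost (mainp d D e M Zc) h <= ctime (gonz d D) bA + ctime (setob d) b +
     ctime (stage2 d e M Zc) b + ctime (fin d) b + 10 /\
  let h' := run (mainp d D e M Zc) h in
    (forall i j, i < j -> j < k -> exists2 l, l < d &
       ra h' (i * d + l) != ra h' (j * d + l)) /\
    exists f out, [/\ f <= k, Good f out & forall j, j < f -> exists2 j', j' < k &
       forall l, l < d -> ra h' (j' * d + l) = out j l].
Proof.
move=> m kap d0 k0 D0 kn Hn Hk HX a1 a2 a3 a4 b1 b2 b3 b4 b5 b6 HG.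
have db : d <= b 0 by apply: leq_trans b1; rewrite leq_pmulr.
have kb : k <= b 0 by apply: leq_trans b1; rewrite leq_pmull.
pose ob := d * (n + k).
have n0 : 0 < n by apply: leq_ltn_trans kn.
have W1 : wp b (setob d) (fun h' =>
   [/\ iv h' vn = n, iv h' vk = k, iv h' vob = ob & ra h' = X]) h.
  by apply: wp_set => //=; rewrite Hn Hk.
have [c1 [Hn1 Hk1 Hob1 HX1]] := @wp_time b (setob d) _ h isT W1.
have [h1 Eh1] : exists h1, h1 = run (setob d) h by eexists.
rewrite -Eh1 in Hn1 Hk1 Hob1 HX1.
have nk1 : bev (BN (NV vn) (NV vk)) h1 = false.
  by rewrite /= Hn1 Hk1; apply/negbTE; rewrite -ltnNge.
have [c2 [F2 Hm2 G2]] := @wp_time bA (gonz d D) _ h1 isT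
   (@gonz_spec R bA d D n k X h1 n0 k0 a1 a2 a3 a4 Hn1 Hk1 HX1 D0).
have [h2 Eh2] : exists h2, h2 = run (gonz d D) h1 by eexists.
rewrite -Eh2 in F2 Hm2 G2.
mv h1 F2.
have r20 : (0 <= rv h2 xr2)%R.
  have [_ _ H _] := G2.
  have [j _ hj] := H (leq_pmull k D0) 0 n0.
  exact: le_trans (sqdist_ge0 _ _ _) hj.
have QI2 q : q < m -> ia h2 aQI 0 q < n by case: G2 => H _ _ _ hq; apply: H.
have W3 : wp b (stage2 d e M Zc) (fun h' => fr (stage2 d e M Zc) h2 h' /\
   st2 d e M Zc m k (Qpt d h2) (rv h2 xr2) (iv h' vf)
       (fun j l => ra h' (iv h2 vob + (d * j + l)))) h2.
  apply: wp_conseq; first apply: (@stage2_spec b d e M Zc m k n) => //.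
    by rewrite Hob1 /ob leq_mul2l leq_addr orbT.
  by move=> h' F' S'.
have [c3 S3] := @wp_time b (stage2 d e M Zc) _ h2 isT W3.
have [h3 Eh3] : exists h3, h3 = run (stage2 d e M Zc) h2 by eexists.
rewrite -Eh3 in S3.
case: S3 => F3 S3.
have eQ : Qpt d h2 = (fun j => ptX d X (ia h2 aQI 0 j)).
  by apply/funext => j; apply/funext => l; rewrite /Qpt /ptX HX1.
rewrite eQ in S3.
have [fk HGood] := HG _ _ _ _ G2 S3.
mv h2 F3.
have dk3 : d * k <= iv h3 vob by rewrite Hob1 /ob leq_mul2l leq_addl orbT.
have [c4 [K1 K2]] := @wp_time b (fin d) _ h3 isT
  (@fin_spec R b d k (iv h3 vf) h3 d0 k0 Hk1 erefl fk dk3 b1).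
have e1 : run (mainp d D e M Zc) h = run (fin d) h3.
  have -> : run (mainp d D e M Zc) h = run (fin d)
     (run (CIf (BN (NV vn) (NV vk)) (copyp d) (gonz d D ;; stage2 d e M Zc))
        (run (setob d) h)) by [].
  rewrite -Eh1.
  have -> : run (CIf (BN (NV vn) (NV vk)) (copyp d) (gonz d D ;; stage2 d e M Zc)) h1 =
     if bev (BN (NV vn) (NV vk)) h1 then run (copyp d) h1
     else run (stage2 d e M Zc) (run (gonz d D) h1) by [].
  by rewrite nk1 -Eh2 -Eh3.
have e2 : cost (mainp d D e M Zc) h = cost (setob d) h +
   (6 + (cost (gonz d D) h1 + cost (stage2 d e M Zc) h2) + 1 + cost (fin d) h3).
  have -> : cost (mainp d D e M Zc) h = cost (setob d) h +
     (cost (CIf (BN (NV vn) (NV vk)) (copyp d) (gonz d D ;; stage2 d e M Zc))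
        (run (setob d) h) + cost (fin d)
     (run (CIf (BN (NV vn) (NV vk)) (copyp d) (gonz d D ;; stage2 d e M Zc))
        (run (setob d) h))) by [].
  rewrite -Eh1.
  have -> : run (CIf (BN (NV vn) (NV vk)) (copyp d) (gonz d D ;; stage2 d e M Zc)) h1 =
     if bev (BN (NV vn) (NV vk)) h1 then run (copyp d) h1
     else run (stage2 d e M Zc) (run (gonz d D) h1) by [].
  have -> : cost (CIf (BN (NV vn) (NV vk)) (copyp d) (gonz d D ;; stage2 d e M Zc)) h1 =
     6 + (if bev (BN (NV vn) (NV vk)) h1 then cost (copyp d) h1
     else cost (gonz d D) h1 + cost (stage2 d e M Zc) (run (gonz d D) h1)) + 1 by [].
  by rewrite nk1 -Eh2 -Eh3.
split; first by rewrite e2; lia.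
rewrite e1; split=> //.
by exists (iv h3 vf), (fun j l => ra h3 (iv h3 vob + (d * j + l))).
Qed.
End Specs5.

(** * Packing *)

Section Geometry.
Variables (R : realType) (d : nat).
Implicit Types (f g u : nat -> R).
Local Open Scope ring_scope.

Lemma cauchy_schwarz (n : nat) (a b : 'I_n -> R) :
  (\sum_i a i * b i) ^+ 2 <= (\sum_i a i ^+ 2) * (\sum_i b i ^+ 2).
Proof.
set A := \sum_i a i ^+ 2; set B := \sum_i b i ^+ 2; set C := \sum_i a i * b i.
have A0 : 0 <= A by apply: sumr_ge0 => i _; apply: sqr_ge0.
have key : 0 <= A * (A * B - C ^+ 2).
  have -> : A * (A * B - C ^+ 2) = \sum_i (A * b i - C * a i) ^+ 2.
    transitivity (\sum_i (A ^+ 2 * b i ^+ 2 - 2 * A * C * (a i * b i) + C ^+ 2 * a i ^+ 2)).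
      rewrite big_split sumrB -!mulr_sumr -/A -/B -/C /=; ring.
    by apply: eq_bigr => i _; ring.
  by apply: sumr_ge0 => i _; apply: sqr_ge0.
have [A00|A0'] := eqVneq A 0; last first.
  by move: key; rewrite pmulr_rge0 ?lt_neqAle 1?eq_sym ?A0' // subr_ge0.
have ai i : a i = 0.
  have /eqP := A00; rewrite psumr_eq0; last by move=> *; apply: sqr_ge0.
  by move=> /allP/(_ i); rewrite mem_index_enum => /(_ isT)/=; rewrite sqrf_eq0 => /eqP.
by rewrite /C big1 ?expr0n ?A00 ?mul0r // => i _; rewrite ai mul0r.
Qed.

Definition dist f g : R := Num.sqrt (sqdist d f g).

Lemma dist_ge0 f g : 0 <= dist f g. Proof. exact: sqrtr_ge0. Qed.

Lemma sqr_dist f g : dist f g ^+ 2 = sqdist d f g.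
Proof. by rewrite sqr_sqrtr // sqdist_ge0. Qed.

Lemma distC f g : dist f g = dist g f. Proof. by rewrite /dist sqdistC. Qed.

Lemma distxx f : dist f f = 0. Proof. by rewrite /dist sqdistxx sqrtr0. Qed.

Lemma dist_le f g t : 0 <= t -> (dist f g <= t) = (sqdist d f g <= t ^+ 2).
Proof. by move=> t0; rewrite -sqr_dist ler_pXn2r // nnegrE ?dist_ge0. Qed.

Lemma dist_lt f g t : 0 <= t -> (dist f g < t) = (sqdist d f g < t ^+ 2).
Proof. by move=> t0; rewrite -sqr_dist ltr_pXn2r // nnegrE ?dist_ge0. Qed.

Lemma dist_triangle f g u : dist f u <= dist f g + dist g u.
Proof.
rewrite dist_le ?addr_ge0 ?dist_ge0 // sqrrD !sqr_dist.
have -> : sqdist d f u = sqdist d f g + (\sum_(l < d) (f l - g l) * (g l - u l)) *+ 2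
    + sqdist d g u.
  by rewrite /sqdist -sumrMnl -!big_split; apply: eq_bigr => l _ /=; ring.
rewrite lerD2r lerD2l lerMn2r /=.
apply: le_trans (ler_norm _) _.
rewrite -(@ler_pXn2r _ 2) // ?nnegrE ?mulr_ge0 ?dist_ge0 //.
rewrite real_normK ?num_real // exprMn !sqr_dist.
apply: le_trans (cauchy_schwarz _ _) _; rewrite /sqdist.
by rewrite le_eqVlt; apply/orP; left; apply/eqP; congr (_ * _); apply: eq_bigr => l _; rewrite expr2.
Qed.

Lemma coord_dist f g l : (l < d)%N -> `|f l - g l| <= dist f g.
Proof.
move=> hl; rewrite -(@ler_pXn2r _ 2) // ?nnegrE ?dist_ge0 //.
rewrite sqr_dist real_normK ?num_real // /sqdist (bigD1 (Ordinal hl)) //= expr2 lerDl.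
by apply: sumr_ge0 => i _; rewrite -expr2 sqr_ge0.
Qed.

Lemma eq_dist f g f' g' : (forall l, (l < d)%N -> f l = f' l) ->
  (forall l, (l < d)%N -> g l = g' l) -> dist f g = dist f' g'.
Proof.
by move=> e1 e2; congr Num.sqrt; apply: eq_bigr => l _; rewrite e1 // e2.
Qed.

Lemma sqdist_coord_le f g t : (forall l, (l < d)%N -> `|f l - g l| <= t) ->
  sqdist d f g <= d%:R * t ^+ 2.
Proof.
move=> H; rewrite mulr_natl -[X in _ *+ X]card_ord -sumr_const; apply: ler_sum => l _.
rewrite -expr2 -real_normK ?num_real // ler_pXn2r ?nnegrE //; first exact: H.
by apply: le_trans (H l (ltn_ord l)).
Qed.

Lemma sqdist_coord_lt f g t : (0 < d)%N -> (forall l, (l < d)%N -> `|f l - g l| < t) ->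
  sqdist d f g < d%:R * t ^+ 2.
Proof.
move=> d0 H; rewrite mulr_natl -[X in _ *+ X]card_ord -sumr_const.
apply: ltr_sum => [|l _]; first by apply/hasP; exists (Ordinal d0); rewrite ?mem_index_enum.
rewrite -expr2 -real_normK ?num_real // ltr_pXn2r ?nnegrE //; first exact: H.
by apply: le_trans (ltW (H l (ltn_ord l))).
Qed.

Lemma dist_coord_le f g t : (0 < d)%N -> 0 <= t ->
  (forall l, (l < d)%N -> `|f l - g l| <= t) -> dist f g <= d%:R * t.
Proof.
move=> d0 t0 H; rewrite dist_le ?mulr_ge0 //; apply: le_trans (sqdist_coord_le H) _.
rewrite exprMn ler_wpM2r ?sqr_ge0 // expr2 -natrM ler_nat; exact: leq_pmulr.
Qed.

Lemma dist_coord_lt f g t : (0 < d)%N -> 0 < t ->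
  (forall l, (l < d)%N -> `|f l - g l| < t) -> dist f g < d%:R * t.
Proof.
move=> d0 t0 H; rewrite dist_lt ?mulr_ge0 // ?ltW //.
apply: lt_le_trans (sqdist_coord_lt d0 H) _.
rewrite exprMn ler_wpM2r ?sqr_ge0 // expr2 -natrM ler_nat; exact: leq_pmulr.
Qed.

Lemma l1_dist f g : (\sum_(l < d) `|f l - g l|) ^+ 2 <= d%:R * sqdist d f g.
Proof.
have := cauchy_schwarz (fun _ : 'I_d => 1) (fun l => `|f l - g l|).
rewrite (eq_bigr (fun l : 'I_d => `|f l - g l|)); last by move=> l _; rewrite mul1r.
move=> H; apply: le_trans H _; rewrite expr1n sumr_const card_ord.
rewrite le_eqVlt; apply/orP; left; apply/eqP; congr (_ * _); apply: eq_bigr => l _.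
by rewrite real_normK ?num_real // expr2.
Qed.

(* Points of a ball that are pairwise far apart: the cells of side h separate
   them, and the cell vector z is small in the l1 norm, so z is determined by
   its signs, its residues modulo E and its quotients, whose sum is at most d. *)
Lemma packing_ball (N E : nat) (x : 'I_N -> nat -> R) (c : nat -> R) (rho delta : R) :
  (0 < d)%N -> (0 < E)%N -> 0 < delta -> rho <= E%:R * delta ->
  (forall i, dist (x i) c <= rho) ->
  (forall i j, i != j -> delta <= dist (x i) (x j)) -> (N <= (8 * E) ^ d)%N.
Proof.
move=> d0 E0 delta0 rhoE Hc Hs.
have sd0 : 0 < Num.sqrt (d%:R : R) by rewrite sqrtr_gt0 ltr0n.
set h := delta / Num.sqrt d%:R.
have h0 : 0 < h by rewrite divr_gt0.
have dh : d%:R * h ^+ 2 = delta ^+ 2.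
  rewrite /h exprMn exprVn sqr_sqrtr ?ler0n // mulrCA mulfV ?mulr1 //.
  by rewrite pnatr_eq0; lia.
pose y i l := x i l - c l.
pose a i l := Num.truncn (`|y i l| / h).
have asum i : (\sum_(l < d) a i l <= d * E)%N.
  rewrite -(ler_nat R) natr_sum.
  have : \sum_(l < d) (a i l)%:R <= (\sum_(l < d) `|y i l|) / h.
    rewrite mulr_suml; apply: ler_sum => l _.
    by rewrite truncn_le divr_ge0 // ltW.
  move/le_trans; apply; rewrite ler_pdivrMr //.
  apply: le_trans (_ : Num.sqrt d%:R * dist (x i) c <= _).
    rewrite -(@ler_pXn2r _ 2) // ?nnegrE ?sumr_ge0 ?mulr_ge0 ?dist_ge0 ?sqrtr_ge0 //.
    rewrite exprMn sqr_sqrtr ?ler0n // sqr_dist; exact: l1_dist.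
  apply: le_trans (_ : Num.sqrt d%:R * (E%:R * delta) <= _).
    by rewrite ler_wpM2l ?sqrtr_ge0 // (le_trans (Hc i)).
  have -> : (d * E)%:R * h = Num.sqrt d%:R * (E%:R * delta) :> R; last by [].
  have -> : (d * E)%:R = Num.sqrt d%:R ^+ 2 * E%:R :> R by rewrite sqr_sqrtr ?ler0n // natrM.
  by rewrite /h; field; rewrite gt_eqF.
have qsum i : (\sum_(l < d) a i l %/ E <= d)%N.
  rewrite -(leq_pmul2r E0); apply: leq_trans (asum i).
  by rewrite big_distrl /=; apply: leq_sum => l _; apply: leq_divM.
have qlt i (l : 'I_d) : (a i l %/ E < d.+1)%N.
  by rewrite ltnS; apply: leq_trans (qsum i); rewrite (bigD1 l) //= leq_addr.
pose key i : {ffun 'I_d -> bool} * {ffun 'I_d -> 'I_E} * d.-tuple 'I_d.+1 :=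
  ([ffun l : 'I_d => y i l < 0],
   [ffun l : 'I_d => Ordinal (ltn_pmod (a i l) E0)],
   [tuple Ordinal (qlt i l) | l < d]).
have kinj : injective key.
  move=> i j e; apply/eqP/negP => /negP hij.
  have k1 := congr1 (fun p => p.1.1) e; have k2 := congr1 (fun p => p.1.2) e.
  have k3 := congr1 snd e; rewrite /= in k1 k2 k3.
  have := Hs i j hij; apply/negP; rewrite -ltNge dist_lt ?ltW // -dh.
  apply: sqdist_coord_lt => // l hl.
  have e1 : (y i l < 0) = (y j l < 0).
    by have := congr1 (fun F : {ffun 'I_d -> bool} => F (Ordinal hl)) k1; rewrite !ffunE.
  have e2 : a i l = a j l.
    have m1 : (a i l %% E = a j l %% E)%N.
      have := congr1 (fun F : {ffun 'I_d -> 'I_E} => F (Ordinal hl)) k2.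
      by rewrite !ffunE => /(congr1 val).
    have m2 : (a i l %/ E = a j l %/ E)%N.
      by have := congr1 (fun F => val (tnth F (Ordinal hl))) k3; rewrite !tnth_mktuple.
    by rewrite (divn_eq (a i l) E) (divn_eq (a j l) E) m1 m2.
  have ti i' : (a i' l)%:R * h <= `|y i' l| < (a i' l).+1%:R * h.
    have : 0 <= `|y i' l| / h by rewrite divr_ge0 // ltW.
    by move/truncn_itv; rewrite -/(a i' l) ler_pdivlMr // ltr_pdivrMr.
  have -> : x i l - x j l = y i l - y j l by rewrite /y; ring.
  rewrite ltr_norml; have := ti i; have := ti j; rewrite e2 -natr1 mulrDl mul1r.
  move: e1.
  case: (ltP (y j l) 0) => hj hi.
    by rewrite !ltr0_norm // => /andP[? ?] /andP[? ?]; apply/andP; split; lra.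
  have hi' : 0 <= y i l by rewrite leNgt hi.
  by rewrite !ger0_norm // => /andP[? ?] /andP[? ?]; apply/andP; split; lra.
pose S3 := [set t : d.-tuple 'I_d.+1 | (\sum_(i <- t) i <= d)%N].
pose S := finset.setX [set: {ffun 'I_d -> bool} * {ffun 'I_d -> 'I_E}] S3.
have sub : [set key i | i in 'I_N] \subset S.
  apply/fintype.subsetP => _ /imsetP[i _ ->]; rewrite !inE /=.
  by rewrite big_map big_enum; apply: qsum.
have := subset_leq_card sub.
rewrite card_imset // card_ord /S cardsX cardsT card_prod !card_ffun !card_ord card_bool.
rewrite card_partial_ord_partitions => H; apply: leq_trans H _.
have bin4 : ('C(d + d, d) <= 4 ^ d)%N.
  have -> : (4 ^ d = \sum_(i < (d + d).+1) 'C(d + d, i))%N.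
    have := expnDn 1 1 (d + d); rewrite addn1 addnn -muln2 mulnC expnM => ->.
    by apply: eq_bigr => i _; rewrite !exp1n !muln1.
  by rewrite (bigD1 (inord d)) //= inordK ?leq_addr //; lia.
apply: leq_trans (_ : 2 ^ d * E ^ d * 4 ^ d <= _)%N; first by rewrite leq_mul2l bin4 orbT.
by rewrite -!expnMn; have -> : (2 * E * 4 = 8 * E)%N by lia.
Qed.

Lemma packing_balls (N k E B : nat) (x : 'I_N -> nat -> R) (c : 'I_k -> nat -> R)
    (rho delta : R) :
  (8 * E = B)%N ->
  (0 < d)%N -> (0 < E)%N -> 0 < delta -> rho <= E%:R * delta ->
  (forall i, exists j, dist (x i) (c j) <= rho) ->
  (forall i j, i != j -> delta <= dist (x i) (x j)) -> (N <= k * B ^ d)%N.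
Proof.
move=> <- d0 E0 delta0 rhoE Hc Hs.
have [g Hg] := choice Hc.
have -> : N = (\sum_(j < k) #|[set i | g i == j]|)%N.
  rewrite -[LHS]card_ord -sum1_card (partition_big g xpredT) //=.
  by apply: eq_bigr => j _; rewrite -sum1_card; apply: eq_bigl => i; rewrite inE.
rewrite -[X in (_ <= X * _)%N]card_ord -sum_nat_const; apply: leq_sum => j _.
set A := [set i | g i == j].
apply: (@packing_ball #|A| E (fun i => x (enum_val i)) (c j) rho delta) => //.
- by move=> i; have := enum_valP i; rewrite inE => /eqP <-.
- by move=> i i' hii; apply: Hs; apply: contra hii => /eqP/enum_val_inj ->.
Qed.

(* A separated set inside a box meets every cell of side sep / d at most once. *)
Lemma grid_card (T : finType) (A : {set T}) (x : T -> nat -> R) (lo : nat -> R)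
    (sep : R) (i : 'I_d) (N1 N2 : nat) :
  0 < sep ->
  (forall c c', c \in A -> c' \in A -> c != c' -> sep <= dist (x c) (x c')) ->
  (forall c (l : 'I_d), c \in A -> 0 <= x c l - lo l /\
     (x c l - lo l) * d%:R < (if l == i then N2 else N1)%:R * sep) ->
  (#|A| <= N2 * N1 ^ d.-1)%N.
Proof.
move=> sep0 Hsep Hbox.
have d0 : (0 < d)%N by apply: leq_ltn_trans (ltn_ord i).
have dR : 0 < d%:R :> R by rewrite ltr0n.
set h := sep / d%:R.
have h0 : 0 < h by rewrite divr_gt0.
pose N := maxn N1 N2.
pose B (l : 'I_d) := if l == i then N2 else N1.
pose z c l := Num.truncn ((x c l - lo l) / h).
have zlt c (l : 'I_d) : c \in A -> (z c l < B l)%N.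
  move=> hc; have [h1 h2] := Hbox c l hc.
  rewrite /z truncn_lt_nat; last by rewrite divr_ge0 // ltW.
  rewrite ltr_pdivrMr //.
  by rewrite [h]/(sep / d%:R) mulrA ltr_pdivlMr.
have BN l : (B l <= N)%N by rewrite /B /N; case: ifP => _; lia.
pose key (c : T) : {ffun 'I_d -> 'I_N.+1} := [ffun l : 'I_d => inord (z c l)].
have kv c (l : 'I_d) : c \in A -> key c l = z c l :> nat.
  by move=> hc; rewrite ffunE inordK // ltnS ltnW // (leq_trans (zlt c l hc)).
have kinj : {in A &, injective key}.
  move=> c c' hc hc' e; apply/eqP/negP => /negP hne.
  have := Hsep c c' hc hc' hne; apply/negP; rewrite -ltNge.
  have -> : sep = d%:R * h by rewrite /h mulrCA mulfV ?mulr1 // gt_eqF.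
  apply: dist_coord_lt => // l hl.
  have ez : z c l = z c' l.
    by rewrite -(kv c (Ordinal hl)) // -(kv c' (Ordinal hl)) // e.
  have ti c0 : c0 \in A -> (z c0 l)%:R * h <= x c0 l - lo l < (z c0 l).+1%:R * h.
    move=> hc0; have [h1 _] := Hbox c0 (Ordinal hl) hc0.
    have : 0 <= (x c0 l - lo l) / h by rewrite divr_ge0 // ltW.
    by move/truncn_itv; rewrite -/(z c0 l) ler_pdivlMr // ltr_pdivrMr.
  rewrite ltr_norml; have := ti c hc; have := ti c' hc'; rewrite ez -natr1 mulrDl mul1r.
  by move=> /andP[? ?] /andP[? ?]; apply/andP; split; lra.
have sub : [set key c | c in A] \subset
    [set f | f \in family (fun l : 'I_d => [pred t : 'I_N.+1 | (t < B l)%N])].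
  apply/fintype.subsetP => _ /imsetP[c hc ->]; rewrite inE; apply/familyP => l.
  by rewrite inE kv // zlt.
have := subset_leq_card sub; rewrite card_in_imset // cardsE card_family => H.
apply: leq_trans H _.
have -> : foldr muln 1%N [seq #|[pred t : 'I_N.+1 | (t < B l)%N]| | l : 'I_d] =
   (\prod_(l < d) B l)%N.
  rewrite foldrE big_map /= big_enum /=; apply: eq_bigr => l _.
  have hB : (B l <= N.+1)%N by rewrite leqW.
  have -> : #|[pred t : 'I_N.+1 | (t < B l)%N]| = #|[set widen_ord hB t | t : 'I_(B l)]|.
    apply: eq_card => t; rewrite inE; apply/idP/imsetP => [ht|[t' _ ->]]; last exact: (ltn_ord t').
    by exists (Ordinal ht) => //; apply: val_inj.
  by rewrite card_imset ?card_ord // => t t' /(congr1 val) /= /val_inj.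
rewrite (bigD1 i) //= {1}/B eqxx leq_mul2l; apply/orP; right.
rewrite (eq_bigr (fun=> N1)); last by move=> l /negPf hl; rewrite /B hl.
by rewrite prod_nat_const cardC1 card_ord.
Qed.
End Geometry.

Lemma cntE kap (p : nat -> bool) : cnt kap p = \sum_(c < kap) p c.
Proof.
elim: kap => [|kap IH]; first by rewrite big_ord0.
by rewrite cntS IH big_ord_recr.
Qed.

Lemma cnt_sum kap (p : nat -> bool) n (f : 'I_n -> nat -> bool) :
  (forall c, c < kap -> p c -> exists i, f i c) ->
  cnt kap p <= \sum_(i < n) cnt kap (f i).
Proof.
move=> H; under [X in _ <= X]eq_bigr do rewrite cntE.
rewrite exchange_big cntE /=; apply: leq_sum => c _.
case E: (p c) => //; have [i hi] := H c (ltn_ord c) E.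
by rewrite (bigD1 i) //= hi.
Qed.

Lemma sum_cnt kap (p : nat -> bool) n (f : 'I_n -> nat -> bool) :
  (forall c, c < kap -> \sum_(i < n) f i c <= p c) ->
  \sum_(i < n) cnt kap (f i) <= cnt kap p.
Proof.
move=> H; under eq_bigr do rewrite cntE.
by rewrite exchange_big cntE /=; apply: leq_sum => c _; apply: H.
Qed.

Lemma cnt_gt0 n (p : nat -> bool) : (0 < cnt n p) = hasn n p.
Proof. by rewrite /cnt /hasn has_count. Qed.

Lemma cnt_lt n (p p' : nat -> bool) q : (forall c, c < n -> p c -> p' c) ->
  q < n -> p' q -> ~~ p q -> cnt n p < cnt n p'.
Proof.
move=> H hq h1 h2; rewrite !cntE (bigD1 (Ordinal hq)) //= (negPf h2) add0n.
rewrite [X in _ < X](bigD1 (Ordinal hq)) //= h1 add1n ltnS; apply: leq_sum => c _.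
by case E: (p c) => //; rewrite H.
Qed.

Lemma cnt1 n c : c < n -> cnt n (fun c' => c' == c) = 1.
Proof.
move=> hc; rewrite cntE (bigD1 (Ordinal hc)) //= eqxx big1 // => i /eqP hi.
by case: eqP => // e; case: hi; apply: val_inj.
Qed.

(** * Cuts crossed by few balls *)

Section Completeness.
Variables (m kap Z S : nat) (In Sg cov : nat -> nat -> bool) (F : nat -> bool).
Variable good : (nat -> bool) -> Prop.

Definition touch (B : nat -> bool) c := F c && hasn m (fun q => B q && cov q c).
Definition cross (B : nat -> bool) c := touch B c && touch (fun q => ~~ B q) c.

Hypothesis row_ex : forall B s, good B -> cnt kap s <= S -> exists w,
  [/\ w < Z, forall q, q < m -> In w q = B q & forall c, c < kap -> Sg w c = s c].
Hypothesis S0 : 0 < S.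
Hypothesis cross_le : forall B, good B -> cnt kap (cross B) <= S.
Hypothesis split_ex : forall B, good B -> 0 < cnt m B ->
  (exists c, [/\ c < kap, F c & forall q, q < m -> B q -> cov q c]) \/
  exists B1 B2, [/\ good B1, good B2, 0 < cnt m B1, 0 < cnt m B2 &
    forall q, q < m -> [/\ B1 q || B2 q = B q & ~~ (B1 q && B2 q)]].

Lemma touchP (B : nat -> bool) c : reflect (F c /\ exists q, [/\ q < m, B q & cov q c]) (touch B c).
Proof.
apply: (iffP andP) => [[h1 /hasnP[q hq /andP[h2 h3]]]|[h1 [q [hq h2 h3]]]].
  by split=> //; exists q.
by split=> //; apply/hasnP; exists q; rewrite ?h2.
Qed.

(* F is the set of centers of a solution.  At a split of B into B1 and B2 every
   center serving B is counted once: it lies in the set Sg of one of the three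
   rows, or serves points of B1 only, or serves points of B2 only. *)
Lemma dp_complete j (B : nat -> bool) w : good B -> 0 < cnt m B -> cnt m B <= j -> w < Z ->
  (forall q, q < m -> In w q = B q) -> (forall c, c < kap -> Sg w c = cross B c) ->
  exists2 x, x <= cnt kap (touch B) & bnd m kap Z In Sg cov j w x.
Proof.
elim: j B w => [|j IH] B w gB B0; first by lia.
move=> Bj hw hI hS.
have [[c [hc Fc cc]]|[B1 [B2 [g1 g2 p1 p2 hB]]]] := split_ex gB B0.
  have [|u [hu uI uS]] := row_ex (s := fun c' => c' == c) gB; first by rewrite cnt1.
  have cu : cnt kap (Sg u) = 1 by rewrite (eq_cnt uS) cnt1.
  have lu : leafr m kap In Sg cov u.
    by move=> q hq; rewrite uI // => hBq; exists c; rewrite uS // eqxx; split=> //; apply: cc.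
  have bu : bnd m kap Z In Sg cov j u 1 by rewrite -cu; apply: bnd_leaf.
  eexists; last apply: (bnd_split hw hu hu _ bu bu).
    rewrite cu subnn !addn0; apply: cnt_le => c' hc'.
    rewrite orbb hS // uS // => /orP[/andP[]//|/eqP ->].
    apply/touchP; split=> //; move: B0; rewrite cnt_gt0 => /hasnP[q hq hb].
    by exists q; split=> //; apply: cc.
  by move=> q hq; rewrite hI // uI // => ->.
have sub1 q : q < m -> B1 q -> B q by move=> /hB[<- _] ->.
have sub2 q : q < m -> B2 q -> B q by move=> /hB[<- _] ->; rewrite orbT.
have lt1 : cnt m B1 < cnt m B.
  move: p2; rewrite cnt_gt0 => /hasnP[q hq h2]; apply: (cnt_lt sub1 hq (sub2 q hq h2)).
  by apply/negP => h1; have [_] := hB q hq; rewrite h1 h2.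
have lt2 : cnt m B2 < cnt m B.
  move: p1; rewrite cnt_gt0 => /hasnP[q hq h1]; apply: (cnt_lt sub2 hq (sub1 q hq h1)).
  by apply/negP => h2; have [_] := hB q hq; rewrite h1 h2.
have [u [hu uI uS]] := row_ex g1 (cross_le g1).
have [v [hv vI vS]] := row_ex g2 (cross_le g2).
have [x1 l1 b1] := IH B1 u g1 p1 (leq_trans lt1 Bj) hu uI uS.
have [x2 l2 b2] := IH B2 v g2 p2 (leq_trans lt2 Bj) hv vI vS.
eexists; last apply: (bnd_split hw hu hv _ b1 b2); last first.
  by move=> q hq; rewrite hI // uI // vI //; have [<- _] := hB q hq.
pose InB1 c := touch B1 c && ~~ touch (fun q => ~~ B1 q) c.
pose InB2 c := touch B2 c && ~~ touch (fun q => ~~ B2 q) c.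
have splitC b' : cnt kap (touch b') =
    cnt kap (cross b') + cnt kap (fun c => touch b' c && ~~ touch (fun q => ~~ b' q) c).
  rewrite !cntE -big_split /=; apply: eq_bigr => c _; rewrite /cross.
  by case: (touch b' c); case: (touch (fun q => ~~ b' q) c).
have m1 : x1 - cnt kap (Sg u) <= cnt kap InB1.
  by rewrite (eq_cnt uS) leq_subLR -splitC.
have m2 : x2 - cnt kap (Sg v) <= cnt kap InB2.
  by rewrite (eq_cnt vS) leq_subLR -splitC.
apply: leq_trans (leq_add (leq_add (leqnn _) m1) m2) _.
rewrite !cntE -!big_split /=; apply: leq_sum => c _.
rewrite hS // uS // vS // /InB1 /InB2 /cross.
set o := touch (fun q => ~~ B q) c.
have eB : touch B c = touch B1 c || touch B2 c.
  apply/touchP/orP => [[Fc [q [hq hb hc]]]|].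
    have [e _] := hB q hq; move: hb; rewrite -e => /orP[h1|h2].
      by left; apply/touchP; split=> //; exists q.
    by right; apply/touchP; split=> //; exists q.
  case=> /touchP[Fc [q [hq hb hc]]]; split=> //; exists q; split=> //.
    exact: sub1.
  exact: sub2.
have eN b b' : (forall q, q < m -> [/\ b q || b' q = B q & ~~ (b q && b' q)]) ->
   touch (fun q => ~~ b q) c = touch b' c || o.
  move=> hb; apply/touchP/orP => [[Fc [q [hq nb hc]]]|].
    have [e _] := hb q hq.
    case E: (b' q); first by left; apply/touchP; split=> //; exists q.
    right; apply/touchP; split=> //; exists q; split=> //.
    by rewrite -e E orbF.
  case=> /touchP[Fc [q [hq h1 hc]]]; split=> //; exists q; split=> //.
    by have [_] := hb q hq; rewrite h1 andbT.
  by have [e _] := hb q hq; move: h1; rewrite -e negb_or => /andP[].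
have hB' q : q < m -> [/\ B2 q || B1 q = B q & ~~ (B2 q && B1 q)].
  by move=> /hB; rewrite orbC andbC.
rewrite (eN B1 B2 hB) (eN B2 B1 hB') eB.
by case: (touch B1 c); case: (touch B2 c); case: (o).
Qed.
End Completeness.

Lemma cnt_card kap (p : nat -> bool) : cnt kap p = #|[set c : 'I_kap | p c]|.
Proof.
rewrite cntE -sum1_card [RHS]big_mkcond; apply: eq_bigr => c _.
by rewrite inE; case: (p c).
Qed.

Lemma cntU kap (p q : nat -> bool) :
  cnt kap (fun c => p c || q c) <= cnt kap p + cnt kap q.
Proof. by rewrite -cntUI leq_addr. Qed.

Lemma min_ex (R : realType) m (B : nat -> bool) (f : nat -> R) :
  (exists2 q, q < m & B q) ->
  exists q, [/\ q < m, B q & forall q', q' < m -> B q' -> (f q <= f q')%R].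
Proof.
elim: m => [|m IH] [q]; first by [].
rewrite ltnS leq_eqVlt => hq hB.
have [/hasnP ex|nex] := boolP (hasn m B); last first.
  have eqm q' : q' < m.+1 -> B q' -> q' = m.
    rewrite ltnS leq_eqVlt => /orP[/eqP//|hq'] hb.
    by case/negP: nex; apply/hasnP; exists q'.
  have hq0 : q < m.+1 by rewrite ltnS leq_eqVlt.
  exists q; split=> // q' h1 h2.
  have hq' : q < m.+1 by rewrite ltnS leq_eqVlt.
  by rewrite (eqm q' h1 h2) (eqm q hq' hB).
have [q1 [h1 h2 h3]] := IH ex.
case: (boolP (B m && (f m < f q1)%R)) => [/andP[b1 b2]|].
  exists m; split=> // q'; rewrite ltnS leq_eqVlt => /orP[/eqP -> //|hq'] hb.
  by apply: le_trans (ltW b2) (h3 _ hq' hb).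
rewrite negb_and -leNgt => hn; exists q1; split=> //; first by lia.
move=> q'; rewrite ltnS leq_eqVlt => /orP[/eqP ->|hq'] hb; last exact: h3.
by move: hn; rewrite hb.
Qed.

Lemma slab_disjoint (R : realType) (r x y a b : R) : (0 < r)%R -> (a + 1 <= b)%R ->
  (x - (y + 3 * r * a) <= r)%R -> (- r <= x - (y + 3 * r * b))%R -> False.
Proof.
move=> r0; rewrite -subr_ge0 => /(mulr_ge0 (ltW r0)) h1 h2 h3.
have h4 : (r * (b - (a + 1)) = r * b - r * a - r)%R by ring.
lra.
Qed.

Lemma slab_inside (R : realType) (r x y a b : R) : (0 < r)%R -> (3 * r * b <= x - y)%R ->
  (a + 1 <= b)%R -> (y + 3 * r * a < x)%R.
Proof.
move=> r0 h2; rewrite -subr_ge0 => /(mulr_ge0 (ltW r0)) h1.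
have h4 : (r * (b - (a + 1)) = r * b - r * a - r)%R by ring.
lra.
Qed.

Lemma allnPn n (p : nat -> bool) : ~~ alln n p -> exists2 i, i < n & ~~ p i.
Proof. by move=> /allPn[i]; rewrite mem_iota => hi hp; exists i. Qed.

Section Cuts.
Variables (R : realType) (d m kap k e s0 N : nat) (Qp Kp : nat -> nat -> R).
Variables (F : nat -> bool) (rho sep : R).
Hypotheses (d0 : 0 < d) (e0 : 0 < e) (N0 : 0 < N) (s00 : 0 < s0).
Hypotheses (rho0 : (0 < rho)%R) (sep0 : (0 < sep)%R).
Hypothesis rho_sep : (rho <= (2 * e)%:R * sep)%R.
Hypothesis Fk : cnt kap F <= k.
Hypothesis Fsep : forall c c', c < kap -> c' < kap -> F c -> F c' -> c != c' ->
  (sep <= dist d (Kp c) (Kp c'))%R.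
Hypothesis Nk : k < N.+1 * (d * s0).
Hypothesis Ns0 : (N * d) ^ d.-1 <= s0.

Definition covd q c := (dist d (Qp q) (Kp c) <= rho)%R.
Definition near c l (t : R) := (`|Kp c l - t| <= rho)%R.
Definition cutw := (10 * e) ^ d * d * s0.
Notation touchF := (touch m covd F).

Hypothesis Fcov : forall q, q < m -> exists c, [/\ c < kap, F c & covd q c].

(* If some side of the bounding box of B is long, one of N parallel hyperplanes
   at pairwise distance 3 * rho meets at most k / N of the balls.  Otherwise all
   sides are O(rho * N), and the separated centers near one hyperplane are
   counted with a grid. *)
Lemma cut_ex (B : nat -> bool) q0 q1 l0 : q0 < m -> q1 < m -> l0 < d ->
  B q0 -> B q1 -> (Qp q0 l0 < Qp q1 l0)%R ->
  exists l t, [/\ l < d, exists q, [/\ q < m, B q & (Qp q l <= t)%R],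
    exists q, [/\ q < m, B q & (t < Qp q l)%R] &
    cnt kap (fun c => touchF B c && near c l t) <= cutw].
Proof.
move=> hq0 hq1 hl0 B0 B1 hlt.
have exB : exists2 q, q < m & B q by exists q0.
have [mn Hmn] := choice (fun l => min_ex (fun q => Qp q l) exB).
have [mx Hmx] := choice (fun l => min_ex (fun q => - Qp q l)%R exB).
have hmx l q : q < m -> B q -> (Qp q l <= Qp (mx l) l)%R.
  by move=> hq hb; rewrite -lerN2; have [_ _] := Hmx l; apply.
have cutw_ge : 2 * (d * s0) <= cutw.
  rewrite /cutw -mulnA leq_mul2r; apply/orP; right.
  apply: leq_trans (_ : 10 * e <= _); first by lia.
  by rewrite -{1}(expn1 (10 * e)) leq_pexp2l //; lia.
have [[l hl hW]|nW] := pselect (exists2 l, l < d &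
    (3 * rho * N%:R <= Qp (mx l) l - Qp (mn l) l)%R).
  pose t (j : 'I_N) := (Qp (mn l) l + 3 * rho * j%:R)%R.
  have H : \sum_(j < N) cnt kap (fun c => F c && near c l (t j)) <= cnt kap F.
    apply: sum_cnt => c _; case: (F c) => /=; last by rewrite big1.
    case: (boolP [exists j : 'I_N, near c l (t j)]) => [/existsP[j hj]|]; last first.
      rewrite negb_exists => /forallP nj; rewrite big1 // => j _.
      by rewrite (negPf (nj j)).
    rewrite (bigD1 j) //= hj big1 // => j' hj'; apply/eqP; rewrite eqb0; apply/negP => hn.
    move: hj hn; rewrite /near /t !ler_norml => /andP[h1 h2] /andP[h3 h4].
    have [hlt'|hgt|e1] := ltngtP (j : nat) j'.
    + have : (j%:R + 1 <= j'%:R :> R)%R by rewrite natr1 ler_nat.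
      by move/(slab_disjoint rho0)/(_ h2 h3).
    + have : (j'%:R + 1 <= j%:R :> R)%R by rewrite natr1 ler_nat.
      by move/(slab_disjoint rho0)/(_ h4 h1).
    + by case/eqP: hj'; apply: val_inj.
  have [j hj] : exists j : 'I_N, N * cnt kap (fun c => F c && near c l (t j)) <= k.
    apply/not_existsP => Hn.
    have : \sum_(j < N) k.+1 <= \sum_(j < N) N * cnt kap (fun c => F c && near c l (t j)).
      by apply: leq_sum => j _; rewrite ltnNge; apply/negP; apply: Hn.
    rewrite -big_distrr sum_nat_const card_ord /= => H2.
    have : N * k.+1 <= N * k by apply: leq_trans H2 _; rewrite leq_mul2l (leq_trans H) ?orbT.
    by rewrite leq_pmul2l // ltnn.
  exists l, (t j); split=> //.
  - have [a1 a2 a3] := Hmn l; exists (mn l); split=> //.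
    by rewrite /t lerDl !mulr_ge0 // ltW.
  - have [a1 a2 a3] := Hmx l; exists (mx l); split=> //.
    have : (j%:R + 1 <= N%:R :> R)%R by rewrite natr1 ler_nat ltn_ord.
    exact: slab_inside rho0 hW.
  - apply: leq_trans cutw_ge.
    apply: leq_trans (_ : cnt kap (fun c => F c && near c l (t j)) <= _).
      by apply: cnt_le => c _ /andP[/andP[-> _] ->].
    by nia.
have W l : l < d -> (Qp (mx l) l - Qp (mn l) l < 3 * rho * N%:R)%R.
  by move=> hl; rewrite ltNge; apply/negP => h; apply: nW; exists l.
have [a1 a2 a3] := Hmn l0.
exists l0, (Qp (mn l0) l0); split=> //.
- by exists (mn l0).
- exists q1; split=> //; apply: le_lt_trans hlt; exact: a3.
rewrite cnt_card.
pose lo l := (if l == l0 then Qp (mn l0) l0 - rho else Qp (mn l) l - rho)%R.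
have NR : (1 <= N%:R :> R)%R by rewrite ler1n.
have dR : (1 <= d%:R :> R)%R by rewrite ler1n.
have := @grid_card R d _ [set c : 'I_kap | touchF B c && near c l0 (Qp (mn l0) l0)]
   (fun c => Kp c) lo sep (Ordinal hl0) (10 * e * (N * d)) (5 * e * d) sep0.
move=> H; apply: leq_trans (H _ _) _.
- move=> c c'; rewrite !inE => /andP[/touchP[f1 _] _] /andP[/touchP[f2 _] _] hne.
  exact: Fsep.
- move=> c l; rewrite inE => /andP[/touchP[f1 [q [hq hb hc]]] hn].
  have hcl : (`|Qp q l - Kp c l| <= rho)%R by apply: le_trans (coord_dist _ _ (ltn_ord l)) hc.
  have -> : (l == Ordinal hl0) = (val l == l0) by [].
  have -> : lo l = (Qp (mn l) l - rho)%R by rewrite /lo; case: eqP => // ->.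
  have m1 : (Qp (mn l) l <= Qp q l)%R by have [_ _] := Hmn l; apply.
  have m2 := hmx l q hq hb; have m3 := W l (ltn_ord l).
  move: hcl; rewrite ler_norml => /andP[c1 c2].
  split; first by lra.
  case: eqP => [el|_].
    move: hn; rewrite /near ler_norml -el => /andP[n1 n2].
    apply: le_lt_trans (_ : 2 * rho * d%:R < _)%R.
      by rewrite ler_wpM2r ?ler0n //; lra.
    apply: le_lt_trans (_ : 2 * ((2 * e)%:R * sep) * d%:R < _)%R.
      by rewrite ler_wpM2r ?ler0n // ler_wpM2l.
    rewrite !natrM; have eR : (1 <= e%:R :> R)%R by rewrite ler1n.
    have : (0 < e%:R * d%:R * sep :> R)%R by rewrite !mulr_gt0 //; lra.
    by lra.
  apply: lt_le_trans (_ : (5 * rho * N%:R) * d%:R <= _)%R.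
    rewrite ltr_pM2r ?ltr0n //; apply: lt_le_trans (_ : 3 * rho * N%:R + 2 * rho <= _)%R.
      by lra.
    by nra.
  rewrite !natrM.
  apply: le_trans (_ : (5 * ((2 * e)%:R * sep) * N%:R) * d%:R <= _)%R.
    by rewrite !ler_wpM2r ?ler0n // ler_wpM2l.
  by rewrite natrM; rewrite le_eqVlt; apply/orP; left; apply/eqP; ring.
rewrite expnMn /cutw.
apply: leq_trans (_ : 5 * e * d * ((10 * e) ^ d.-1 * s0) <= _).
  by rewrite !leq_mul2l Ns0 !orbT.
rewrite -[in X in _ <= X](prednK d0) expnS /=.
have : 5 * e <= 10 * e by lia.
by move: ((10 * e) ^ d.-1) => w hw; nia.
Qed.

Definition lo_ok (o : option R) x := if o is Some t then (t < x)%R else true.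
Definition hi_ok (o : option R) x := if o is Some t then (x <= t)%R else true.

(* Boxes all of whose sides were produced by cuts; a ball serving points on both
   sides of the boundary has its center near one of these cuts. *)
Definition boxy (B : nat -> bool) : Prop := (exists2 q, q < m & B q) /\
  exists lo hi : nat -> option R,
    (forall q, q < m -> B q = alln d (fun l => lo_ok (lo l) (Qp q l) && hi_ok (hi l) (Qp q l))) /\
    (forall l t, l < d -> lo l = Some t \/ hi l = Some t ->
       cnt kap (fun c => touchF B c && near c l t) <= cutw).

Lemma boxy_cross B : boxy B -> cnt kap (cross m covd F B) <= 2 * d * cutw.
Proof.
move=> [_ [lo [hi [HB Hf]]]].
pose no (o : option R) c l := if o is Some t then near c l t else false.
pose f (l : 'I_d) c := (touchF B c && no (lo l) c l) || (touchF B c && no (hi l) c l).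
have H : cnt kap (cross m covd F B) <= \sum_(l < d) cnt kap (f l).
  apply: cnt_sum => c _ /andP[ht /touchP[_ [q' [hq' nb hc']]]].
  have /touchP[_ [q [hq hb hc]]] := ht.
  move: nb hb; rewrite !HB // => nb /allnP hb.
  have [l hl hn] : exists2 l, l < d & ~~ (lo_ok (lo l) (Qp q' l) && hi_ok (hi l) (Qp q' l)).
    exact: allnPn nb.
  have := coord_dist (Qp q) (Kp c) hl => /le_trans/(_ hc); rewrite ler_norml => /andP[c1 c2].
  have := coord_dist (Qp q') (Kp c) hl => /le_trans/(_ hc'); rewrite ler_norml => /andP[c3 c4].
  exists (Ordinal hl); rewrite /f /= ht /=.
  have /andP[b1 b2] := hb l hl.
  move: hn b1 b2; rewrite negb_and; case: (lo l) => [t|]; case: (hi l) => [t'|] //=;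
    rewrite ?orbF ?orFb -?ltNge -?leNgt.
  + move=> /orP[h|h] h1 h2; apply/orP; [left|right]; rewrite /near ler_norml; apply/andP; split; lra.
  + move=> h h1 h2; rewrite /near ler_norml; apply/andP; split; lra.
  + move=> h h1 h2; rewrite /near ler_norml; apply/andP; split; lra.
apply: leq_trans H _.
apply: leq_trans (_ : \sum_(l < d) 2 * cutw <= _); last first.
  by rewrite sum_nat_const card_ord mulnA (mulnC d).
apply: leq_sum => l _; apply: leq_trans (cntU _ _ _) _; rewrite mul2n -addnn leq_add //.
  case E: (lo l) => [t|] /=; first by apply: Hf => //; left.
  by rewrite (@eq_cnt _ _ (fun=> false)) ?cntE ?big1 // => c _; rewrite andbF.
case E: (hi l) => [t|] /=; first by apply: Hf => //; right.
by rewrite (@eq_cnt _ _ (fun=> false)) ?cntE ?big1 // => c _; rewrite andbF.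
Qed.

Lemma touch_sub (B B' : nat -> bool) c : (forall q, q < m -> B q -> B' q) ->
  touchF B c -> touchF B' c.
Proof.
move=> H /touchP[h1 [q [hq hb hc]]]; apply/touchP; split=> //; exists q; split=> //.
exact: H.
Qed.

Lemma boxy_split B : boxy B -> 0 < cnt m B ->
  (exists c, [/\ c < kap, F c & forall q, q < m -> B q -> covd q c]) \/
  exists B1 B2, [/\ boxy B1, boxy B2, 0 < cnt m B1, 0 < cnt m B2 &
    forall q, q < m -> [/\ B1 q || B2 q = B q & ~~ (B1 q && B2 q)]].
Proof.
move=> [[q0 hq0 hb0] [lo [hi [HB Hf]]]] _.
have [[q1 [q2 [l0 [[h1 h2 h3] h4 h5 h6]]]]|neq] := pselect (exists q1 q2 l0,
   [/\ [/\ q1 < m, q2 < m & l0 < d], B q1, B q2 & (Qp q1 l0 < Qp q2 l0)%R]); last first.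
  left; have [c [hc Fc cc]] := Fcov hq0; exists c; split=> // q hq hb.
  rewrite /covd (@eq_dist _ _ (Qp q) (Kp c) (Qp q0) (Kp c)) // => l hl.
  apply/eqP; rewrite eq_le !leNgt; apply/andP; split; apply/negP => hlt; apply: neq.
    by exists q0, q, l.
  by exists q, q0, l.
right; have [l [t [hl [qa [qa1 qa2 qa3]] [qb [qb1 qb2 qb3]] hcut]]] :=
  cut_ex h1 h2 h3 h4 h5 h6.
pose B1 q := B q && (Qp q l <= t)%R; pose B2 q := B q && (t < Qp q l)%R.
have s1 q : q < m -> B1 q -> B q by move=> _ /andP[].
have s2 q : q < m -> B2 q -> B q by move=> _ /andP[].
have e1 : B1 qa by rewrite /B1 qa2.
have e2 : B2 qb by rewrite /B2 qb2.
have cmono (B' : nat -> bool) l' t' : (forall q, q < m -> B' q -> B q) ->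
   cnt kap (fun c => touchF B c && near c l' t') <= cutw ->
   cnt kap (fun c => touchF B' c && near c l' t') <= cutw.
  move=> hs; apply: leq_trans; apply: cnt_le => c _ /andP[ht ->].
  by rewrite andbT; apply: touch_sub ht.
exists B1, B2; split.
- split; first by exists qa.
  exists lo, (fun l' => if l' == l then Some t else hi l'); split.
    move=> q hq; rewrite /B1 HB //; apply/andP/allnP => [[/allnP H1 H2] l' hl'|H].
      have /andP[-> H3] /= := H1 l' hl'; by case: eqP => [->|].
    have /andP[_] := H l hl; rewrite eqxx /= => ht; split=> //; apply/allnP => l' hl'.
    have /andP[-> /=] := H l' hl'; case: eqP => [->|//] _.
    have := qb2; rewrite HB // => /allnP/(_ l hl)/andP[_].
    case: (hi l) => //= t'; lra.
  move=> l' t' hl' H; apply: cmono s1 _; move: H; case: eqP => [->|_] H; last exact: Hf.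
  by case: H => [H|[<-]//]; apply: Hf => //; left.
- split; first by exists qb.
  exists (fun l' => if l' == l then Some t else lo l'), hi; split.
    move=> q hq; rewrite /B2 HB //; apply/andP/allnP => [[/allnP H1 H2] l' hl'|H].
      have /andP[H3 ->] /= := H1 l' hl'; rewrite andbT; by case: eqP => [->|].
    have /andP[] := H l hl; rewrite eqxx /= => ht _; split=> //; apply/allnP => l' hl'.
    have /andP[+ ->] := H l' hl'; rewrite andbT; case: eqP => [->|//] _.
    have := qa2; rewrite HB // => /allnP/(_ l hl)/andP[+ _].
    case: (lo l) => //= t'; lra.
  move=> l' t' hl' H; apply: cmono s2 _; move: H; case: eqP => [->|_] H; last exact: Hf.
  by case: H => [[<-]//|H]; apply: Hf => //; right.
- by rewrite cnt_gt0; apply/hasnP; exists qa.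
- by rewrite cnt_gt0; apply/hasnP; exists qb.
- move=> q hq; rewrite /B1 /B2; case: (B q) => //=.
  by case: leP.
Qed.

Lemma boxy_all : 0 < m -> boxy (fun=> true).
Proof.
move=> m0; split; first by exists 0.
exists (fun=> None), (fun=> None); split=> [q hq|l t _ []//].
by symmetry; apply/allnP.
Qed.

(* A nonempty box is the set of points of its bounding box, and the bounds
   are coordinates of points of the box. *)
Lemma boxy_hull B : boxy B -> exists ql qh : nat -> nat,
  [/\ forall l, ql l < m, forall l, qh l < m &
   forall q, q < m -> B q = all (fun l => (Qp (ql l) l <= Qp q l)%R &&
       (Qp q l <= Qp (qh l) l)%R) (iota 0 d)].
Proof.
move=> [exB [lo [hi [HB _]]]].
have [mn Hmn] := choice (fun l => min_ex (fun q => Qp q l) exB).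
have [mx Hmx] := choice (fun l => min_ex (fun q => - Qp q l)%R exB).
exists mn, mx; split; [by move=> l; case: (Hmn l)|by move=> l; case: (Hmx l)|].
move=> q hq; rewrite -/(alln d _); apply/idP/allnP => [hb l hl|H].
  have [_ _ /(_ q hq hb) ->] := Hmn l.
  by have [_ _ /(_ q hq hb)] := Hmx l; rewrite lerN2.
rewrite HB //; apply/allnP => l hl; have /andP[h1 h2] := H l hl.
have [a1 + _] := Hmn l; have [b1 + _] := Hmx l.
rewrite !HB // => /allnP/(_ l hl)/andP[_ h3] /allnP/(_ l hl)/andP[h4 _].
apply/andP; split.
  by case: (lo l) h4 => //= t h4; apply: lt_le_trans h1.
by case: (hi l) h3 => //= t h3; apply: le_trans h3.
Qed.
End Cuts.

Section Costs.
Variables (R : realType) (d : nat).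
Local Open Scope ring_scope.
Implicit Types (C F : seq 'rV[R]_d).

Definition rowfun (x : 'rV[R]_d) (l : nat) : R :=
  if insub l is Some j then x ord0 j else 0.

Lemma rowfunE x (l : 'I_d) : rowfun x l = x ord0 l.
Proof. by rewrite /rowfun valK. Qed.

Lemma enormB x y : enorm (x - y) = dist d (rowfun x) (rowfun y).
Proof.
by congr Num.sqrt; apply: eq_bigr => l _; rewrite !rowfunE !mxE expr2.
Qed.

Lemma coords_nth C p l : (p < size C)%N -> (l < d)%N ->
  nth 0 (coords C) (d * p + l) = rowfun (nth 0 C p) l.
Proof.
elim: C p => [//|x C IH] p /=; rewrite /coords /= nth_cat size_map size_enum_ord.
case: p => [_ hl|p hp hl].
  rewrite muln0 add0n hl (nth_map (Ordinal hl)) ?size_enum_ord //.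
  have -> : rowfun x l = x ord0 (Ordinal hl) by rewrite -rowfunE.
  by congr (x _ _); apply: val_inj; rewrite /= nth_enum_ord.
have -> : (d * p.+1 + l < d)%N = false by rewrite mulnS; lia.
have -> : (d * p.+1 + l - d = d * p + l)%N by rewrite mulnS; lia.
exact: IH.
Qed.

Lemma dist_to_le F x (t : R) : (0 < size F)%N ->
  (dist_to F x <= t) <-> exists2 c, c \in F & enorm (x - c) <= t.
Proof.
case: F => [//|c0 F] _; rewrite /dist_to /=; split=> [|[c hc]]; last first.
  by move=> h; apply: bigmin_inf_seq hc _ h.
set r := c0 :: F; move=> H.
have : exists2 c, c \in c0 :: r & enorm (x - c) <= t.
  move: H; elim: r => [|c r IH].
    by rewrite big_nil; exists c0; rewrite ?inE ?eqxx.
  rewrite big_cons ge_min => /orP[h|/IH[c' hc' h]].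
    by exists c; rewrite ?inE ?eqxx ?orbT.
  by exists c' => //; move: hc'; rewrite !inE => /orP[->|->]; rewrite ?orbT.
by move=> [c hc h]; exists c => //; move: hc; rewrite /r !inE orbA orbb.
Qed.

Lemma cost_ge0 C F : 0 <= kcenter_cost C F.
Proof. by rewrite /kcenter_cost; apply: bigmax_ge_id. Qed.

Lemma kcenter_cost_le C F (t : R) : 0 <= t -> (0 < size F)%N ->
  kcenter_cost C F <= t <->
  forall x, x \in C -> exists2 c, c \in F & enorm (x - c) <= t.
Proof.
move=> t0 F0; split=> [H x hx|H].
  apply/(dist_to_le _ _ F0); apply: le_trans H.
  exact: le_bigmax_seq hx _.
rewrite /kcenter_cost big_seq; apply: bigmax_le => // x hx.
by apply/(dist_to_le _ _ F0); apply: H.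
Qed.

Lemma opt_le C k F : kcenter_feasible R d k F -> kcenter_opt C k <= kcenter_cost C F.
Proof.
move=> hF; apply: ge_inf; last by exists F.
by exists 0 => _ [F' _ <-]; apply: cost_ge0.
Qed.

Lemma opt_ge0 C k : 0 <= kcenter_opt C k.
Proof.
rewrite /kcenter_opt; set E := [set _ | _ in _]%classic.
have [->|/set0P hE] := eqVneq E set0; first by rewrite inf0.
by apply: lb_le_inf => // _ [F' _ <-]; apply: cost_ge0.
Qed.

Lemma opt_lt C k F (t : R) : kcenter_feasible R d k F -> kcenter_opt C k < t ->
  exists2 F', kcenter_feasible R d k F' & kcenter_cost C F' <= t.
Proof.
move=> hF ht; have t0 : 0 < t - kcenter_opt C k by rewrite subr_gt0.
have [|_ [F' hF' <-] h] := inf_adherent t0 (E := [set kcenter_cost C F | F in kcenter_feasible R d k]%classic).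
  split; first by exists (kcenter_cost C F), F.
  by exists 0 => _ [F' _ <-]; apply: cost_ge0.
by exists F' => //; move: h; rewrite -/(kcenter_opt C k) addrC subrK => /ltW.
Qed.

Lemma thinning (T : Type) (x : T -> nat -> R) (sep : R) (L : seq nat) (pt : nat -> T) :
  0 < sep -> exists L', [/\ {subset L' <= L}, (size L' <= size L)%N,
   forall c c', c \in L' -> c' \in L' -> c != c' -> sep <= dist d (x (pt c)) (x (pt c')) &
   forall c, c \in L -> exists2 c', c' \in L' & dist d (x (pt c)) (x (pt c')) < sep].
Proof.
move=> sep0; elim: L => [|c L [L' [h1 h2 h3 h4]]]; first by exists [::].
have [[c' hc' hlt]|nex] := pselect (exists2 c', c' \in L' & dist d (x (pt c)) (x (pt c')) < sep).
  exists L'; split=> //; first by move=> a /h1 ha; rewrite inE ha orbT.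
    exact: leqW.
  by move=> a; rewrite inE => /orP[/eqP ->|/h4]; first by exists c'.
have hsep c' : c' \in L' -> sep <= dist d (x (pt c)) (x (pt c')).
  by move=> hc'; rewrite leNgt; apply/negP => h; apply: nex; exists c'.
exists (c :: L'); split=> //.
- by move=> a; rewrite !inE => /orP[->//|/h1 ->]; rewrite orbT.
- move=> a a'; rewrite !inE => /orP[/eqP ->|ha] /orP[/eqP ->|ha'].
  + by rewrite eqxx.
  + by move=> _; apply: hsep.
  + by move=> _; rewrite distC; apply: hsep.
  + exact: h3.
- move=> a; rewrite inE => /orP[/eqP ->|/h4[c' hc' h]].
    by exists c; rewrite ?inE ?eqxx // distxx.
  by exists c' => //; rewrite inE hc' orbT.
Qed.
End Costs.

Section Feasible.
Variables (R : realType) (d e M Zc m k kap s0 nb S Z : nat).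
Variables (KQ : nat -> nat) (KZ : nat -> nat -> nat) (In Sg : nat -> nat -> bool).
Variables (Qp : nat -> nat -> R) (eta rho sep : R) (F : nat -> bool).
Let Kp c l := (Qp (KQ c) l + eta * ((KZ c l)%:R - Zc%:R))%R.
Hypotheses (d0 : 0 < d) (e0 : 0 < e) (m0 : 0 < m) (s00 : 0 < s0) (k0 : 0 < k).
Hypotheses (rho0 : (0 < rho)%R) (sep0 : (0 < sep)%R).
Hypothesis rho_sep : (rho <= (2 * e)%:R * sep)%R.
Hypothesis Fk : cnt kap F <= k.
Hypothesis Fsep : forall c c', c < kap -> c' < kap -> F c -> F c' -> c != c' ->
  (sep <= dist d (Kp c) (Kp c'))%R.
Hypothesis Fcov : forall q, q < m -> exists c, [/\ c < kap, F c & covd d Qp Kp rho q c].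
Hypothesis HM : M = 2 * d * ((10 * e) ^ d * d).
Hypothesis Kself : forall q, q < m -> exists2 c, c < kap &
  KQ c = q /\ forall l, l < d -> KZ c l = Zc.
Hypothesis s0k : k ^ d.-1 <= s0 ^ d.
Hypothesis HS : if k <= M * s0 then S = k /\ nb = 0 else S = M * s0 /\ nb = d.
Hypothesis Hrows : forall (lo hi : nat -> nat) (s : seq nat),
  (forall i, i < nb -> lo i < kap) -> (forall i, i < nb -> hi i < kap) ->
  size s <= S -> all (fun c => c < kap) s ->
  exists w, [/\ w < Z,
    forall q, q < m -> In w q = all (fun i => (Kp (lo i) i <= Qp q i)%R &&
            (Qp q i <= Kp (hi i) i)%R) (iota 0 nb) &
    forall c, c < kap -> Sg w c = (c \in s)].

Lemma feas_rows : exists w x, [/\ w < Z, forall q, q < m -> In w q, x <= k &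
  bnd m kap Z In Sg (covd d Qp Kp rho) m w x].
Proof.
have filt (s : nat -> bool) : size [seq c <- iota 0 kap | s c] = cnt kap s /\
   all (fun c => c < kap) [seq c <- iota 0 kap | s c] /\
   forall c, c < kap -> (c \in [seq c <- iota 0 kap | s c]) = s c.
  split; first by rewrite size_filter.
  split; first by apply/allP => c; rewrite mem_filter mem_iota => /andP[].
  by move=> c hc; rewrite mem_filter mem_iota /= add0n hc andbT.
move: HS; case: leqP => hk [eS enb].
  have [f1 [f2 f3]] := filt F.
  have [||||w [hw hI hSg]] := @Hrows (fun=> 0) (fun=> 0) [seq c <- iota 0 kap | F c].
  - by rewrite enb.
  - by rewrite enb.
  - by rewrite f1 eS.
  - by [].
  have eSg : cnt kap (Sg w) = cnt kap F by apply: eq_cnt => c hc; rewrite hSg // f3.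
  exists w, (cnt kap (Sg w)); split=> //.
  - by move=> q hq; rewrite hI // enb.
  - by rewrite eSg.
  - apply: bnd_leaf => // q hq _; have [c [c1 c2 c3]] := Fcov hq.
    by exists c; rewrite hSg // f3.
pose N := k %/ (d * s0).
have ds0 : 0 < d * s0 by rewrite muln_gt0 d0.
have w0 : 0 < (10 * e) ^ d * d by rewrite muln_gt0 expn_gt0 d0 andbT; lia.
have N0 : 0 < N.
  rewrite divn_gt0 //; apply: leq_trans (ltnW hk); rewrite HM leq_pmul2r //.
  by move: ((10 * e) ^ d * d) w0 => w w0; nia.
have Nk : k < N.+1 * (d * s0) by rewrite -ltn_divLR.
have Ns0 : (N * d) ^ d.-1 <= s0.
  have h1 : N * d * s0 <= k by rewrite -mulnA; apply: leq_divM.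
  have h2 : (N * d) ^ d.-1 * s0 ^ d.-1 <= s0 * s0 ^ d.-1.
    rewrite -expnMn -expnS prednK //; apply: leq_trans s0k.
    by case: (d.-1) => [|d1]; rewrite ?expn0 // leq_exp2r.
  by rewrite -(leq_pmul2r (m := s0 ^ d.-1)) // expn_gt0 s00.
have Fcov' : forall q, q < m -> exists c, [/\ c < kap, F c & covd d Qp Kp rho q c] by [].
pose good := boxy d m kap e s0 Qp Kp F rho.
have S0 : 0 < S by rewrite eS muln_gt0 s00 HM; lia.
have rowx B s : good B -> cnt kap s <= S -> exists w,
  [/\ w < Z, forall q, q < m -> In w q = B q & forall c, c < kap -> Sg w c = s c].
  move=> gB hs; have [ql [qh [b1 b2 b3]]] := boxy_hull gB.
  have [cl Hcl] := choice (fun l => let: ex_intro2 c h1 h2 := Kself (b1 l) in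
     ex_intro (fun c => c < kap /\ (KQ c = ql l /\ forall l, l < d -> KZ c l = Zc)) c (conj h1 h2)).
  have [ch Hch] := choice (fun l => let: ex_intro2 c h1 h2 := Kself (b2 l) in
     ex_intro (fun c => c < kap /\ (KQ c = qh l /\ forall l, l < d -> KZ c l = Zc)) c (conj h1 h2)).
  have [f1 [f2 f3]] := filt s.
  have [||||w [hw hI hSg]] := @Hrows cl ch [seq c <- iota 0 kap | s c].
  - by move=> i _; case: (Hcl i).
  - by move=> i _; case: (Hch i).
  - by rewrite f1.
  - by [].
  exists w; split=> // [q hq|c hc]; last by rewrite hSg // f3.
  rewrite hI // b3 // enb; apply: eq_in_all => l; rewrite mem_iota add0n => /andP[_ hl].
  have [_ [k1 k2]] := Hcl l; have [_ [k3 k4]] := Hch l.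
  by rewrite /Kp k1 k2 // k3 k4 // !subrr !mulr0 !addr0.
have cr B : good B -> cnt kap (cross m (covd d Qp Kp rho) F B) <= S.
  move=> gB; apply: leq_trans (boxy_cross gB) _.
  by rewrite eS HM /cutw; lia.
have gall : good (fun=> true) by apply: boxy_all.
have [w [hw hI hSg]] := rowx _ _ gall (cr _ gall).
have mm : cnt m (fun=> true) = m by rewrite /cnt count_predT size_iota.
have [|||x hx hb] := @dp_complete m kap Z S In Sg (covd d Qp Kp rho) F good rowx S0 cr _ m _ w gall _ _ hw hI hSg.
- move=> B gB B0; exact: (boxy_split d0 e0 N0 s00 rho0 sep0 rho_sep Fk Fsep Nk Ns0 Fcov gB B0).
- by rewrite mm.
- by rewrite mm.
exists w, x; split=> //.
apply: leq_trans hx (leq_trans _ Fk); apply: cnt_le => c _ /andP[] //.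
Qed.
End Feasible.

(** * The approximation guarantee *)

Definition coreset_size (d e : nat) : nat := (16 * e) ^ d.
Definition cut_size (d e : nat) : nat := 2 * d * ((10 * e) ^ d * d).

Fact jj_range e i : e <= i -> 4 * e - i <= 3 * e. Proof. lia. Qed.
Fact sqr_2e e : (2 * e) ^ 2 = 4 * e * e. Proof. lia. Qed.
Fact lattice_range e d : 2 * (e * d) <= 3 * e * d. Proof. nia. Qed.
Fact leq_2n n : n <= 2 * n. Proof. lia. Qed.

Section Approximation.
Variables (R : realType) (d e k : nat) (C : seq 'rV[R]_d).
Notation n := (size C).
Notation D := (coreset_size d e).
Notation M := (cut_size d e).
Notation Zc := (3 * e * d).
Notation X := (fun a => nth 0%R (coords C) a).
Notation P := (ptX d X).
Notation opt := (kcenter_opt C k).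
Hypotheses (d0 : 0 < d) (e16 : 16 <= e) (k0 : 0 < k) (kn : k < n) (uC : uniq C).

Lemma ptP p l : p < n -> l < d -> P p l = rowfun (nth 0%R C p) l.
Proof. exact: coords_nth. Qed.

Lemma distPP p q : p < n -> q < n ->
  dist d (P p) (P q) = enorm (nth 0%R C p - nth 0%R C q).
Proof. by move=> hp hq; rewrite enormB; apply: eq_dist => l hl; rewrite ptP. Qed.

Lemma rowfun_inj (x y : 'rV[R]_d) : dist d (rowfun x) (rowfun y) = 0%R -> x = y.
Proof.
move=> h; apply/rowP => j; have := coord_dist (rowfun x) (rowfun y) (ltn_ord j).
by rewrite h normr_le0 subr_eq0 !rowfunE => /eqP.
Qed.

Section Run.
Variables (q : nat -> nat) (r2 : R).
Hypothesis Hgz : gz n k d P q r2 (D * k).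
Let r := Num.sqrt r2.

Let e0 : 0 < e. Proof. exact: leq_trans e16. Qed.
Let D0 : 0 < D. Proof. by rewrite expn_gt0 muln_gt0 e0. Qed.
Let kD : k <= D * k. Proof. by rewrite leq_pmull. Qed.
Let qn j : j <= D * k -> q j < n. Proof. by case: Hgz => H _ _ _; apply: H. Qed.

Let r20 : (0 <= r2)%R.
Proof.
case: Hgz => _ _ H _; have [j _ hj] := H kD 0 (leq_ltn_trans (leq0n k) kn).
exact: le_trans (sqdist_ge0 _ _ _) hj.
Qed.

Let cov_r p : p < n -> exists2 j, j < k & (dist d (P p) (P (q j)) <= r)%R.
Proof.
move=> hp; case: Hgz => _ _ H _; have [j hj hj'] := H kD p hp.
by exists j => //; apply: ler_wsqrtr.
Qed.

Let sep_r i j : i < j -> j <= k -> (r <= dist d (P (q i)) (P (q j)))%R.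
Proof. by move=> hi hj; case: Hgz => _ _ _ H; apply: ler_wsqrtr; apply: H. Qed.

Let r0 : (0 < r)%R.
Proof.
rewrite lt_neqAle sqrtr_ge0 andbT; apply/negP => /eqP r00.
have Hf (p : 'I_n) : exists j : 'I_k, dist d (P p) (P (q j)) = 0%R.
  have [j hj h] := cov_r (ltn_ord p); exists (Ordinal hj).
  by rewrite -r00 in h; apply/eqP; rewrite eq_le dist_ge0 andbT; exact: h.
have [g Hg] := choice Hf.
have : injective g.
  move=> p p' e1; apply: val_inj; apply/eqP => /=.
  have qjn : q (g p) < n by apply: qn; apply: leq_trans kD; apply: ltnW.
  rewrite -(nth_uniq 0%R _ _ uC) //; apply/eqP.
  have h1 := Hg p; have h2 := Hg p'; rewrite -e1 in h2.
  rewrite distPP // enormB in h1; rewrite distPP // enormB in h2.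
  by rewrite (rowfun_inj h1) (rowfun_inj h2).
by move/leq_card; rewrite !card_ord leqNgt kn.
Qed.

Let F0 := [seq nth 0%R C (q j) | j <- iota 0 k].

Let F0_feas : kcenter_feasible R d k F0.
Proof.
split; last by rewrite size_map size_iota.
rewrite map_inj_in_uniq ?iota_uniq // => i j; rewrite !mem_iota !add0n => /andP[_ hi] /andP[_ hj] e1.
apply/eqP; apply/negPn/negP => hij.
wlog lt : i j hi hj e1 hij / i < j.
  move=> H; case: (ltngtP i j) hij => // h _; first by apply: (H i j) => //; rewrite ltn_eqF.
  by apply: (H j i) => //; rewrite ltn_eqF.
have := sep_r lt (ltnW hj); rewrite distPP ?qn //; try (by apply: leq_trans kD; apply: ltnW).
by rewrite e1 enormB distxx leNgt r0.
Qed.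

Let opt_r : (opt <= r)%R.
Proof.
apply: le_trans (opt_le C F0_feas) _; apply/kcenter_cost_le.
- exact: sqrtr_ge0.
- by rewrite size_map size_iota.
move=> x hx; have hp : index x C < n by rewrite index_mem.
have [j hj h] := cov_r hp; exists (nth 0%R C (q j)).
  by apply/mapP; exists j => //; rewrite mem_iota.
rewrite -[x in (x - _)%R](nth_index 0%R hx) -distPP // qn //.
by apply: leq_trans kD; apply: ltnW.
Qed.

Let r_opt : (r <= 2 * opt)%R.
Proof.
apply/ler_addgt0Pr => t t0.
have t20 : (0 < t / 2)%R by rewrite divr_gt0.
have [|F1 [uF sF] cF] := opt_lt (C := C) (t := (opt + t / 2)%R) F0_feas; first by rewrite ltrDl.
have o0 := opt_ge0 C k.
have F10 : 0 < size F1 by rewrite sF.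
have t2 : (0 <= opt + t / 2)%R by rewrite addr_ge0 // ltW.
have Hc := (kcenter_cost_le C t2 F10).1 cF.
have Hf (i : 'I_k.+1) : exists j : 'I_k, (dist d (P (q i)) (rowfun (nth 0%R F1 j)) <= opt + t / 2)%R.
  have qi : q i < n by apply: qn; apply: leq_trans kD; rewrite -ltnS.
  have [|c hc h] := Hc (nth 0%R C (q i)); first by rewrite mem_nth.
  have hi : index c F1 < k by rewrite -sF index_mem.
  exists (Ordinal hi); rewrite /= nth_index //; apply: le_trans h; rewrite enormB.
  by rewrite le_eqVlt; apply/orP; left; apply/eqP; apply: eq_dist => l hl; rewrite ?ptP.
have [g Hg] := choice Hf.
have : ~ injective g by move=> /leq_card; rewrite !card_ord ltnn.
move=> ninj.
have [i [j [lt e1]]] : exists i j : 'I_k.+1, i < j /\ g i = g j.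
  apply: contrapT => hn; apply: ninj => i j e1; apply/eqP/negPn/negP => hij.
  case: (ltngtP i j) => h; last by case/eqP: hij; apply: val_inj.
    by apply: hn; exists i, j.
  by apply: hn; exists j, i.
apply: le_trans (sep_r lt _) _; first by rewrite -ltnS.
apply: le_trans (dist_triangle _ _ (rowfun (nth 0%R F1 (g i))) _) _.
have h1 := Hg i; have h2 := Hg j; rewrite -e1 distC in h2.
by apply: le_trans (lerD h1 h2) _; lra.
Qed.

Let opt0 : (0 < opt)%R. Proof. have := r0; have := r_opt; lra. Qed.

Let eR : (16 <= e%:R :> R)%R. Proof. by rewrite (ler_nat R 16). Qed.
Let e0R : (0 < e%:R :> R)%R. Proof. by have := eR; lra. Qed.
Let rad := (opt + opt / e%:R)%R.

Let re0 : (0 < r / e%:R)%R. Proof. by rewrite divr_gt0. Qed.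

Let opt_e : (opt / e%:R <= r / e%:R)%R.
Proof. by rewrite ler_pM2r // invr_gt0. Qed.
Let r_e : (r / e%:R <= 2 * (opt / e%:R))%R.
Proof. by rewrite mulrA ler_pM2r // invr_gt0. Qed.
Let re_small : (16 * (r / e%:R) <= r)%R.
Proof. by rewrite mulrA ler_pdivrMr // mulrC ler_pM2l. Qed.

Let Fopt : exists2 F1, kcenter_feasible R d k F1 & forall x, x \in C ->
  exists2 c, c \in F1 & (dist d (rowfun x) (rowfun c) <= rad)%R.
Proof.
have [|F1 hF cF] := opt_lt (C := C) (t := rad) F0_feas; first by rewrite ltrDl divr_gt0.
exists F1 => //; have F10 : 0 < size F1 by case: hF => _ ->.
have rad0 : (0 <= rad)%R by rewrite addr_ge0 ?divr_ge0 // ltW.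
move=> x hx; have [c hc h] := (kcenter_cost_le C rad0 F10).1 cF x hx.
by exists c => //; rewrite -enormB.
Qed.

Let coreset p : p < n -> exists2 j, j <= D * k & (dist d (P p) (P (q j)) < r / e%:R)%R.
Proof.
move=> hp; case: Hgz => _ H _ _; have [j hj Hj] := H p hp; exists j => //.
rewrite ltNge; apply/negP => hge.
have [F1 [uF sF] cF] := Fopt.
have e8 : 8 * (2 * e) = 16 * e by rewrite mulnA.
have := @packing_balls R d (D * k).+1 k (2 * e) (16 * e) (fun i => P (q i))
   (fun j => rowfun (nth 0%R F1 j)) rad (r / e%:R) e8 d0 _ re0.
rewrite -/D [k * _]mulnC ltnn => Hp; suff: false by [].
apply: Hp => //.
- by rewrite muln_gt0 e0.
- rewrite natrM -mulrA mulrCA mulrC mulrA mulfVK ?gt_eqF // /rad.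
  by have := opt_e; have := re_small; have := opt_r; have := r0; lra.
- move=> i; have qi : q i < n by apply: qn; rewrite -ltnS.
  have [|c hc h] := cF (nth 0%R C (q i)); first by rewrite mem_nth.
  have hi : index c F1 < k by rewrite -sF index_mem.
  exists (Ordinal hi); rewrite /= nth_index //; apply: le_trans h.
  by rewrite le_eqVlt; apply/orP; left; apply/eqP; apply: eq_dist => l hl; rewrite ?ptP.
- have Hs (a b : nat) : a < b -> b <= D * k -> (r / e%:R <= dist d (P (q a)) (P (q b)))%R.
    by move=> h1 h2; apply: le_trans hge _; apply: ler_wsqrtr; apply: Hj.
  move=> a b; rewrite neq_ltn => /orP[h|h]; first by apply: Hs => //; rewrite -ltnS.
  by rewrite distC; apply: Hs => //; rewrite -ltnS.
Qed.

Variables (f : nat) (out : nat -> nat -> R).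
Hypothesis Hst : st2 d e M Zc (D * k).+1 k (fun j => P (q j)) r2 f out.

Lemma approx_main : f <= k /\ forall p, p < n -> exists2 j, j < f &
  (dist d (P p) (out j) <= (1 + 8 / e%:R) * opt)%R.
Proof.
have Hst' := Hst; move: Hst'; set m := (D * k).+1 => Hst'.
pose kap := m * (2 * Zc).+2 ^ d.
have [KQ [KZ [s0 [nb [S [Z [In [Sg [HKQ HKex [s00 s0k HS] Hrows Hfin]]]]]]]]] := Hst'.
pose Qp j := P (q j).
pose Kp c l := (Qp (KQ c) l + r / (e * d)%:R * ((KZ c l)%:R - Zc%:R))%R.
have [F1 [uF sF] cF] := Fopt.
have dR : (1 <= d%:R :> R)%R by rewrite ler1n.
have ed0 : (0 < (e * d)%:R :> R)%R by rewrite ltr0n muln_gt0 e0.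
have eta0 : (0 < r / (e * d)%:R)%R by rewrite divr_gt0.
have rad2 : (rad <= 2 * r)%R.
  by rewrite /rad; have := opt_e; have := re_small; have := opt_r; have := r0; lra.
have vfP j : j < m -> forall l, l < d -> Qp j l = rowfun (nth 0%R C (q j)) l.
  by move=> hj l hl; rewrite /Qp ptP // qn // -ltnS.
pose touching (c : 'rV[R]_d) := `[< exists2 j, j < m & (dist d (Qp j) (rowfun c) <= rad)%R >].
have lattice c : touching c -> exists2 a, a < kap & (dist d (rowfun c) (Kp a) <= r / e%:R)%R.
  move=> /asboolP[j hj hd].
  pose t l := ((rowfun c l - Qp j l) / (r / (e * d)%:R) + Zc%:R)%R.
  have tb l : l < d -> (0 <= t l)%R /\ (t l <= (2 * Zc)%:R)%R.
    move=> hl; have := le_trans (coord_dist (Qp j) (rowfun c) hl) hd.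
    move=> /le_trans/(_ rad2); rewrite ler_norml => /andP[h1 h2].
    have h3 : (2 * r = (2 * (e * d))%:R * (r / (e * d)%:R) :> R)%R.
      by rewrite natrM -mulrA [((e * d)%:R * _)%R]mulrC mulfVK ?gt_eqF.
    have h4 : (- (2 * (e * d))%:R <= (rowfun c l - Qp j l) / (r / (e * d)%:R))%R.
      by rewrite ler_pdivlMr // mulNr -h3; lra.
    have h5 : ((rowfun c l - Qp j l) / (r / (e * d)%:R) <= (2 * (e * d))%:R)%R.
      by rewrite ler_pdivrMr // -h3; lra.
    have h6 : ((2 * (e * d))%:R <= Zc%:R :> R)%R by rewrite ler_nat lattice_range.
    have h7 : ((2 * Zc)%:R = Zc%:R + Zc%:R :> R)%R by rewrite mul2n -addnn natrD.
    by rewrite /t h7; split; lra.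
  have [|a ha [a1 a2]] := HKex j (fun l => Num.truncn (t l)) hj.
    move=> l hl; have [t1 t2] := tb l hl.
    by rewrite -(ler_nat R) (le_trans _ t2) // truncn_le.
  exists a => //; apply: le_trans (_ : d%:R * (r / (e * d)%:R) <= _)%R; last first.
    have dn0 : (d%:R != 0 :> R)%R by rewrite pnatr_eq0 -lt0n.
    by rewrite natrM invfM mulrCA [X in (_ * X)%R]mulrCA mulfV ?mulr1.
  apply: dist_coord_le => //; first exact: ltW.
  move=> l hl; have [t1 t2] := tb l hl.
  have -> : (rowfun c l - Kp a l = (t l - (Num.truncn (t l))%:R) * (r / (e * d)%:R))%R.
    rewrite /Kp a1 a2 //; move: (Num.truncn (t l)) => T; rewrite /t.
    move: (r / (e * d)%:R)%R eta0 => eta eta0.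
    have -> : (rowfun c l - Qp j l = eta * ((rowfun c l - Qp j l) / eta))%R.
      by rewrite mulrC mulfVK ?gt_eqF.
    move: ((rowfun c l - Qp j l) / eta)%R (mulfVK (lt0r_neq0 eta0) (rowfun c l - Qp j l)%R) => w hw.
    rewrite mulrC in hw.
    have -> : rowfun c l = (Qp j l + eta * w)%R by rewrite hw addrC subrK.
    by rewrite [(eta * w)%R]mulrC mulfK ?lt0r_neq0 //; ring.
  rewrite normrM (gtr0_norm eta0) -{2}[(r / _)%R]mul1r ler_pM2r //.
  have /andP[u1 u2] := truncn_itv t1; rewrite -natr1 in u2.
  by rewrite ler_norml; apply/andP; split; lra.
have [g Hg] : exists g : 'rV[R]_d -> nat, forall c, touching c ->
    g c < kap /\ (dist d (rowfun c) (Kp (g c)) <= r / e%:R)%R.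
  have H c : exists a, touching c -> a < kap /\ (dist d (rowfun c) (Kp a) <= r / e%:R)%R.
    case: (boolP (touching c)) => [/lattice[a h1 h2]|_]; last by exists 0.
    by exists a.
  by have [g Hg] := choice H; exists g.
pose L := [seq g c | c <- F1 & touching c].
have [L' [L1 L2 L3 L4]] := @thinning R d nat Kp (r / e%:R)%R L id re0.
have L'kap c : c \in L' -> c < kap.
  by move=> /L1/mapP[c' hc' ->]; move: hc'; rewrite mem_filter => /andP[/Hg[]].
pose F c := c \in L'.
have Fk : cnt kap F <= k.
  have -> : cnt kap F = size [seq c <- iota 0 kap | c \in L'] by rewrite size_filter.
  apply: leq_trans (_ : size L' <= _); last first.
    apply: leq_trans L2 _; rewrite size_map size_filter -sF; exact: count_size.
  apply: uniq_leq_size; first by rewrite filter_uniq // iota_uniq.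
  by move=> c; rewrite mem_filter => /andP[].
pose rhos := (rad + 2 * (r / e%:R))%R.
have Fcovs j : j < m -> exists c, [/\ c < kap, F c & (dist d (Qp j) (Kp c) <= rhos)%R].
  move=> hj; have qj : q j < n by apply: qn; rewrite -ltnS.
  have [|c hc h] := cF (nth 0%R C (q j)); first by rewrite mem_nth.
  have hd : (dist d (Qp j) (rowfun c) <= rad)%R.
    by rewrite (eq_dist (f' := rowfun (nth 0%R C (q j))) (g' := rowfun c) (vfP j hj)).
  have ht : touching c by apply/asboolP; exists j.
  have [g1 g2] := Hg c ht.
  have [|c' hc' h'] := L4 (g c); first by apply: map_f; rewrite mem_filter ht.
  exists c'; split=> //; first exact: L'kap.
  apply: le_trans (dist_triangle _ _ (rowfun c) _) _.
  apply: le_trans (lerD hd (dist_triangle _ _ (Kp (g c)) _)) _.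
  by rewrite /rhos; have := ltW h'; lra.
pose i := (Num.truncn ((2 * e)%:R * rhos / r)).+1.
have rhos_lo : (r <= 2 * rhos)%R.
  by rewrite /rhos /rad; have := r_opt; have := re0; have := divr_gt0 opt0 e0R; lra.
have rhos_hi : (rhos <= r + 3 * (r / e%:R))%R.
  by rewrite /rhos /rad; have := opt_e; have := opt_r; lra.
have tr0 : (0 <= (2 * e)%:R * rhos / r)%R.
  by rewrite divr_ge0 ?(ltW r0) // mulr_ge0 ?ler0n //; have := r0; lra.
have /andP[i1 i2] := truncn_itv tr0.
have ie : e <= i.
  rewrite /i leqW // truncn_ge_nat // ler_pdivlMr // natrM.
  by have := ler_wpM2l (ltW e0R) rhos_lo; lra.
have i4 : i <= 4 * e.
  rewrite /i truncn_lt_nat // ltr_pdivrMr //.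
  have -> : ((4 * e)%:R * r = (2 * e)%:R * (2 * r))%R by rewrite !natrM; ring.
  rewrite ltr_pM2l; last by rewrite ltr0n muln_gt0 e0.
  by have := rhos_hi; have := re_small; have := r0; lra.
have e20 : (0 < (2 * e)%:R :> R)%R by rewrite ltr0n muln_gt0 e0.
pose jj := 4 * e - i.
have hjj : jj <= 3 * e by apply: jj_range.
pose rho := (r * i%:R / (2 * e)%:R)%R.
have rho_s : (rhos <= rho)%R.
  have h := i2; rewrite ltr_pdivrMr // in h.
  by rewrite /rho ler_pdivlMr // mulrC [X in (_ <= X)%R]mulrC ltW.
have rho_le : (rho <= rhos + r / (2 * e)%:R)%R.
  have h := i1; rewrite ler_pdivlMr // in h.
  rewrite /rho ler_pdivrMr // mulrDl mulfVK ?gt_eqF // /i -natr1 mulrDr mulr1 lerD2r.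
  by rewrite mulrC [X in (_ <= X)%R]mulrC.
have rho0 : (0 < rho)%R by have := r0; lra.
have rho_eq : rho2 e r2 jj = (rho ^+ 2)%R.
  have eX : ((4 * e * e)%:R = (2 * e)%:R ^+ 2 :> R)%R by rewrite -natrX sqr_2e.
  rewrite /rho2 /rho /jj subKn // eX -(sqr_sqrtr r20) -/r.
  by rewrite !exprMn exprVn -expr2.
have rho_sep : (rho <= (2 * e)%:R * (r / e%:R))%R.
  have -> : ((2 * e)%:R * (r / e%:R) = 2 * r)%R.
    by rewrite natrM -mulrA [X in (_ * X)%R]mulrC mulfVK // gt_eqF.
  rewrite /rho ler_pdivrMr // [X in (_ <= X * _)%R]mulrC -mulrA ler_pM2l //.
  by rewrite -natrM ler_nat (leq_trans i4) // mulnA.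
have covE j c : (sqdist d (Qp j) (Kp c) <= rho2 e r2 jj)%R = covd d Qp Kp rho j c.
  by rewrite rho_eq /covd dist_le // ltW.
have [w [x [hw hin hx hb]]] : exists w x, [/\ w < Z, forall q, q < m -> In w q, x <= k &
  bnd m kap Z In Sg (covd d Qp Kp rho) m w x].
  apply: (@feas_rows R d e M Zc m k kap s0 nb S Z KQ KZ In Sg Qp (r / (e * d)%:R)%R rho (r / e%:R)%R F) => //.
  - by move=> c c' _ _; apply: L3.
  - move=> j hj; have [c [c1 c2 c3]] := Fcovs j hj; exists c; split=> //.
    exact: le_trans c3 rho_s.
  - move=> j hj; have [|c hc [c1 c2]] := HKex j (fun=> Zc) hj; last by exists c.
    by move=> l _; apply: leq_2n.
have [|fk Hout] := Hfin jj hjj.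
  exists w, x; split=> //; apply: bnd_ext hb => // j c _ _.
  by rewrite -covE.
split=> // p hp; have [j hj Hj] := coreset hp.
have [b hb' Hb] := Hout j hj; exists b => //.
apply: le_trans (dist_triangle _ _ (P (q j)) _) _.
have h1 : (dist d (P (q j)) (out b) <= rho)%R by rewrite dist_le ?(ltW rho0) // -rho_eq.
apply: le_trans (lerD (ltW Hj) h1) _.
have -> : ((1 + 8 / e%:R) * opt = opt + 8 * (opt / e%:R))%R by ring.
have e2 : (r / (2 * e)%:R = r / e%:R / 2)%R by rewrite natrM; field; rewrite gt_eqF.
move: rho_le; rewrite e2 /rhos /rad; have := r_e; lra.
Qed.
End Run.
End Approximation.

(** * Running time *)

Definition cand_size (d e k : nat) : nat :=
  (coreset_size d e * k).+1 * (2 * (3 * e * d)).+2 ^ d.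
Definition cand_factor (d e : nat) : nat := 4 * (128 * e ^ 2 * d) ^ d.

Lemma expn_leq m n d : m <= n -> m ^ d <= n ^ d.
Proof. by case: d => // d h; rewrite leq_exp2r. Qed.

Lemma cand_size_le d e k : 0 < d -> 0 < e -> 0 < k ->
  (cand_size d e k).+1 <= k * cand_factor d e.
Proof.
move=> d0 e0 k0; rewrite /cand_size /cand_factor /coreset_size.
have h1 : (2 * (3 * e * d)).+2 <= 8 * e * d by nia.
have h2 := expn_leq d h1.
have -> : 128 * e ^ 2 * d = 16 * e * (8 * e * d) by rewrite expnS expn1; ring.
rewrite (expnMn (16 * e) (8 * e * d)).
have D0 : 0 < (16 * e) ^ d by rewrite expn_gt0; lia.
have B0 : 0 < (8 * e * d) ^ d by rewrite expn_gt0 !muln_gt0 e0 d0.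
move: ((16 * e) ^ d) D0 => D D0.
move: ((2 * (3 * e * d)).+2 ^ d) ((8 * e * d) ^ d) h2 B0 => a b ab b0.
apply: leq_trans (_ : (D * k).+1 * b + 1 <= _).
  by rewrite addn1 ltnS leq_mul2l ab orbT.
apply: leq_trans (_ : (2 * (D * k)) * b + (D * k) * b <= _); last by nia.
by rewrite leq_add // ?muln_gt0 ?D0 ?k0 // leq_mul2r; apply/orP; right; nia.
Qed.

Lemma cand_size_ge d e k : 0 < d -> 16 <= e -> 0 < k ->
  [/\ d * k <= cand_size d e k, cut_size d e <= cand_size d e k,
      (2 * (3 * e * d)).+1 <= cand_size d e k, (3 * e).+1 <= cand_size d e k &
      d <= coreset_size d e].
Proof.
move=> d0 e16 k0; rewrite /cand_size.
have dD : d <= coreset_size d e.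
  apply: leq_trans (ltnW (ltn_expl d (isT : 1 < 2))) _.
  by apply: expn_leq; lia.
have D0 : 0 < coreset_size d e by apply: leq_trans dD.
set B := (2 * (3 * e * d)).+2 ^ d.
have B1 : (2 * (3 * e * d)).+2 <= B by rewrite -{1}(expn1 _.+2) /B leq_pexp2l.
have Dk : 0 < coreset_size d e * k by rewrite muln_gt0 D0.
split=> //.
- apply: leq_trans (_ : (coreset_size d e * k).+1 * 1 <= _).
    by rewrite muln1 leqW // leq_mul2r dD orbT.
  by rewrite leq_mul2l; apply/orP; right; lia.
- have h : 2 * d * d <= B.
    rewrite /B; case: d d0 {dD D0 B B1 Dk} => // -[|d] _; first by lia.
    apply: leq_trans (_ : (2 * (3 * e * d.+2)).+2 ^ 2 <= _); last by rewrite leq_pexp2l.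
    by rewrite expnS expn1; nia.
  apply: leq_trans (_ : coreset_size d e * (2 * d * d) <= _).
    rewrite /cut_size /coreset_size.
    have : (10 * e) ^ d <= (16 * e) ^ d by apply: expn_leq; lia.
    by move: ((10 * e) ^ d) ((16 * e) ^ d) => a b; nia.
  by rewrite leq_mul // leqW // leq_pmulr.
- apply: leq_trans (leq_trans (leqnSn _) B1) _; exact: leq_pmull.
- by apply: leq_trans (leq_trans _ B1) _; [nia|exact: leq_pmull].
Qed.

Section Numeric.
Variables (R : realType) (A : R) (d e : nat).
Local Open Scope ring_scope.
Hypotheses (A2 : 2 <= A) (d0 : (0 < d)%N) (e16 : (16 <= e)%N) (eA : e%:R <= A ^+ 5).

Let A1 : 1 <= A. Proof. by apply: le_trans A2; rewrite ler1n. Qed.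
Let A0 : 0 < A. Proof. by apply: lt_le_trans A1. Qed.
Let e0 : (0 < e)%N. Proof. exact: leq_trans e16. Qed.

Lemma powA_le i j : (i <= j)%N -> A ^+ i <= A ^+ j.
Proof. by move=> h; apply: ler_weXn2l. Qed.

Lemma pow2_le n : (2 ^ n)%:R <= A ^+ n.
Proof. by rewrite natrX lerXn2r // nnegrE ?ler0n // ltW. Qed.

Lemma nat_le_powA n : n%:R <= A ^+ n.
Proof. by apply: le_trans (pow2_le n); rewrite ler_nat ltnW // ltn_expl. Qed.

Lemma const_le n i : (n <= 2 ^ i)%N -> n%:R <= A ^+ i.
Proof. by move=> h; apply: le_trans (pow2_le i); rewrite ler_nat. Qed.

Lemma coreset_le : (coreset_size d e)%:R <= A ^+ (9 * d).
Proof.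
rewrite natrX exprM lerXn2r ?nnegrE ?ler0n ?exprn_ge0 ?(ltW A0) // natrM.
by rewrite (exprD A 4 5) ler_pM ?ler0n // const_le.
Qed.

Lemma cut_le : (cut_size d e)%:R <= A ^+ (12 * d).
Proof.
rewrite !natrM natrX natrM.
have h1 : (10%:R * e%:R) ^+ d <= A ^+ (9 * d).
  rewrite exprM lerXn2r ?nnegrE ?mulr_ge0 ?ler0n ?exprn_ge0 ?(ltW A0) //.
  by rewrite (exprD A 4 5) ler_pM ?ler0n // const_le.
have h2 := nat_le_powA d.
have -> : (12 * d = (d + d) + (9 * d + d))%N by lia.
move: (9 * d)%N h1 => q h1.
rewrite !exprD !ler_pM ?mulr_ge0 ?exprn_ge0 ?mulr_ge0 ?ler0n //.
by apply: le_trans A2 _; rewrite -{1}(expr1 A) powA_le.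
Qed.

Lemma cand_factor_le : (cand_factor d e)%:R <= A ^+ (19 * d) * (d ^ d)%:R.
Proof.
rewrite /cand_factor natrM !natrX !natrM -expr2 !exprMn.
have h1 : 4%:R <= A ^+ (2 * d) :> R.
  by apply: le_trans (const_le (isT : 4 <= 2 ^ 2)%N) _; apply: powA_le; lia.
have h2 : 128%:R ^+ d <= A ^+ (7 * d).
  by rewrite exprM lerXn2r ?nnegrE ?ler0n ?exprn_ge0 ?(ltW A0) // const_le.
have h3 : (e%:R ^+ 2) ^+ d <= A ^+ (10 * d).
  rewrite exprM lerXn2r ?nnegrE ?exprn_ge0 ?ler0n ?(ltW A0) //.
  by rewrite (exprM A 5 2) lerXn2r ?nnegrE ?exprn_ge0 ?ler0n ?(ltW A0).
have -> : (19 * d = 2 * d + (7 * d + 10 * d))%N by lia.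
move: (2 * d)%N (7 * d)%N (10 * d)%N h1 h2 h3 => q1 q2 q3 h1 h2 h3.
rewrite -(exprMn _ e%:R) -expr2 !exprD !mulrA ler_wpM2r ?exprn_ge0 ?ler0n //.
by rewrite !ler_pM ?mulr_ge0 ?exprn_ge0 ?ler0n.
Qed.

Lemma cand_factor_gt0 : (0 < cand_factor d e)%N.
Proof. by rewrite /cand_factor muln_gt0 expn_gt0 !muln_gt0 e0 d0. Qed.

Lemma ln_le (x : R) : 0 < x -> ln x <= x.
Proof.
move=> x0; have := @le_ln1Dx R (x - 1); rewrite [1 + _]addrC subrK => H.
by apply: le_trans (H _) _; lra.
Qed.

Lemma ln_cand_factor : ln (cand_factor d e)%:R <= A ^+ (8 * d).
Proof.
have F0 : 0 < (cand_factor d e)%:R :> R by rewrite ltr0n cand_factor_gt0.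
have dd0 : 0 < (d ^ d)%:R :> R by rewrite ltr0n expn_gt0 d0.
have P0 : 0 < A ^+ (19 * d) by rewrite exprn_gt0.
apply: le_trans (_ : ln (A ^+ (19 * d) * (d ^ d)%:R) <= _).
  by rewrite ler_ln ?posrE ?cand_factor_le // mulr_gt0.
rewrite lnM ?posrE //.
have -> : ln (A ^+ (19 * d)) = (19 * d)%:R * ln A by rewrite (lnXn (19 * d) A0) mulr_natl.
have -> : ln (d ^ d)%:R = d%:R * ln d%:R :> R.
  have d0' : 0 < d%:R :> R by rewrite ltr0n.
  by rewrite natrX (lnXn d d0') mulr_natl.
have h1 : (19 * d)%:R * ln A <= A ^+ (7 * d).
  rewrite natrM.
  apply: le_trans (_ : A ^+ 5 * A ^+ d * A <= _).
    rewrite ler_pM ?mulr_ge0 ?ler0n ?ln_ge0 //; last exact: ln_le.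
    apply: ler_pM; rewrite ?ler0n ?nat_le_powA //; exact: const_le.
  by rewrite -exprD -exprSr powA_le //; lia.
have h2 : d%:R * ln d%:R <= A ^+ (7 * d).
  apply: le_trans (_ : A ^+ d * A ^+ d <= _).
    rewrite ler_pM ?ler0n ?ln_ge0 ?ler1n ?nat_le_powA //.
    by apply: le_trans (ln_le _) (nat_le_powA d); rewrite ltr0n.
  by rewrite -exprD powA_le //; lia.
apply: le_trans (lerD h1 h2) _.
rewrite -mulr2n -mulr_natl; have -> : (8 * d = d + 7 * d)%N by lia.
rewrite exprD ler_wpM2r ?exprn_ge0 ?(ltW A0) //.
by apply: le_trans A2 _; rewrite -{1}(expr1 A) powA_le.
Qed.

Section Subexp.
Variables (k s0 : nat).
Hypotheses (k2 : (1 < k)%N) (s0k : (s0.-1 ^ d < k ^ d.-1)%N).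
Let kap : R := (k%:R : R) `^ (1 - 1 / d%:R).

Let expo : 0 <= 1 - 1 / d%:R :> R.
Proof. by rewrite subr_ge0 ler_pdivrMr ?ltr0n // mul1r ler1n. Qed.

Let kap1 : 1 <= kap.
Proof.
rewrite -[X in X <= _](powRr0 (k%:R : R)) ler_powR // ler1n; exact: ltnW.
Qed.

Lemma s0_le : s0%:R <= 2 * kap.
Proof.
have kapd : kap ^+ d = (k ^ d.-1)%:R.
  rewrite -powR_mulrn ?powR_ge0 // -powRrM natrX -powR_mulrn ?ler0n //; congr (_ `^ _).
  rewrite mulrBl mul1r mul1r mulVf ?pnatr_eq0 -?lt0n //.
  by rewrite -{1}(prednK d0) -natr1 addrK.
have h : s0.-1%:R < kap.
  rewrite ltNge; apply/negP => h.
  have : kap ^+ d <= s0.-1%:R ^+ d by rewrite lerXn2r ?nnegrE ?powR_ge0 ?ler0n.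
  by rewrite kapd -natrX ler_nat leqNgt s0k.
have : s0%:R <= s0.-1%:R + 1 :> R by rewrite natr1 ler_nat; lia.
by have := kap1; lra.
Qed.

Definition row_exp := (2 * d + cut_size d e * s0)%N.

Lemma row_exp_le : row_exp%:R <= A ^+ (15 * d) * kap.
Proof.
rewrite /row_exp natrD (natrM _ 2) (natrM _ (cut_size d e)).
have h1 : 2 * d%:R <= A ^+ (12 * d) * kap.
  apply: le_trans (_ : A ^+ (12 * d) * 1 <= _); last by rewrite ler_wpM2l ?exprn_ge0 ?(ltW A0).
  rewrite mulr1; apply: le_trans (_ : A ^+ d * A ^+ d <= _); last first.
    by rewrite -exprD powA_le //; lia.
  rewrite ler_pM ?ler0n ?nat_le_powA //.
  by apply: le_trans A2 _; rewrite -{1}(expr1 A) powA_le.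
have h2 : (cut_size d e)%:R * s0%:R <= A ^+ (12 * d) * (2 * kap).
  by rewrite ler_pM ?ler0n ?cut_le ?s0_le.
have h3 : 3 * A ^+ (12 * d) <= A ^+ (15 * d).
  have -> : (15 * d = 3 * d + 12 * d)%N by lia.
  rewrite exprD ler_wpM2r ?exprn_ge0 ?(ltW A0) //.
  apply: le_trans (const_le (isT : 3 <= 2 ^ 2)%N) _; apply: powA_le; lia.
apply: le_trans (lerD h1 h2) _.
have -> : A ^+ (12 * d) * kap + A ^+ (12 * d) * (2 * kap) = 3 * A ^+ (12 * d) * kap by ring.
by rewrite ler_wpM2r // powR_ge0.
Qed.

Definition subexp_const : R := 18 * (1 + 1 / ln 2) / ln 2.

Let ln2 : 0 < ln (2 : R). Proof. by rewrite ln_gt0 // ltr1n. Qed.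

Lemma rows_time : (((cand_size d e k).+1 ^ row_exp).+1 ^ 9)%:R <=
  2 `^ (subexp_const * (A ^+ (23 * d) * kap * ln k%:R + d%:R * ln d%:R)).
Proof.
set Y := ((cand_size d e k).+1 ^ row_exp)%N.
have U0 : (0 < row_exp)%N by rewrite /row_exp; lia.
have c1 : (1 < (cand_size d e k).+1)%N by rewrite ltnS /cand_size muln_gt0 expn_gt0.
have Y2 : (1 < Y)%N by rewrite /Y -{1}(exp1n row_exp) ltn_exp2r.
have kG0 : (0 < k * cand_factor d e)%N by rewrite muln_gt0 cand_factor_gt0 andbT; lia.
have Yb : (Y.+1 ^ 9 <= (k * cand_factor d e) ^ (18 * row_exp))%N.
  apply: leq_trans (_ : (Y ^ 2) ^ 9 <= _)%N.
    by apply: expn_leq; rewrite expnS expn1; nia.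
  rewrite -expnM /Y -!expnM [(row_exp * _)%N]mulnC.
  apply: expn_leq; apply: cand_size_le => //; exact: ltnW.
apply: le_trans (_ : ((k * cand_factor d e) ^ (18 * row_exp))%:R <= _); first by rewrite ler_nat.
have k0 : 0 < k%:R :> R by rewrite ltr0n; lia.
have G0 : 0 < (cand_factor d e)%:R :> R by rewrite ltr0n cand_factor_gt0.
rewrite -[X in X <= _]lnK; last by rewrite posrE ltr0n expn_gt0 kG0.
have kG0' : 0 < (k * cand_factor d e)%:R :> R by rewrite ltr0n.
rewrite /powR gt_eqF // ler_expR natrX (lnXn _ kG0') -[X in X <= _]mulr_natl.
rewrite (natrM _ 18) (natrM _ k) lnM ?posrE //.
have lnk : ln (2 : R) <= ln k%:R by rewrite ler_ln ?posrE ?k0 // ler_nat.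
have lnG := ln_cand_factor.
have A8 : 1 <= A ^+ (8 * d) by rewrite exprn_ege1.
set L := ln k%:R in lnk *; set a8 := A ^+ (8 * d) in lnG A8.
have L0 : 0 < L by apply: lt_le_trans lnk.
have h1 : L + ln (cand_factor d e)%:R <= (1 + 1 / ln 2) * (a8 * L).
  have h2 : a8 <= a8 * (L / ln 2) by rewrite ler_peMr ?exprn_ge0 ?(ltW A0) // ler_pdivlMr // mul1r.
  have h3 : L <= a8 * L by rewrite ler_peMl // ltW.
  apply: le_trans (lerD h3 (le_trans lnG h2)) _.
  by rewrite le_eqVlt; apply/orP; left; apply/eqP; field; rewrite gt_eqF.
apply: le_trans (_ : 18 * (A ^+ (15 * d) * kap) * ((1 + 1 / ln 2) * (a8 * L)) <= _).
  rewrite ler_pM ?mulr_ge0 ?ler0n //.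
  - by rewrite addr_ge0 ?(ltW L0) // ln_ge0 // ler1n cand_factor_gt0.
  - by rewrite ler_wpM2l ?row_exp_le.
have -> : subexp_const * (A ^+ (23 * d) * kap * L + d%:R * ln d%:R) * ln 2 =
   18 * (1 + 1 / ln 2) * (A ^+ (23 * d) * kap * L + d%:R * ln d%:R).
  by rewrite /subexp_const; field; rewrite gt_eqF.
have -> : A ^+ (23 * d) = A ^+ (15 * d) * a8 by rewrite /a8 -exprD -mulnDl.
have dd : 0 <= d%:R * ln d%:R :> R by rewrite mulr_ge0 ?ler0n ?ln_ge0 ?ler1n.
have c0 : 0 <= 18 * (1 + 1 / ln 2) :> R.
  by rewrite mulr_ge0 // addr_ge0 // divr_ge0 // ltW.
apply: le_trans (_ : 18 * (1 + 1 / ln 2) * (A ^+ (15 * d) * a8 * kap * L) <= _).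
  by rewrite le_eqVlt; apply/orP; left; apply/eqP; ring.
by rewrite ler_wpM2l // lerDl.
Qed.
End Subexp.
End Numeric.

Section FinalTime.
Variables (R : realType) (A : R) (d e : nat).
Local Open Scope ring_scope.
Hypotheses (A2 : 2 <= A) (d0 : (0 < d)%N) (e16 : (16 <= e)%N) (eA : e%:R <= A ^+ 5).

Let A1 : 1 <= A. Proof. by apply: le_trans A2; rewrite ler1n. Qed.
Let ln2 : 0 < ln (2 : R). Proof. by rewrite ln_gt0 // ltr1n. Qed.

Definition subexp_time (k : nat) : R :=
  2 `^ (subexp_const R * (A ^+ (23 * d) * k%:R `^ (1 - 1 / d%:R) * ln k%:R +
                          d%:R * ln d%:R)).

Lemma subexp_time_ge0 k : 0 <= subexp_time k.
Proof. exact: powR_ge0. Qed.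

Lemma self_exp_le : ((d ^ (18 * d))%:R : R) <= subexp_time 1.
Proof.
have d1 : 0 < d%:R :> R by rewrite ltr0n.
have dd0 : 0 < (d ^ (18 * d))%:R :> R by rewrite ltr0n expn_gt0 d0.
rewrite /subexp_time ln1 mulr0 add0r -[X in X <= _]lnK ?posrE //.
rewrite /powR gt_eqF // ler_expR natrX (lnXn _ d1) -[X in X <= _]mulr_natl natrM.
have -> : subexp_const R * (d%:R * ln d%:R) * ln 2 =
   18 * (1 + 1 / ln 2) * (d%:R * ln d%:R).
  by rewrite /subexp_const; field; rewrite gt_eqF.
rewrite -mulrA ler_wpM2r //.
  by rewrite mulr_ge0 ?ler0n ?ln_ge0 ?ler1n.
by rewrite ler_peMr // lerDl divr_ge0 // ltW.
Qed.

Lemma gonz_time_le n k : (0 < n)%N -> (0 < k)%N ->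
  (((coreset_size d e).+1 ^ 2 * (coreset_size d e * k).+1 * n.+1)%N%:R : R) <=
  A ^+ (31 * d) * (n%:R * k%:R).
Proof.
move=> n0 k0.
have [_ _ _ _ dD] := cand_size_ge d0 e16 k0.
have D0 : (0 < coreset_size d e)%N by apply: leq_trans dD.
have DA := coreset_le d A2 eA.
apply: le_trans (_ : (16 * coreset_size d e ^ 3 * (n * k))%N%:R <= _).
  rewrite ler_nat; move: (coreset_size d e) D0 => D D0.
  have h1 : (D.+1 ^ 2 <= 4 * D ^ 2)%N by rewrite !expnS !expn0; nia.
  have h2 : ((D * k).+1 <= 2 * (D * k))%N by nia.
  have h3 : (n.+1 <= 2 * n)%N by lia.
  apply: leq_trans (leq_mul (leq_mul h1 h2) h3) _.
  by rewrite !expnS !expn0; lia.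
rewrite natrM (natrM _ n) ler_wpM2r ?mulr_ge0 ?ler0n // natrM natrX.
have -> : (31 * d = 4 * d + 27 * d)%N by rewrite -mulnDl.
rewrite exprD ler_pM ?exprn_ge0 ?ler0n //.
  by apply: le_trans (const_le A2 (isT : 16 <= 2 ^ 4)%N) _; apply: powA_le => //; lia.
have -> : (27 * d = 9 * d * 3)%N by rewrite mulnAC.
by rewrite exprM lerXn2r ?nnegrE ?exprn_ge0 ?ler0n // (le_trans ler01).
Qed.

Lemma rows_time1 : (((cand_size d e 1).+1.+1 ^ 9)%:R : R) <=
  A ^+ (360 * d) + subexp_time 1.
Proof.
have H := cand_size_le d0 (leq_trans (isT : 0 < 16)%N e16) (isT : 0 < 1)%N.
rewrite mul1n in H.
have FA := cand_factor_le A2 d0 e16 eA.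
apply: le_trans (_ : (2 * (A ^+ (19 * d) * (d ^ d)%:R)) ^+ 9 <= _).
  rewrite natrX lerXn2r ?nnegrE ?ler0n ?mulr_ge0 ?exprn_ge0 ?ler0n ?(le_trans ler01) //.
  apply: le_trans (_ : 2 * (cand_factor d e)%:R <= _); last by rewrite ler_wpM2l.
  by rewrite -natrM ler_nat; lia.
apply: le_trans (_ : A ^+ (180 * d) * (d ^ (9 * d))%:R <= _).
  rewrite !exprMn -(natrX _ (d ^ d)) -expnM -exprM.
  have -> : (d * 9 = 9 * d)%N by rewrite mulnC.
  rewrite mulrA ler_wpM2r ?ler0n //.
  have -> : (180 * d = 9 * d + 19 * d * 9)%N by lia.
  rewrite exprD ler_wpM2r ?exprn_ge0 ?(le_trans ler01) //.
  apply: le_trans (_ : A ^+ 9 <= _); last by apply: powA_le => //; lia.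
  by rewrite lerXn2r ?nnegrE //; apply: le_trans A1.
have := self_exp_le.
have -> : (360 * d = 180 * d * 2)%N by lia.
have -> : (18 * d = 9 * d * 2)%N by lia.
rewrite (exprM A (180 * d) 2) (expnM d) natrX.
move: (A ^+ (180 * d)) ((d ^ (9 * d))%:R : R) => x y h.
apply: le_trans (lerD (lexx _) h).
rewrite -subr_ge0.
have -> : x ^+ 2 + y ^+ 2 - x * y = ((x - y) ^+ 2 + x ^+ 2 + y ^+ 2) / 2 by field.
by rewrite divr_ge0 // !addr_ge0 ?sqr_ge0.
Qed.

Lemma row_budget k : (0 < k)%N -> exists Y : nat,
  [/\ (cand_size d e k <= Y)%N,
     forall s0, (0 < s0)%N -> (s0 <= k)%N -> (k ^ d.-1 <= s0 ^ d)%N ->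
       (s0.-1 ^ d < k ^ d.-1)%N ->
       ((cand_size d e k).+1 ^
          (if k <= cut_size d e * s0 then k else 2 * d + cut_size d e * s0) <= Y)%N &
     (Y.+1 ^ 9)%:R <= (if k == 1%N then A ^+ (360 * d) else 0) + subexp_time k].
Proof.
move=> k0; case: eqP => [->|/eqP k1].
  exists (cand_size d e 1).+1; split=> [|s0 s00 s01 _ _|]; last exact: rows_time1.
    exact: leqW.
  have -> : s0 = 1%N by lia.
  have M0 : (0 < cut_size d e)%N by rewrite /cut_size !muln_gt0 expn_gt0 d0 muln_gt0; lia.
  by rewrite muln1 M0 expn1.
have k2 : (1 < k)%N by lia.
have ex : exists s, (k ^ d.-1 <= s ^ d)%N.
  by exists k; rewrite leq_pexp2l ?leq_pred.
have [s hs smin] := ex_minnP ex.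
exists ((cand_size d e k).+1 ^ row_exp d e s)%N.
have U0 : (0 < row_exp d e s)%N by rewrite /row_exp; lia.
split=> [|s0 s00 s0k _ hs0|].
- by apply: leq_trans (leqnSn _) _; rewrite -[X in (X <= _)%N]expn1 leq_pexp2l.
- have hss : (s0 <= s)%N.
    have h : (s0.-1 ^ d < s ^ d)%N by apply: leq_trans hs0 hs.
    by rewrite ltn_exp2r // in h; lia.
  have hM : (cut_size d e * s0 <= cut_size d e * s)%N by rewrite leq_mul2l hss orbT.
  rewrite leq_pexp2l // /row_exp; case: ifP => hk.
    by apply: leq_trans hk _; apply: leq_trans hM (leq_addl _ _).
  by rewrite leq_add2l.
- rewrite add0r; apply: rows_time => //.
  rewrite ltnNge; apply/negP => h.
  have := smin _ h; case: s hs {smin U0 h} => [|s] hs; last by rewrite ltnn.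
  by move: hs; rewrite exp0n // leqn0 expn_eq0 => /andP[/eqP]; lia.
Qed.
End FinalTime.

Definition prog_size : nat :=
  csz (gonz 0 0) + csz (setob 0) + csz (stage2 0 0 0 0) + csz (fin 0) +
  csz (mainp 0 0 0 0 0) + 10.

Definition gonz_budget (D k n i : nat) : nat := nth 0 [:: D; D * k; n] i.
Definition row_only (Y i : nat) : nat := nth 0 [:: Y] i.

Lemma large_ctime d D e M Zc k n Y :
  ctime (gonz d D) (gonz_budget D k n) + ctime (setob d) (row_only Y) +
  ctime (stage2 d e M Zc) (row_only Y) + ctime (fin d) (row_only Y) + 10 <=
  prog_size * (D.+1 ^ 2 * (D * k).+1 * n.+1 + Y.+1 ^ 9).
Proof.
rewrite /ctime /wgt.
have -> : dep 0 (gonz d D) = 1 by [].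
have -> : dep 1 (gonz d D) = 1 by [].
have -> : dep 2 (gonz d D) = 1 by [].
have -> : csz (gonz d D) = csz (gonz 0 0) by [].
have -> : csz (stage2 d e M Zc) = csz (stage2 0 0 0 0) by [].
have -> : csz (setob d) = csz (setob 0) by [].
have -> : csz (fin d) = csz (fin 0) by [].
rewrite /gonz_budget /row_only ![nth _ _ _]/= !exp1n !muln1 !expn1.
have h i : i <= 9 -> Y.+1 ^ i <= Y.+1 ^ 9 by move=> hi; rewrite leq_pexp2l.
have h1 : Y.+1 <= Y.+1 ^ 9 := h 1 isT.
have h2 := h (dep 0 (stage2 d e M Zc)).+1 isT.
have h3 := h (dep 0 (fin d)).+1 isT.
have h4 : 0 < Y.+1 ^ 9 by rewrite expn_gt0.
rewrite /prog_size.
set a1 := csz (gonz 0 0); set a2 := csz (setob 0); set a3 := csz (stage2 0 0 0 0).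
set a4 := csz (fin 0); set a5 := csz (mainp 0 0 0 0 0).
move: a1 a2 a3 a4 a5 => a1 a2 a3 a4 a5.
move: (D.+1 ^ 2 * _ * _) => X.
move: (Y.+1 ^ 9) h1 h2 h3 h4 {h} => y h1 h2 h3.
move: (Y.+1 ^ _) h2 (Y.+1 ^ _) h3 => y2 h2 y3 h3 h4.
have g1 : a2 * Y.+1 <= a2 * y by rewrite leq_mul2l h1 orbT.
have g2 : a3 * y2 <= a3 * y by rewrite leq_mul2l h2 orbT.
have g3 : a4 * y3 <= a4 * y by rewrite leq_mul2l h3 orbT.
rewrite mulnDr !mulnDl.
by nia.
Qed.

Lemma small_ctime d D e M Zc Y :
  ctime (mainp d D e M Zc) (row_only Y) <= prog_size * Y.+1 ^ 9.
Proof.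
rewrite /ctime /wgt /row_only ![nth _ _ _]/= !exp1n !muln1.
have -> : csz (mainp d D e M Zc) = csz (mainp 0 0 0 0 0) by [].
by rewrite leq_mul // ?leq_pexp2l // /prog_size; lia.
Qed.

Local Open Scope ring_scope.

Lemma output_approx (R : realType) d k (s : state R) (C : seq 'rV[R]_d) eps :
  0 < eps -> (0 < k)%N ->
  (forall i j, (i < j)%N -> (j < k)%N -> exists2 l, (l < d)%N &
     rmem s (i * d + l) != rmem s (j * d + l)) ->
  (forall p, (p < size C)%N -> exists2 j, (j < k)%N &
     dist d (rowfun (nth 0 C p)) (fun l => rmem s (j * d + l)) <=
       (1 + eps) * kcenter_opt C k) ->
  kcenter_approx eps C k (output d k s).
Proof.
move=> eps0 k0 Hd Hc.
have feas : kcenter_feasible R d k (output d k s).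
  split; last by rewrite size_map size_iota.
  rewrite map_inj_in_uniq ?iota_uniq // => i j; rewrite !mem_iota !add0n /= => ik jk Hij.
  have row l : (l < d)%N -> rmem s (i * d + l) = rmem s (j * d + l).
    by move=> hl; move/rowP: Hij => /(_ (Ordinal hl)); rewrite !mxE.
  apply/eqP; apply/negPn/negP; rewrite neq_ltn => /orP[h|h].
    by have [l hl] := Hd _ _ h jk; rewrite row // eqxx.
  by have [l hl] := Hd _ _ h ik; rewrite row // eqxx.
split=> //; apply/kcenter_cost_le.
- by rewrite mulr_ge0 ?opt_ge0 // addr_ge0 // ltW.
- by rewrite size_map size_iota.
move=> x /(nthP 0)[p hp <-]; have [j jk hj] := Hc p hp.
exists (\row_(l < d) rmem s (j * d + l)%N).
  by apply/mapP; exists j => //; rewrite mem_iota.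
rewrite enormB; apply: le_trans hj; rewrite le_eqVlt; apply/orP; left; apply/eqP.
apply: eq_dist => // l hl; have := rowfunE (\row_(l < d) rmem s (j * d + l)%N) (Ordinal hl).
by rewrite mxE.
Qed.

Lemma inv_eps_ge2 (R : realType) (eps : R) : 0 < eps -> 2 <= inv_eps eps.
Proof.
move=> h; have m0 : 0 < Num.min eps (1 / 2) by rewrite lt_min h divr_gt0.
rewrite /inv_eps ler_pdivlMr // mulrC -ler_pdivlMr //.
by rewrite ge_min lexx orbT.
Qed.

Definition grid_param (R : realType) (eps : R) : nat := (Num.truncn (8 * inv_eps eps)).+1.

Lemma grid_param_spec (R : realType) (eps : R) : 0 < eps ->
  [/\ (16 <= grid_param eps)%N, (grid_param eps)%:R <= inv_eps eps ^+ 5 &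
      8 / (grid_param eps)%:R <= eps].
Proof.
move=> eps0; have A2 := inv_eps_ge2 eps0; set A := inv_eps eps in A2 *.
have A8 : 0 <= 8 * A by lra.
have /andP[h1 h2] := truncn_itv A8; rewrite -/(grid_param eps) in h2.
split.
- by rewrite -(ltr_nat R); apply: le_lt_trans h2; lra.
- have h3 : (grid_param eps)%:R <= 9 * A by rewrite /grid_param -natr1 -/A; lra.
  apply: le_trans h3 _.
  have : 2 ^+ 4 <= A ^+ 4 by rewrite lerXn2r // nnegrE; lra.
  rewrite (exprSr A 4); move: (A ^+ 4) => B hB; nra.
- have m0 : 0 < Num.min eps (1 / 2) by rewrite lt_min eps0 divr_gt0.
  have e0 : 0 < (grid_param eps)%:R :> R by rewrite ltr0n.
  have hA : A * Num.min eps (1 / 2) = 1 by rewrite /A /inv_eps divfK // gt_eqF.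
  have hm : Num.min eps (1 / 2) <= eps by rewrite ge_min lexx.
  rewrite ler_pdivrMr //; nra.
Qed.

Definition kcenter_cmd (R : realType) (d : nat) (eps : R) : cmd :=
  let e := grid_param eps in
  mainp d (coreset_size d e) e (cut_size d e) (3 * e * d).

Definition init_store (R : realType) (d : nat) (eps : R) (C : seq 'rV[R]_d) (k : nat) : ist R :=
  Ist (fun i => nth 0%N [:: size C; k] i) (fun i => nth 0 [:: eps] i)
      (fun _ _ _ => 0%N) (fun a => nth 0 (coords C) a).

Section Run.
Variables (R : realType) (d k : nat) (eps : R) (C : seq 'rV[R]_d).
Hypotheses (d0 : (0 < d)%N) (k0 : (0 < k)%N) (eps0 : 0 < eps) (uC : uniq C).
Let A := inv_eps eps.
Let e := grid_param eps.
Let h := init_store eps C k.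
Let n := size C.

Definition run_good (g : ist R) : Prop :=
  (forall i j, (i < j)%N -> (j < k)%N -> exists2 l, (l < d)%N &
     ra g (i * d + l) != ra g (j * d + l)) /\
  (forall p, (p < n)%N -> exists2 j, (j < k)%N &
     dist d (rowfun (nth 0 C p)) (fun l => ra g (j * d + l)) <=
       (1 + eps) * kcenter_opt C k).

Lemma run_good_cover (g : ist R) (r : nat) (out : nat -> nat -> R) :
  (forall i j, (i < j)%N -> (j < k)%N -> exists2 l, (l < d)%N &
     ra g (i * d + l) != ra g (j * d + l)) ->
  (forall j, (j < r)%N -> exists2 j', (j' < k)%N &
     forall l, (l < d)%N -> ra g (j' * d + l) = out j l) ->
  (forall p, (p < n)%N -> exists2 j, (j < r)%N &
     dist d (ptX d (fun a => nth 0 (coords C) a) p) (out j) <=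
       (1 + eps) * kcenter_opt C k) ->
  run_good g.
Proof.
move=> Hd Ho Hc; split=> // p hp; have [j jr hj] := Hc p hp.
have [j' jk' hj'] := Ho j jr; exists j' => //.
have -> : dist d (rowfun (nth 0 C p)) (fun l => ra g (j' * d + l)) =
    dist d (ptX d (fun a => nth 0 (coords C) a) p) (out j).
  by apply: eq_dist => // l hl; rewrite ?ptP ?hj'.
by [].
Qed.

Definition run_time : R :=
  1024 * prog_size%:R * (n%:R * k%:R * A ^+ (360 * d) + subexp_time A d k).

Let A2 : 2 <= A. Proof. exact: inv_eps_ge2. Qed.
Let e16 : (16 <= e)%N. Proof. by case: (grid_param_spec eps0). Qed.
Let eA : e%:R <= A ^+ 5. Proof. by case: (grid_param_spec eps0). Qed.
Let e8 : 8 / e%:R <= eps. Proof. by case: (grid_param_spec eps0). Qed.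
Let D0 : (0 < coreset_size d e)%N.
Proof. by have [_ _ _ _ dD] := cand_size_ge d0 e16 k0; apply: leq_trans dD. Qed.

Lemma kcenter_run_large : (k < n)%N ->
  (cost (kcenter_cmd d eps) h)%:R <= run_time /\ run_good (run (kcenter_cmd d eps) h).
Proof.
move=> kn; have [Y [hY1 hY2 hY3]] := row_budget A2 d0 e16 eA k0.
have [g1 g2 g3 g4 dD] := cand_size_ge d0 e16 k0.
have n0 : (0 < n)%N by apply: leq_ltn_trans kn.
pose Good f (out : nat -> nat -> R) := forall p, (p < n)%N -> exists2 j, (j < f)%N &
  dist d (ptX d (fun a => nth 0 (coords C) a) p) (out j) <=
    (1 + 8 / e%:R) * kcenter_opt C k.
have HG q r2 f out Hq Hs := @approx_main R d e k C d0 e16 k0 kn uC q r2 Hq f out Hs.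
have leY a : (a <= cand_size d e k)%N -> (a <= row_only Y 0)%N.
  by move=> ha; apply: leq_trans ha hY1.
have [Ht [Hd [f [out [fk Gf Ho]]]]] := @main_large R (gonz_budget (coreset_size d e) k n)
  (row_only Y) d (coreset_size d e) e (cut_size d e) (3 * e * d) n k
  (fun a => nth 0 (coords C) a) h Good
  d0 k0 D0 kn erefl erefl erefl dD (leqnn _) (leqnn _) (leqnn _)
  (leY _ g1) (leY _ g2) (leY _ g3) (leY _ (leqnn _)) (leY _ g4) hY2 HG.
split; last first.
  apply: run_good_cover Hd Ho _ => p hp; have [j jf hj] := Gf p hp.
  exists j => //; apply: le_trans hj _.
  by rewrite ler_wpM2r ?opt_ge0 // lerD2l.
apply: le_trans (_ : (prog_size * _)%N%:R <= _).
  by rewrite ler_nat; apply: leq_trans Ht (large_ctime _ _ _ _ _ _ _ _).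
rewrite /run_time; move: prog_size => K.
rewrite (mulrC 1024) -(mulrA K%:R) natrM ler_wpM2l ?ler0n // natrD.
have G := gonz_time_le A2 d0 e16 eA n0 k0.
have nk1 : 1 <= n%:R * k%:R :> R by rewrite -natrM ler1n muln_gt0 n0.
have a31 : A ^+ (31 * d) <= A ^+ (360 * d) by apply: powA_le => //; rewrite leq_mul2r orbT.
have A360 : 0 <= A ^+ (360 * d) by rewrite exprn_ge0 // (le_trans _ A2).
have S0 := subexp_time_ge0 A d k.
have hY4 : (if k == 1%N then A ^+ (360 * d) else 0) <= n%:R * k%:R * A ^+ (360 * d).
  by case: ifP => _; [rewrite ler_peMl|rewrite mulr_ge0 // (le_trans ler01)].
have G2 := ler_wpM2r (le_trans ler01 nk1) a31.
move: (_%:R) G => x G; move: (_%:R) hY3 => y hY3.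
move: (if _ then _ else _) hY4 hY3 => z hz hy.
move: (A ^+ (31 * d) * _) G2 G => w.
have v0 : 0 <= n%:R * k%:R * A ^+ (360 * d) by rewrite mulr_ge0 // (le_trans ler01).
rewrite [A ^+ _ * _]mulrC; move: (n%:R * k%:R * _) v0 hz => v v0 hz hw G.
by lra.
Qed.

Lemma kcenter_run_small : (n <= k)%N ->
  (cost (kcenter_cmd d eps) h)%:R <= run_time /\ run_good (run (kcenter_cmd d eps) h).
Proof.
move=> nk.
have S0 := subexp_time_ge0 A d k.
have A360 : 0 <= A ^+ (360 * d) by rewrite exprn_ge0 // (le_trans _ A2).
have [Y hY1 hY2] : exists2 Y : nat, (d * k <= Y)%N &
    (Y.+1 ^ 9)%:R <= 2 ^+ 9 * subexp_time A d k.
  have [k1|k1] := eqVneq k 1%N.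
    exists d; rewrite k1 ?muln1 //.
    apply: le_trans (_ : (2 ^ 9 * d ^ (18 * d))%N%:R <= _); last first.
      by rewrite natrM natrX ler_wpM2l ?exprn_ge0 // self_exp_le.
    rewrite ler_nat.
    apply: (@leq_trans ((2 * d) ^ 9)); first by apply: expn_leq; lia.
    by rewrite expnMn leq_mul // leq_pexp2l //; lia.
  have [Y [h1 _]] := row_budget A2 d0 e16 eA k0.
  rewrite (negbTE k1) add0r => h2; exists Y.
    by have [g1 _ _ _ _] := cand_size_ge d0 e16 k0; apply: leq_trans g1 h1.
  by apply: le_trans h2 _; rewrite ler_peMl // exprn_ege1 ?ler1n.
have [Ht [Hd Ho]] := @wp_time R (row_only Y) (kcenter_cmd d eps) _ h isT
  (@main_small R (row_only Y) d (coreset_size d e) e (cut_size d e) (3 * e * d) n k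
    (fun a => nth 0 (coords C) a) h d0 k0 nk erefl erefl erefl hY1).
split; last first.
  clear Ht; apply: (run_good_cover (out := ptX d (fun a => nth 0 (coords C) a)) Hd Ho) => p hp.
  by exists p => //; rewrite distxx mulr_ge0 ?opt_ge0 // addr_ge0 // ltW.
apply: le_trans (_ : (prog_size * Y.+1 ^ 9)%N%:R <= _).
  by rewrite ler_nat; apply: leq_trans Ht (small_ctime _ _ _ _ _ _).
clear Ht Hd Ho; rewrite /run_time; move: prog_size => K.
rewrite (mulrC 1024) -(mulrA K%:R) natrM ler_wpM2l ?ler0n //.
have v0 : 0 <= n%:R * k%:R * A ^+ (360 * d) by rewrite !mulr_ge0.
by apply: le_trans hY2 _; lra.
Qed.
End Run.

Theorem theorem7 (R : realType) :
  exists c0 c1 c2 c3 : R,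
  forall (d : nat) (eps : R), (1 <= d)%N -> 0 < eps ->
  exists P : prog,
  forall (C : seq 'rV[R]_d) (k : nat), uniq C -> (0 < k)%N ->
  exists (t : nat) (s : state R),
    [/\ exec P (input eps C k) t s,
        kcenter_approx eps C k (output d k s) &
        t%:R <= kcenter_time c0 c1 c2 c3 d eps (size C) k].
Proof.
exists (1024 * prog_size%:R), 360, (subexp_const R), 23 => d eps d0 eps0.
exists (comp (kcenter_cmd d eps) nvars) => C k uC k0.
have hsim : sim (init_store eps C k) (input eps C k) by [].
have [s [Hexec [_ _ _ Hmem] _]] := comp_exec (leqnn nvars) (isT : cwf (kcenter_cmd d eps)) hsim.
have [Ht [Hd Hc]] : (cost (kcenter_cmd d eps) (init_store eps C k))%:R <= run_time k eps C /\
    run_good k eps C (run (kcenter_cmd d eps) (init_store eps C k)).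
  by have [nk|kn] := leqP (size C) k; [apply: kcenter_run_small|apply: kcenter_run_large].
exists (cost (kcenter_cmd d eps) (init_store eps C k)), s; split=> //.
  apply: output_approx => // [i j ij jk|p hp].
    by have [l hl hne] := Hd i j ij jk; exists l => //; rewrite !Hmem.
  have [j jk hj] := Hc p hp; exists j => //.
  rewrite (_ : (fun l => _) = fun l => ra (run (kcenter_cmd d eps) (init_store eps C k)) (j * d + l)) //.
  by apply/funext => l; apply: Hmem.
apply: le_trans Ht _; rewrite /run_time /kcenter_time /subexp_time.
have A0 : 0 <= inv_eps eps by apply: le_trans (inv_eps_ge2 eps0).
by rewrite -!natrM !powR_mulrn.
Qed.
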